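(* Let $S_{L;M}(\mathbf{A},\mathbf{B},\mathbf{C},\mathbf{D}\,|\,x,y;v)$ be the weights defined in the context. For any $L,M\in\mathbb{Z}_{>0}$, $x,y,v\in\mathbb{C}$ and compositions $\mathbf{A},\mathbf{B}$ of length $n+1$ with $|\mathbf{A}|=M$, $|\mathbf{B}|=L$, $$\sum_{\mathbf{C},\mathbf{D}}S_{L;M}(\mathbf{A},\mathbf{B},\mathbf{C},\mathbf{D}\,|\,x,y;v)=1,$$ where the sum is over all compositions $\mathbf{C},\mathbf{D}$ of length $n+1$. Furthermore, for any fixed $L,M,T\in\mathbb{Z}_{>0}$, $x,y,z,v\in\mathbb{C}$, and compositions $\mathbf{I}_1,\mathbf{J}_1,\mathbf{K}_1,\mathbf{I}_3,\mathbf{J}_3,\mathbf{K}_3$ of length $n+1$, $$\begin{aligned} \sum_{\mathbf{I}_2,\mathbf{J}_2,\mathbf{K}_2}&S_{L;M}\big(\mathbf{I}_1,\mathbf{J}_1,\mathbf{I}_2,\mathbf{J}_2\,|\,x,y;q^{T-(\mathbf{K}_1)_0}v\big)\,S_{L;T}\big(\mathbf{K}_1,\mathbf{J}_2,\mathbf{K}_2,\mathbf{J}_3\,|\,x,z;v\big)\,S_{M;T}\big(\mathbf{K}_2,\mathbf{I}_2,\mathbf{K}_3,\mathbf{I}_3\,|\,y,z;q^{L-(\mathbf{J}_3)_0}v\big)\\ =\sum_{\mathbf{I}_2,\mathbf{J}_2,\mathbf{K}_2}&S_{M;T}\big(\mathbf{K}_1,\mathbf{I}_1,\mathbf{K}_2,\mathbf{I}_2\,|\,y,z;v\big)\,S_{L;T}\big(\mathbf{K}_2,\mathbf{J}_1,\mathbf{K}_3,\mathbf{J}_2\,|\,x,z;q^{M-(\mathbf{I}_2)_0}v\big)\,S_{L;M}\big(\mathbf{I}_2,\mathbf{J}_2,\mathbf{I}_3,\mathbf{J}_3\,|\,x,y;v\big),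 \end{aligned}$$ where both sums are over all compositions $\mathbf{I}_2,\mathbf{J}_2,\mathbf{K}_2$ of length $n+1$.
   Context: Fix $q\in\mathbb{C}$ and $n\in\mathbb{Z}_{>0}$; $(a;q)_k=\prod_{j=0}^{k-1}(1-q^ja)$. A composition of length $n+1$ is $\mathbf{X}=(X_0,X_1,\dots,X_n)\in\mathbb{Z}_{\ge0}^{n+1}$; $(\mathbf{X})_0=X_0$, $|\mathbf{X}|=\sum_iX_i$ (its size), and $\overline{\mathbf{X}}=(X_1,\dots,X_n)$. For $\lambda,\mu\in\mathbb{Z}_{\ge0}^n$ with $\lambda_i\le\mu_i$ for all $i$, and $|\lambda|=\sum_i\lambda_i$, set $$\Phi(\lambda,\mu;x,y)=\frac{(x;q)_{|\lambda|}(x^{-1}y;q)_{|\mu|-|\lambda|}}{(y;q)_{|\mu|}}\Big(\frac yx\Big)^{|\lambda|}q^{\sum_{1\le i<j\le n}(\mu_i-\lambda_i)\lambda_j}\prod_{i=1}^n\frac{(q;q)_{\mu_i}}{(q;q)_{\lambda_i}(q;q)_{\mu_i-\lambda_i}} .$$ For $L,M\in\mathbb{Z}_{>0}$, if $\mathbf{A}+\mathbf{B}=\mathbf{C}+\mathbf{D}$, $|\mathbf{A}|=M=|\mathbf{C}|$ and $|\mathbf{B}|=L=|\mathbf{D}|$, set $$\begin{aligned} S_{L;M}&(\mathbf{A},\mathbf{B},\mathbf{C},\mathbf{D}\,|\,x,y;v)=q^{MB_0-LC_0+(M-L)(D_0-B_0)+A_0B_0-C_0D_0+\sum_{1\le i<j\le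 n}(D_jC_i-A_jB_i)}\\ &\times\frac{(q^{L-D_0}vx;q)_{D_0}}{(q^{L+M-A_0-B_0}vx;q)_{B_0}}\frac{(q^{L+M-C_0-D_0}vy;q)_{C_0}}{(q^{M-A_0}vy;q)_{A_0}}\prod_{i=0}^n\frac{(q;q)_{A_i}(q;q)_{B_i}}{(q;q)_{C_i}(q;q)_{D_i}}\\ &\times\sum_{\mathbf{P}}\Phi\big(\overline{\mathbf{A}}-\mathbf{P},\overline{\mathbf{A}}+\overline{\mathbf{B}}-\mathbf{P};q^{L-M}xy^{-1},q^{-M}xy^{-1}\big)\,\Phi\big(\mathbf{P},\overline{\mathbf{D}};q^{-L}x^{-1}y,q^{-L}\big), \end{aligned}$$ the sum being over $\mathbf{P}=(P_1,\dots,P_n)\in\mathbb{Z}_{\ge0}^n$ with $P_i\le\min\{A_i,D_i\}$ for $i\in[1,n]$; otherwise $S_{L;M}(\mathbf{A},\mathbf{B},\mathbf{C},\mathbf{D}\,|\,x,y;v)=0$. Parameters are assumed such that all denominators are nonzero (in particular $q\ne0$ is not a root of unity). *)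

(* Defs.v *)
From HB Require Import structures.
From mathcomp Require Export all_boot all_order all_algebra.
From mathcomp Require Export boolp classical_sets functions cardinality fsbigop reals.
From mathcomp Require Export complex.

Set Implicit Arguments.
Unset Strict Implicit.
Unset Printing Implicit Defensive.

Import Order.TTheory GRing.Theory Num.Theory.

Local Open Scope classical_set_scope.
Local Open Scope ring_scope.

(* A composition of length n+1, i.e. an element of Z_{>=0}^{n+1}. *)
Notation composition n := {ffun 'I_n.+1 -> nat}.

(* |l| *)
Definition wt (m : nat) (l : {ffun 'I_m -> nat}) : nat := (\sum_(i < m) l i)%N.

(* (X_0, X_1, ..., X_n) |-> (X_1, ..., X_n) *)
Definition tail (n : nat) (X : composition n) : {ffun 'I_n -> nat} :=
  [ffun i => X (lift ord0 i)].

(* Componentwise truncated subtraction; below it is only applied to l, k with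
   k i <= l i for all i. *)
Definition subc (m : nat) (l k : {ffun 'I_m -> nat}) : {ffun 'I_m -> nat} :=
  [ffun i => (l i - k i)%N].

Definition addc (m : nat) (l k : {ffun 'I_m -> nat}) : {ffun 'I_m -> nat} :=
  [ffun i => (l i + k i)%N].

Section Weights.
Variables (F : fieldType) (q : F).

(* (a; q)_k *)
Definition qpoch (a : F) (k : nat) : F := \prod_(j < k) (1 - q ^+ j * a).

(* Phi(l, m; x, y), meaningful for l i <= m i. *)
Definition Phi (n : nat) (l m : {ffun 'I_n -> nat}) (x y : F) : F :=
  qpoch x (wt l) * qpoch (x^-1 * y) (wt m - wt l) / qpoch y (wt m)
  * (y / x) ^+ wt l
  * q ^+ (\sum_(i < n) \sum_(j < n | (i < j)%N) (m i - l i) * l j)%N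
  * \prod_(i < n) (qpoch q (m i) / (qpoch q (l i) * qpoch q (m i - l i))).

Definition Phi_defined (n : nat) (l m : {ffun 'I_n -> nat}) (x y : F) : Prop :=
  [/\ x != 0, qpoch y (wt m) != 0 &
      forall i : 'I_n, qpoch q (l i) != 0 /\ qpoch q (m i - l i) != 0].

Section Sweight.
Variables (n L M : nat) (A B C D : composition n) (x y v : F).

Definition Sadmissible : bool :=
  [&& addc A B == addc C D,
      wt A == M, wt C == M, wt B == L & wt D == L].

(* The range of P in the definition of S. *)
Definition Srange : set {ffun 'I_n -> nat} :=
  [set P | forall i, (P i <= minn (tail A i) (tail D i))%N].

Definition Sexponent : int :=
  M%:Z * (B ord0)%:Z - L%:Z * (C ord0)%:Z
  + (M%:Z - L%:Z) * ((D ord0)%:Z - (B ord0)%:Z)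
  + (A ord0)%:Z * (B ord0)%:Z - (C ord0)%:Z * (D ord0)%:Z
  + \sum_(i < n.+1) \sum_(j < n.+1 | (0 < i < j)%N)
      ((D j)%:Z * (C i)%:Z - (A j)%:Z * (B i)%:Z).

(* S_{L;M}(A, B, C, D | x, y; v) *)
Definition Sweight : F :=
  if Sadmissible then
    q ^ Sexponent
    * (qpoch (q ^ (L%:Z - (D ord0)%:Z) * v * x) (D ord0)
       / qpoch (q ^ (L%:Z + M%:Z - (A ord0)%:Z - (B ord0)%:Z) * v * x) (B ord0))
    * (qpoch (q ^ (L%:Z + M%:Z - (C ord0)%:Z - (D ord0)%:Z) * v * y) (C ord0)
       / qpoch (q ^ (M%:Z - (A ord0)%:Z) * v * y) (A ord0))
    * \prod_(i < n.+1)
        (qpoch q (A i) * qpoch q (B i) / (qpoch q (C i) * qpoch q (D i)))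
    * \sum_(P \in Srange)
        (Phi (subc (tail A) P) (subc (addc (tail A) (tail B)) P)
             (q ^ (L%:Z - M%:Z) * x * y^-1) (q ^ (- M%:Z) * x * y^-1)
         * Phi P (tail D)
             (q ^ (- L%:Z) * x^-1 * y) (q ^ (- L%:Z)))
  else 0.

(* Division is total, so it has to be required that every denominator
   occurring in the formula for S_{L;M}(A, B, C, D | x, y; v) is nonzero.
   Nothing is required of the weights that are 0 by the "otherwise" clause. *)
Definition Sdefined : Prop :=
  Sadmissible ->
  [/\ x != 0 /\ y != 0,
      qpoch (q ^ (L%:Z + M%:Z - (A ord0)%:Z - (B ord0)%:Z) * v * x) (B ord0)
        != 0,
      qpoch (q ^ (M%:Z - (A ord0)%:Z) * v * y) (A ord0) != 0,
      forall i : 'I_n.+1, qpoch q (C i) != 0 /\ qpoch q (D i) != 0 &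
      forall P, Srange P ->
        Phi_defined (subc (tail A) P) (subc (addc (tail A) (tail B)) P)
          (q ^ (L%:Z - M%:Z) * x * y^-1) (q ^ (- M%:Z) * x * y^-1)
        /\ Phi_defined P (tail D)
          (q ^ (- L%:Z) * x^-1 * y) (q ^ (- L%:Z))].

End Sweight.
End Weights.

(* The operator \sum_(i \in A) of fsbigop is 0 on families with infinite
   support. The next facts show that this never happens for the sums over
   compositions and over P considered here. *)
Lemma finite_box (m k : nat) :
  finite_set [set l : {ffun 'I_m -> nat} | forall i, (l i <= k)%N].
Proof.
pose f (g : {ffun 'I_m -> 'I_k.+1}) : {ffun 'I_m -> nat} := [ffun i => val (g i)].
apply: (@sub_finite_set _ _ (f @` [set: {ffun 'I_m -> 'I_k.+1}])).
  move=> l /= lk; exists [ffun i => inord (l i)] => //.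
  by apply/ffunP => i; rewrite !ffunE /= inordK // ltnS.
exact/finite_image/finite_finset.
Qed.

Lemma finite_wt (m k : nat) :
  finite_set [set l : {ffun 'I_m -> nat} | wt l = k].
Proof.
apply: sub_finite_set (@finite_box m k) => l /= <- i.
by rewrite /wt (bigD1 i) //= leq_addr.
Qed.

Lemma finite_Srange (n : nat) (A D : composition n) : finite_set (Srange A D).
Proof.
apply: sub_finite_set (@finite_box n (wt A)) => P /= PA i.
apply: leq_trans (PA i) _; apply: leq_trans (geq_minl _ _) _.
by rewrite ffunE /wt (bigD1 (lift ord0 i)) //= leq_addr.
Qed.

Lemma Sweight_neq0 (F : fieldType) (q : F) (n L M : nat)
    (A B C D : composition n) (x y v : F) :
  Sweight q L M A B C D x y v != 0 ->
  [/\ wt A = M, wt B = L, wt C = M & wt D = L].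
Proof.
rewrite /Sweight; case: ifP => [/and5P[_ /eqP -> /eqP -> /eqP -> /eqP ->] //|].
by rewrite eqxx.
Qed.

(* Main.v *)
(* Write a = x, b = q^L x for the parameters of a module and c = y, d = q^M y for
   those of another one.  Read from (C, D) to (A, B), the inner sum over P in S is
   a two-step process: U keeps P of the particles D with probability
   Phi(P, D; c/b, a/b) and sends the others to the second module, then V sends
   some of the particles there back, with parameters (b/d, a/d).  Here U exchanges
   a with c and V exchanges b with d, so that the Yang-Baxter equation becomes a
   braid relation for products V U.  It follows from two identities for Phi: an
   associativity, and the exchange relation
     sum_k Phi(k, m; be/al, ga/al) Phi(E-k, D+m-k; al, ga)
       = sum_Q Phi(Q, D; al, be) Phi(E, Q+m; be, ga),
   a vector form of Sears' 4phi3 transformation, which gives at once the braid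
   relations of the U's and of the V's and the commutation UV = VU.  The exchange
   relation is polynomial in be/al, so it is enough to have it for be/al = q^-j,
   where it is reached by induction from j = 0.

   The braid relation holds for generic a_i, b_i, with unbounded occupation
   numbers.  Putting b_i = t^i q^L_i a_i and letting t tend to 1, the configurations
   exceeding the spins disappear thanks to UV = VU; a second limit removes the
   genericity of x, y, z.  Limits are replaced by an algebraic notion for rational
   functions.  The dynamical parameter v and all the other prefactors are gauge
   factors, which telescope.

   For the normalization, the sum over D and then the sum over P are instances of
   the q-Pfaff-Saalschuetz formula, itself a case of the exchange relation. *)
Require Import Defs.
From mathcomp Require Import zify ring.

Set Implicit Arguments.
Unset Strict Implicit.
Unset Printing Implicit Defensive.

Import Order.TTheory GRing.Theory Num.Theory.
Local Open Scope classical_set_scope.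
Local Open Scope ring_scope.

(** The recursion behind the exchange relation moves only [al], to q [al], with [be] and [ga] fixed;
    in the cleared variables this is a -> q a, u -> u / q. Both sides satisfy the same relation, in
    which D stays or loses one letter: the right side term by term, the left side only after
    summation over k, by counting letter removals in two ways. The obstacle to finite spins is that
    R has zeros and poles at b = q^L a. By definition it carries (a/b)_|B| / (a/b)_|D|, and by UV =
    VU also (c/d)_|A| / (c/d)_|C|. An intermediate state above its spin makes a numerator of one
    factor and a denominator of another vanish together, so nothing can be read off at the limit
    point itself; both factorizations are needed to see that one zero survives in the product of
    three. In the normalization, once (q^-L)_|D| is cleared, the terms above the spins vanish, so D
    can range over everything below A + B, where the summation formula applies; v is treated there
    as a polynomial variable. *)

Ltac natlia := repeat match goal with
  | H : is_true (leq _ _) |- _ => revert H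
  | H : @eq nat _ _ |- _ => revert H
  end; clear; lia.

(** * Occupation vectors and sums over the vectors below a given one *)

Section Vectors.
Variable n : nat.
Implicit Types k l m s : {ffun 'I_n -> nat}.

Definition lec l m := [forall i, (l i <= m i)%N].
Definition minc l m : {ffun 'I_n -> nat} := [ffun i => minn (l i) (m i)].
Definition unitc (i : 'I_n) : {ffun 'I_n -> nat} := [ffun j => (j == i) : nat].
Definition zeroc : {ffun 'I_n -> nat} := [ffun=> 0%N].

Lemma lecP l m : reflect (forall i, (l i <= m i)%N) (lec l m).
Proof. exact: forallP. Qed.

Lemma addcE l m i : addc l m i = (l i + m i)%N. Proof. by rewrite ffunE. Qed.
Lemma subcE l m i : subc l m i = (l i - m i)%N. Proof. by rewrite ffunE. Qed.
Lemma mincE l m i : minc l m i = minn (l i) (m i). Proof. by rewrite ffunE. Qed.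
Lemma unitcE i j : unitc i j = (j == i). Proof. by rewrite ffunE. Qed.
Lemma zerocE i : zeroc i = 0%N. Proof. by rewrite ffunE. Qed.

Definition vecE := (addcE, subcE, mincE, zerocE).

Lemma vecP l m : (forall i, l i = m i) <-> l = m.
Proof. by split=> [lm|->] //; apply/ffunP. Qed.

Lemma wt_addc l m : wt (addc l m) = (wt l + wt m)%N.
Proof. by rewrite /wt -big_split; apply: eq_bigr => i _; rewrite addcE. Qed.

Lemma wt_subc l m : lec l m -> wt (subc m l) = (wt m - wt l)%N.
Proof.
move/lecP=> lm; rewrite -[X in (wt X - _)%N](_ : addc (subc m l) l = m).
  by rewrite wt_addc addnK.
by apply/vecP=> i; rewrite !vecE subnK.
Qed.

Lemma wt_le l m : lec l m -> (wt l <= wt m)%N.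
Proof. by move/lecP=> lm; apply: leq_sum => i _. Qed.

Lemma wt_unitc i : wt (unitc i) = 1%N.
Proof.
rewrite /wt (bigD1 i) //= unitcE eqxx big1 // => j /negPf ji.
by rewrite unitcE ji.
Qed.

Lemma le_wt l i : (l i <= wt l)%N.
Proof. by rewrite /wt (bigD1 i) //= leq_addr. Qed.

Lemma wt0_eq l : wt l = 0%N -> l = zeroc.
Proof.
move=> l0; apply/vecP=> i; rewrite zerocE.
by apply/eqP; rewrite -leqn0 -l0 le_wt.
Qed.

Lemma wt_zeroc : wt zeroc = 0%N.
Proof. by rewrite /wt big1 // => i _; rewrite zerocE. Qed.

Lemma lec_refl m : lec m m. Proof. by apply/lecP. Qed.

Lemma lec_trans l m s : lec l m -> lec m s -> lec l s.
Proof.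
by move=> /lecP lm /lecP ms; apply/lecP=> i; apply: leq_trans (lm i) (ms i).
Qed.

Lemma lec_wt_eq l m : lec l m -> wt l = wt m -> l = m.
Proof.
move=> lm e; have /lecP lm' := lm.
have /wt0_eq/vecP h : wt (subc m l) = 0%N by rewrite wt_subc // e subnn.
by apply/vecP=> i; move: (h i) (lm' i); rewrite !vecE; lia.
Qed.

(** A sequence rather than a set, so that sums over it are ordinary big operators without
    finite-support conditions; the lock keeps simplification from unfolding the enumeration. *)
Definition box m : seq {ffun 'I_n -> nat} :=
  locked [seq k <- [seq [ffun i => val (g i)] | g : {ffun 'I_n -> 'I_(wt m).+1}] |
    lec k m].

Lemma mem_box k m : (k \in box m) = lec k m.
Proof.
rewrite /box -lock mem_filter andb_idr // => /lecP km.
apply/mapP; exists [ffun i => inord (k i)]; first by rewrite mem_enum.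
apply/vecP=> i; rewrite !ffunE /= inordK // ltnS.
exact: leq_trans (km i) (le_wt _ _).
Qed.

Lemma box_uniq m : uniq (box m).
Proof.
rewrite /box -lock; apply: filter_uniq; rewrite map_inj_uniq ?enum_uniq // => f g /ffunP fg.
by apply/ffunP=> i; apply: val_inj; move: (fg i); rewrite !ffunE.
Qed.

Section Sums.
Variable V : nmodType.
Implicit Types f g : {ffun 'I_n -> nat} -> V.

Lemma eq_box m f g : (forall k, lec k m -> f k = g k) ->
  \sum_(k <- box m) f k = \sum_(k <- box m) g k.
Proof. by move=> fg; apply: eq_big_seq => k; rewrite mem_box; apply: fg. Qed.

Lemma box0 m f : (forall k, lec k m -> f k = 0) -> \sum_(k <- box m) f k = 0.
Proof. by move=> f0; rewrite (eq_box f0) big1. Qed.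

Lemma box_widen l m f : lec l m ->
  \sum_(k <- box l) f k = \sum_(k <- box m | lec k l) f k.
Proof.
move=> lm; rewrite -[RHS]big_filter; apply: perm_big; apply: uniq_perm.
- exact: box_uniq.
- by rewrite filter_uniq // box_uniq.
move=> k; rewrite mem_box mem_filter mem_box andb_idr // => kl.
exact: lec_trans kl lm.
Qed.

Lemma box_shift l m f : lec l m ->
  \sum_(k <- box (subc m l)) f k = \sum_(s <- box m | lec l s) f (subc s l).
Proof.
move=> /lecP lm; rewrite -[RHS]big_filter -(big_map (fun s => subc s l) xpredT f).
apply: perm_big; apply: uniq_perm; first exact: box_uniq.
  rewrite map_inj_in_uniq ?filter_uniq ?box_uniq // => s t.
  rewrite !mem_filter => /andP[/lecP ls _] /andP[/lecP lt _] /vecP st.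
  apply/vecP=> i; move: (ls i) (lt i) (st i); rewrite !vecE; lia.
move=> k; rewrite mem_box; apply/lecP/mapP => [km|[s]].
  exists (addc k l).
    rewrite mem_filter mem_box; apply/andP; split; apply/lecP=> i.
      by rewrite vecE leq_addl.
    by move: (km i) (lm i); rewrite !vecE; lia.
  by apply/vecP=> i; rewrite !vecE addnK.
rewrite mem_filter mem_box => /andP[/lecP ls /lecP sm] -> i.
by move: (sm i); rewrite !vecE; lia.
Qed.

(** Chains l <= s <= m are parametrized by l and r = s - l; this is the reindexing used to compose
    two averages. *)
Lemma box_exchange m (f : {ffun 'I_n -> nat} -> {ffun 'I_n -> nat} -> V) :
  \sum_(s <- box m) \sum_(l <- box s) f s l =
  \sum_(l <- box m) \sum_(r <- box (subc m l)) f (addc l r) l.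
Proof.
transitivity (\sum_(s <- box m) \sum_(l <- box m | lec l s) f s l).
  by apply: eq_box => s sm; rewrite (box_widen _ sm).
rewrite (exchange_big_dep xpredT) //=; apply: eq_box => l lm.
rewrite (box_shift _ lm); apply: eq_bigr => s /lecP ls; congr (f _ _).
by apply/vecP=> i; rewrite !vecE subnKC.
Qed.

Lemma box_single m l f : lec l m -> (forall k, lec k m -> k != l -> f k = 0) ->
  \sum_(k <- box m) f k = f l.
Proof.
move=> lm f0; rewrite (bigD1_seq l) ?mem_box ?box_uniq //= big_seq_cond big1.
  by rewrite addr0.
by move=> k /andP[]; rewrite mem_box; apply: f0.
Qed.

End Sums.
End Vectors.

(** * q-Pochhammer symbols and inversion counts of coloured words *)

Section Pochhammer.
Variables (F : fieldType) (q : F).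

Lemma qpoch0 a : qpoch q a 0 = 1.
Proof. by rewrite /qpoch big_ord0. Qed.

Lemma qpochSr a k : qpoch q a k.+1 = qpoch q a k * (1 - q ^+ k * a).
Proof. by rewrite /qpoch big_ord_recr. Qed.

Lemma qpochD a i j : qpoch q a (i + j) = qpoch q a i * qpoch q (q ^+ i * a) j.
Proof.
elim: j => [|j IH]; first by rewrite addn0 qpoch0 mulr1.
by rewrite addnS !qpochSr IH -mulrA exprD; congr (_ * (_ * _)); ring.
Qed.

Lemma qpochSl a k : qpoch q a k.+1 = (1 - a) * qpoch q (q * a) k.
Proof. by rewrite -add1n qpochD qpochSr qpoch0 expr0 expr1 !mul1r. Qed.

Lemma qpoch1 a : qpoch q a 1 = 1 - a.
Proof. by rewrite qpochSr qpoch0 expr0 !mul1r. Qed.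

Lemma qpoch_neq0W a i j : (i <= j)%N -> qpoch q a j != 0 -> qpoch q a i != 0.
Proof. by move/subnKC <-; rewrite qpochD mulf_eq0 negb_or => /andP[]. Qed.

Lemma qpoch_eq0W a i j : (i <= j)%N -> qpoch q a i = 0 -> qpoch q a j = 0.
Proof. by move/subnKC <-; rewrite qpochD => ->; rewrite mul0r. Qed.

Section Generic.
Hypotheses (q0 : q != 0) (q1 : forall k, (0 < k)%N -> q ^+ k != 1).

Lemma qq_neq0 k : qpoch q q k != 0.
Proof.
elim: k => [|k IH]; first by rewrite qpoch0 oner_neq0.
by rewrite qpochSr mulf_neq0 // -exprSr subr_eq0 eq_sym q1.
Qed.

Lemma subq_neq0 : 1 - q != 0.
Proof. by rewrite subr_eq0 eq_sym -[q]expr1 q1. Qed.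

Lemma subqX_neq0 k : (0 < k)%N -> 1 - q ^+ k != 0.
Proof. by move=> k0; rewrite subr_eq0 eq_sym q1. Qed.

Definition qint (a : nat) : F := locked ((1 - q ^+ a) / (1 - q)).

Lemma qintE a : qint a = (1 - q ^+ a) / (1 - q).
Proof. by rewrite /qint -lock. Qed.

Lemma qint_neq0 k : (0 < k)%N -> qint k != 0.
Proof. by move=> k0; rewrite qintE mulf_neq0 ?invr_eq0 ?subq_neq0 ?subqX_neq0. Qed.

Lemma qint0 : qint 0 = 0. Proof. by rewrite qintE expr0 subrr mul0r. Qed.

Section Vectors.
Variable n : nat.
Implicit Types k l m s D E : {ffun 'I_n -> nat}.

(* The factor of Phi that is not a function of the sizes: it counts by
   inversions (a 0 before a 1) the words made of n consecutive blocks, the i-th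
   one having m i letters, l i of which are 1. *)
Definition vb m l : F := locked (
  q ^+ (\sum_(i < n) \sum_(j < n | (i < j)%N) (m i - l i) * l j)%N
  * \prod_(i < n) (qpoch q q (m i) / (qpoch q q (l i) * qpoch q q (m i - l i)))).

Lemma vbE m l : vb m l =
  q ^+ (\sum_(i < n) \sum_(j < n | (i < j)%N) (m i - l i) * l j)%N
  * \prod_(i < n) (qpoch q q (m i) / (qpoch q q (l i) * qpoch q q (m i - l i))).
Proof. by rewrite /vb -lock. Qed.

Lemma PhiE l m x y : Phi q l m x y =
  qpoch q x (wt l) * qpoch q (x^-1 * y) (wt m - wt l) / qpoch q y (wt m)
  * (y / x) ^+ wt l * vb m l.
Proof. by rewrite /Phi vbE !mulrA. Qed.

(** Both sides count chains l <= s <= m. The exponents agree for each pair of colours and the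
    factorials for each colour. *)
Lemma vb_assoc l s m : lec l s -> lec s m ->
  vb m s * vb s l = vb m l * vb (subc m l) (subc s l).
Proof.
move=> /lecP ls /lecP sm; rewrite !vbE mulrACA [RHS]mulrACA -!exprD -!big_split /=.
congr (_ ^+ _ * _); apply: eq_bigr => i _.
  rewrite -!big_split; apply: eq_bigr => j _ /=; rewrite !vecE.
  by move: (ls i) (ls j) (sm i) (sm j); nia.
rewrite !vecE (_ : (m i - l i - (s i - l i) = m i - s i)%N); last first.
  by move: (ls i) (sm i); lia.
by field; rewrite !qq_neq0.
Qed.

Lemma vb_id m : vb m m = 1.
Proof.
rewrite vbE !big1 ?expr0 ?mulr1 // => i _.
  by rewrite subnn qpoch0 mulr1 divff // qq_neq0.
by rewrite big1 // => j _; rewrite subnn.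
Qed.

Lemma vb_zero m : vb m (@zeroc n) = 1.
Proof.
rewrite vbE !big1 ?expr0 ?mulr1 // => i _.
  by rewrite zerocE subn0 qpoch0 mul1r divff // qq_neq0.
by rewrite big1 // => j _; rewrite !zerocE muln0.
Qed.

Lemma vb_neq0 l m : vb m l != 0.
Proof.
rewrite vbE mulf_neq0 ?expf_neq0 //; apply/prodf_neq0 => i _.
by rewrite !mulf_neq0 ?invr_eq0 ?mulf_neq0 ?qq_neq0.
Qed.

Lemma qpochq_div (k : nat) : (0 < k)%N ->
  qpoch q q k / (qpoch q q k.-1 * qpoch q q 1) = qint k.
Proof.
case: k => // k _; rewrite /= qpochSr qpoch1 -exprSr qintE; field.
by rewrite qq_neq0 subq_neq0.
Qed.

(** The position [k] is a natural number and not an ordinal, so that both ends k = 0 and k = n are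
    available to telescoping sums. *)
Definition lo m (k : nat) := (\sum_(j < n | (j < k)%N) m j)%N.
Definition hi m (k : nat) := (\sum_(j < n | (k <= j)%N) m j)%N.

Lemma lo0 m : lo m 0 = 0%N. Proof. exact: big_pred0. Qed.
Lemma lon m : lo m n = wt m.
Proof. by rewrite /lo /wt; apply: eq_bigl => j; rewrite ltn_ord. Qed.
Lemma hin m : hi m n = 0%N.
Proof. by apply: big_pred0 => j; rewrite leqNgt ltn_ord. Qed.
Lemma loS m (i : 'I_n) : lo m i.+1 = (lo m i + m i)%N.
Proof.
rewrite /lo (bigD1 i) //= addnC; congr addn; apply: eq_bigl => j.
by rewrite ltnS andbC ltn_neqAle.
Qed.
Lemma hiS m (i : 'I_n) : hi m i = (m i + hi m i.+1)%N.
Proof.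
rewrite /hi (bigD1 i) //=; congr addn; apply: eq_bigl => j.
by rewrite andbC ltn_neqAle eq_sym.
Qed.
Lemma lohi m (k : nat) : (lo m k + hi m k)%N = wt m.
Proof.
rewrite /lo /hi /wt [RHS](bigID (fun j : 'I_n => (j < k)%N)) /=.
by congr addn; apply: eq_bigl => j; rewrite leqNgt.
Qed.
Lemma hi0 m : hi m 0 = wt m. Proof. by rewrite -(lohi m 0) lo0. Qed.
Lemma lo_addc l m (k : nat) : lo (addc l m) k = (lo l k + lo m k)%N.
Proof. by rewrite /lo -big_split; apply: eq_bigr => j _; rewrite vecE. Qed.
Lemma hi_addc l m (k : nat) : hi (addc l m) k = (hi l k + hi m k)%N.
Proof. by rewrite /hi -big_split; apply: eq_bigr => j _; rewrite vecE. Qed.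

Lemma lec_unitc m (i : 'I_n) : (0 < m i)%N -> lec (unitc i) m.
Proof. by move=> mi; apply/lecP=> j; rewrite unitcE; case: eqP => [->|]. Qed.

Lemma subc_unitc_lec m (i : 'I_n) : lec (subc m (unitc i)) m.
Proof. by apply/lecP=> j; rewrite vecE leq_subr. Qed.

Lemma vb_rem m (i : 'I_n) : (0 < m i)%N ->
  vb m (subc m (unitc i)) = q ^+ hi m i.+1 * qint (m i).
Proof.
move=> mi; rewrite vbE; congr (_ ^+ _ * _).
  rewrite (bigD1 i) //= [X in (_ + X)%N]big1 ?addn0 => [|j /negPf ji]; last first.
    by rewrite big1 // => k _; rewrite !vecE unitcE ji subn0 subnn.
  apply: eq_bigr => j ij; rewrite !vecE !unitcE eqxx -[j == i]val_eqE /= gtn_eqF //.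
  by rewrite subn0 subKn // mul1n.
rewrite (bigD1 i) //= [X in _ * X]big1 ?mulr1 => [|j /negPf ji]; last first.
  by rewrite vecE unitcE ji subn0 subnn qpoch0 mulr1 divff // qq_neq0.
by rewrite vecE unitcE eqxx subKn // subn1 qpochq_div.
Qed.

Lemma vb_unit m (i : 'I_n) : (0 < m i)%N ->
  vb m (unitc i) = q ^+ lo m i * qint (m i).
Proof.
move=> mi; rewrite vbE; congr (_ ^+ _ * _).
  rewrite /lo [RHS]big_mkcond; apply: eq_bigr => j _.
  case: ltnP => ji; last first.
    rewrite big1 // => k jk; rewrite [unitc i k]unitcE -val_eqE /= gtn_eqF ?muln0 //.
    exact: leq_ltn_trans ji jk.
  rewrite (bigD1 i) //= big1 ?addn0 => [|k /andP[_ /negPf ki]]; last first.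
    by rewrite [unitc i k]unitcE ki muln0.
  by rewrite !unitcE eqxx -val_eqE /= (ltn_eqF ji) subn0 muln1.
rewrite (bigD1 i) //= [X in _ * X]big1 ?mulr1 => [|j /negPf ji]; last first.
  by rewrite unitcE ji subn0 qpoch0 mul1r divff // qq_neq0.
by rewrite unitcE eqxx subn1 [X in _ / X]mulrC qpochq_div.
Qed.

Lemma sum_telescope (f : nat -> F) :
  \sum_(i < n) (f i - f i.+1) = f 0%N - f n.
Proof.
have := telescope_sumr (fun i => - f i) (leq0n n); rewrite big_mkord => h.
rewrite [RHS]addrC -[f 0%N]opprK -h; apply: eq_bigr => i _.
by rewrite opprK addrC.
Qed.

(** In terms of [hi], removing a letter of colour i contributes a difference of consecutive values
    of q^hi / (1 - q), so the sum telescopes. *)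
Lemma sum_vb_rem m :
  \sum_(i < n | (0 < m i)%N) vb m (subc m (unitc i)) = qint (wt m).
Proof.
rewrite big_mkcond (eq_bigr (fun i : 'I_n =>
  (- q ^+ hi m i) / (1 - q) - (- q ^+ hi m i.+1) / (1 - q))) => [|i _]; last first.
  case: ltnP => mi; first by rewrite vb_rem // hiS exprD !qintE; ring.
  by rewrite hiS (_ : m i = 0%N) ?subrr //; lia.
rewrite (sum_telescope (fun k : nat => - q ^+ hi m k / (1 - q))) hi0 hin !qintE.
by ring.
Qed.

(** The chain l <= m - e_i <= m is read in both orders by [vb_assoc], and the power of q given by
    [hi] of m - l cancels. *)
Lemma vb_dec_rem l m (i : 'I_n) : lec l m -> (l i < m i)%N ->
  q ^+ hi l i.+1 * qint (m i) * vb (subc m (unitc i)) l = vb m l * qint (m i - l i).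
Proof.
move=> lm lmi; have /lecP lm' := lm.
have lmu : lec l (subc m (unitc i)).
  apply/lecP=> j; rewrite vecE unitcE.
  by case: eqP => [->|_]; [lia | rewrite subn0].
have := vb_assoc lmu (subc_unitc_lec m i).
rewrite vb_rem; last by lia.
rewrite (_ : subc (subc m (unitc i)) l = subc (subc m l) (unitc i)); last first.
  by apply/vecP=> j; rewrite !vecE -!subnDA addnC.
rewrite vb_rem vecE; last by lia.
have -> : m = addc l (subc m l) by apply/vecP=> j; rewrite !vecE subnKC.
set d := subc m l; have -> : subc (addc l d) l = d.
  by apply/vecP=> j; rewrite !vecE addKn.
rewrite hi_addc exprD => e; apply: (mulfI (expf_neq0 (hi d i.+1) q0)).
by move: e; rewrite !mulrA => e; rewrite [LHS](_ : _ = q ^+ hi l i.+1 * q ^+ hi d i.+1 *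
   qint (addc l d i) * vb (subc (addc l d) (unitc i)) l); [rewrite e; ring | ring].
Qed.

Lemma vb_dec_both l m (i : 'I_n) : lec l m -> (0 < l i)%N ->
  q ^+ lo (subc m l) i * qint (m i) * vb (subc m (unitc i)) (subc l (unitc i))
  = vb m l * qint (l i).
Proof.
move=> lm li; have /lecP lm' := lm.
have mi : (0 < m i)%N := leq_trans li (lm' i).
have := vb_assoc (lec_unitc li) lm; rewrite !vb_unit //.
have -> : lo m i = (lo (subc m l) i + lo l i)%N.
  by rewrite -lo_addc; congr lo; apply/vecP=> j; rewrite !vecE subnK.
rewrite exprD => e; apply: (mulfI (expf_neq0 (lo l i) q0)).
rewrite [RHS](_ : _ = vb m l * (q ^+ lo l i * qint (l i))); last by ring.
by rewrite e; ring.
Qed.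

(* The two ways of removing one letter from the words counted by vb (m + D) E;
   the powers of q telescope over the colours i. *)
Lemma vb_removal_relation m D E : lec E (addc m D) ->
  q ^+ wt (subc (addc m D) E) *
    (\sum_(i < n | (0 < m i)%N && (0 < E i)%N)
      vb m (unitc i) * vb (subc (addc m D) (unitc i)) (subc E (unitc i)))
  = q ^+ wt m *
    (\sum_(i < n | (0 < D i)%N && (E i < addc m D i)%N)
      vb D (subc D (unitc i)) * vb (subc (addc m D) (unitc i)) E)
    + (q ^+ wt (subc (addc m D) E) - q ^+ wt m) / (1 - q) * vb (addc m D) E.
Proof.
set N := addc m D; move=> EN; have /lecP EN' := EN.
(* [f] is the potential whose total difference is the last term of the statement; the summands are
   then compared colour by colour after multiplication by [N_i]. *)
set B := subc N E; pose f (k : nat) := q ^+ (hi B k + lo m k) / (1 - q) * vb N E.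
have NE i : N i = (m i + D i)%N by rewrite vecE.
have BE i : (m i + D i)%N = (E i + B i)%N by rewrite vecE -NE subnKC.
have hiE (k : nat) : (hi m k + hi D k = hi E k + hi B k)%N.
  by rewrite -!hi_addc; congr hi; apply/vecP=> j; rewrite !addcE BE.
have -> : (q ^+ wt B - q ^+ wt m) / (1 - q) * vb N E = f 0%N - f n.
  by rewrite /f hi0 lo0 hin lon addn0 add0n; ring.
rewrite -(sum_telescope f) !mulr_sumr big_mkcond.
rewrite [X in _ = X + _]big_mkcond -big_split; apply: eq_bigr => i _ /=.
(* Colours absent from N are set apart because [N_i] is cancelled below. *)
have [Ni|Ni] := posnP (N i).
  have m0 : m i = 0%N by move: (NE i); lia.
  have D0 : D i = 0%N by move: (NE i); lia.
  have B0 : B i = 0%N by move: (BE i); lia.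
  by rewrite m0 D0 ltnn /= add0r /f hiS loS B0 m0 add0n addn0 subrr.
set t1 := (X in X = _); set t2 := (X in _ = X + _).
have e1 : t1 * qint (N i) = q ^+ (hi B i + lo m i) * vb N E * (qint (m i) * qint (E i)).
  rewrite /t1; case: ifP => [/andP[mi Ei]|]; last first.
    move/negbT; rewrite negb_and -!eqn0Ngt => /orP[] /eqP ->;
    by rewrite qint0 !(mul0r, mulr0).
  have := vb_dec_both EN Ei; rewrite -/B vb_unit // => e.
  rewrite -(lohi B i) !exprD.
  rewrite [RHS](_ : _ = q ^+ hi B i * q ^+ lo m i * qint (m i) * (vb N E * qint (E i))).
    by rewrite -e; ring.
  by ring.
have e2 : t2 * qint (N i) = q ^+ (hi B i.+1 + lo m i.+1) * vb N E * (qint (D i) * qint (B i)).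
  rewrite /t2; case: ifP => [/andP[Di Ei]|]; last first.
    move/negbT; rewrite negb_and -eqn0Ngt -leqNgt => /orP[/eqP ->|].
      by rewrite qint0 !(mul0r, mulr0).
    move=> Ei; have -> : B i = 0%N by move: (BE i) (NE i); lia.
    by rewrite qint0 !(mul0r, mulr0).
  have := vb_dec_rem EN Ei; rewrite vb_rem // -[(N i - E i)%N]subcE -/B => e.
  rewrite -(lohi m i.+1) !exprD.
  apply: (mulfI (expf_neq0 (hi E i.+1) q0)).
  rewrite [RHS](_ : _ = q ^+ hi E i.+1 * q ^+ hi B i.+1 * q ^+ lo m i.+1 * qint (D i) *
    (vb N E * qint (B i))); last by ring.
  by rewrite -e -[q ^+ hi E _ * _]exprD -hiE exprD; ring.
apply: (mulIf (qint_neq0 Ni)); rewrite mulrDl e1 e2 /f hiS loS NE !qintE !exprD.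
have := f_equal (fun k : nat => q ^+ k) (BE i); rewrite !exprD => e.
have -> : q ^+ B i = q ^+ m i * q ^+ D i / q ^+ E i.
  by rewrite e mulrAC divff ?mul1r // expf_neq0.
by field; rewrite subq_neq0 expf_neq0.
Qed.

End Vectors.
End Generic.
End Pochhammer.

(** * Generic points, polynomial identities and algebraic limits *)

Section RationalLimits.
Variables (F : fieldType) (q : F).
Hypotheses (q0 : q != 0) (q1 : forall k, (0 < k)%N -> q ^+ k != 1).

Lemma qX_inj : injective (fun k : nat => q ^+ k).
Proof.
move=> i j; wlog ij : i j / (i <= j)%N => [h e|].
  by case: (leqP i j) => [/h|/ltnW/h]; [apply | move=> h'; rewrite h'].
rewrite -(subnKC ij) exprD -[q ^+ i in LHS]mulr1 => /(mulfI (expf_neq0 i q0)).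
have [->|] := posnP (j - i)%N; first by rewrite addn0.
by move/q1/eqP=> h /esym /h.
Qed.

Lemma poly_eq0_seq (x : nat -> F) (p : {poly F}) : injective x ->
  (forall j, p.[x j] = 0) -> p = 0.
Proof.
move=> xI p0; apply/eqP; apply: contraT => pn0.
have := max_poly_roots pn0 (rs := [seq x i | i <- iota 0 (size p)]).
rewrite size_map size_iota ltnn => -> //.
  by apply/allP=> _ /mapP[i _ ->]; apply/rootP.
by rewrite map_inj_uniq ?iota_uniq.
Qed.

Lemma poly_eq0_all (p : {poly F}) : (forall t, p.[t] = 0) -> p = 0.
Proof. by move=> p0; apply: (poly_eq0_seq qX_inj). Qed.

(** Truth at all but finitely many points. The polynomial witness turns conjunctions into products,
    and the field is infinite because the powers of q are distinct. *)
Definition cof (P : F -> Prop) :=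
  exists2 e : {poly F}, e != 0 & forall t, e.[t] != 0 -> P t.

Lemma cofT (P : F -> Prop) : (forall t, P t) -> cof P.
Proof. by move=> h; exists 1; rewrite ?oner_neq0. Qed.

Lemma cofI (P Q : F -> Prop) : cof P -> cof Q -> cof (fun t => P t /\ Q t).
Proof.
move=> [e e0 he] [d d0 hd]; exists (e * d); first by rewrite mulf_neq0.
by move=> t; rewrite hornerM mulf_eq0 negb_or => /andP[/he ? /hd ?].
Qed.

Lemma cofW (P Q : F -> Prop) : (forall t, P t -> Q t) -> cof P -> cof Q.
Proof. by move=> h [e e0 he]; exists e => // t /he /h. Qed.

Lemma cofI2 (P Q R : F -> Prop) : (forall t, P t -> Q t -> R t) ->
  cof P -> cof Q -> cof R.
Proof. by move=> h hP hQ; apply: cofW (cofI hP hQ) => t []; apply: h. Qed.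

Lemma cof_neq c : cof (fun t => t != c).
Proof.
exists ('X - c%:P); first by rewrite polyXsubC_eq0.
by move=> t; rewrite hornerXsubC subr_eq0.
Qed.

Lemma cof_poly (p : {poly F}) : p != 0 -> cof (fun t => p.[t] != 0).
Proof. by move=> p0; exists p. Qed.

Lemma cof_eq_poly (p r : {poly F}) : cof (fun t => p.[t] = r.[t]) -> p = r.
Proof.
move=> [e e0 he]; apply/eqP; rewrite -subr_eq0.
have /poly_eq0_all/eqP : forall t, ((p - r) * e).[t] = 0.
  move=> t; rewrite hornerM hornerD hornerN.
  by have [->|/he ->] := eqVneq e.[t] 0; rewrite ?mulr0 // subrr mul0r.
by rewrite mulf_eq0 (negPf e0) orbF.
Qed.

Definition polyfun (f : F -> F) := exists p : {poly F}, forall t, f t = p.[t].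

Lemma polyfun_cst c : polyfun (fun=> c).
Proof. by exists c%:P => t; rewrite hornerC. Qed.
Lemma polyfun_id : polyfun id.
Proof. by exists 'X => t; rewrite hornerX. Qed.
Lemma polyfunD f g : polyfun f -> polyfun g -> polyfun (fun t => f t + g t).
Proof. by move=> [p hp] [r hr]; exists (p + r) => t; rewrite hornerD hp hr. Qed.
Lemma polyfunM f g : polyfun f -> polyfun g -> polyfun (fun t => f t * g t).
Proof. by move=> [p hp] [r hr]; exists (p * r) => t; rewrite hornerM hp hr. Qed.
Lemma polyfunN f : polyfun f -> polyfun (fun t => - f t).
Proof. by move=> [p hp]; exists (- p) => t; rewrite hornerN hp. Qed.
Lemma polyfunX f k : polyfun f -> polyfun (fun t => f t ^+ k).
Proof. by move=> [p hp]; exists (p ^+ k) => t; rewrite horner_exp hp. Qed.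
Lemma polyfun_sum (I : Type) (r : seq I) (P : pred I) (f : I -> F -> F) :
  (forall i, polyfun (f i)) -> polyfun (fun t => \sum_(i <- r | P i) f i t).
Proof.
move=> hf; elim: r => [|i r [p hp]].
  by exists 0 => t; rewrite big_nil horner0.
case: (hf i) => s hs; exists (if P i then s + p else p) => t.
by rewrite big_cons; case: ifP; rewrite ?hornerD -hp ?hs.
Qed.
Lemma polyfun_qpoch f k : polyfun f -> polyfun (fun t => qpoch q (f t) k).
Proof.
move=> [p hp]; exists (\prod_(j < k) (1 - q ^+ j *: p)) => t.
rewrite horner_prod; apply: eq_bigr => j _.
by rewrite hornerD hornerN hornerZ hornerC hp.
Qed.

Lemma polyfun_if (b : bool) (f g : F -> F) : polyfun f -> polyfun g ->
  polyfun (fun t => if b then f t else g t).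
Proof. by case: b. Qed.

Lemma polyfun_eq_cof f g : polyfun f -> polyfun g ->
  cof (fun t => f t = g t) -> forall t, f t = g t.
Proof.
move=> [p hp] [r hr] h t; rewrite hp hr; congr (_.[_]); apply: cof_eq_poly.
by apply: cofW h => s; rewrite hp hr.
Qed.

Lemma polyfun_eq_seq f g (x : nat -> F) : polyfun f -> polyfun g ->
  injective x -> (forall j, f (x j) = g (x j)) -> forall t, f t = g t.
Proof.
move=> [p hp] [r hr] xI h t; rewrite hp hr; congr (_.[_]).
apply/eqP; rewrite -subr_eq0; apply/eqP; apply: (poly_eq0_seq xI) => j.
by rewrite hornerD hornerN -hp -hr h subrr.
Qed.

(* An algebraic substitute for "f t tends to v as t tends to s". *)
Definition alim (s : F) (f : F -> F) (v : F) :=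
  exists p d : {poly F}, [/\ d.[s] != 0, p.[s] / d.[s] = v &
    cof (fun t => f t * d.[t] = p.[t])].

Lemma poly_neq0_at (p : {poly F}) s : p.[s] != 0 -> p != 0.
Proof. by apply: contraNneq => ->; rewrite horner0. Qed.

(** Cross-multiplying the two representations gives polynomials that agree off a finite set, hence
    everywhere, in particular at s. *)
Lemma alim_unique s f v w : alim s f v -> alim s f w -> v = w.
Proof.
move=> [p [d [ds <- h]]] [p' [d' [ds' <- h']]].
have e : p * d' = p' * d.
  apply: cof_eq_poly; apply: cofI2 h h' => t h h'.
  by rewrite !hornerM -h -h' mulrAC.
have := congr1 (horner_eval s) e; rewrite /horner_eval !hornerM => es.
by apply/eqP; rewrite eqr_div // es.
Qed.

(** The exceptional set may contain s, so an identity valid only at generic t can be carried to the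
    limit point. *)
Lemma alim_cofW s f g v : cof (fun t => f t = g t) -> alim s f v -> alim s g v.
Proof.
move=> fg [p [d [ds e h]]]; exists p, d; split=> //.
by apply: cofI2 fg h => t <-.
Qed.

Lemma alim_poly s f : polyfun f -> alim s f (f s).
Proof.
move=> [p hp]; exists p, 1; rewrite hornerC oner_neq0 divr1 -hp; split=> //.
by apply: cofT => t; rewrite hornerC mulr1.
Qed.

Lemma alim_cst s c : alim s (fun=> c) c.
Proof. exact: (alim_poly s (polyfun_cst c)). Qed.
Lemma alim_id s : alim s id s.
Proof. exact: (alim_poly s polyfun_id). Qed.

Lemma alimD s f g v w : alim s f v -> alim s g w ->
  alim s (fun t => f t + g t) (v + w).
Proof.
move=> [p [d [ds <- h]]] [p' [d' [ds' <- h']]].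
exists (p * d' + p' * d), (d * d'); rewrite !(hornerM, hornerD); split.
- by rewrite mulf_neq0.
- by field; rewrite ds ds'.
- by apply: cofI2 h h' => t h h'; rewrite !(hornerM, hornerD) -h -h'; ring.
Qed.

Lemma alimM s f g v w : alim s f v -> alim s g w ->
  alim s (fun t => f t * g t) (v * w).
Proof.
move=> [p [d [ds <- h]]] [p' [d' [ds' <- h']]].
exists (p * p'), (d * d'); rewrite !hornerM; split.
- by rewrite mulf_neq0.
- by field; rewrite ds ds'.
- by apply: cofI2 h h' => t h h'; rewrite !hornerM -h -h'; ring.
Qed.

Lemma alimV s f v : v != 0 -> alim s f v -> alim s (fun t => (f t)^-1) v^-1.
Proof.
move=> v0 [p [d [ds e h]]]; rewrite -e in v0 *.
have ps : p.[s] != 0 by apply: contraNneq v0 => ->; rewrite mul0r.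
exists d, p; split=> //; first by rewrite invf_div.
apply: cofI2 h (cof_poly (poly_neq0_at ps)) => t h pt.
have ft : f t != 0 by apply: contraNneq pt => ft; rewrite -h ft mul0r.
by rewrite -h mulKf.
Qed.

Lemma alimN s f v : alim s f v -> alim s (fun t => - f t) (- v).
Proof.
move=> h; rewrite -mulN1r; apply: alim_cofW (alimM (alim_cst s (-1)) h).
by apply: cofT => t; rewrite mulN1r.
Qed.

Lemma alimX s f v k : alim s f v -> alim s (fun t => f t ^+ k) (v ^+ k).
Proof.
move=> h; elim: k => [|k IH]; first exact: alim_cst.
rewrite exprS; apply: alim_cofW (alimM h IH).
by apply: cofT => t; rewrite exprS.
Qed.

Lemma alim_sum s (I : eqType) (r : seq I) (P : pred I) (f : I -> F -> F) (v : I -> F) :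
  (forall i, i \in r -> P i -> alim s (f i) (v i)) ->
  alim s (fun t => \sum_(i <- r | P i) f i t) (\sum_(i <- r | P i) v i).
Proof.
elim: r => [|i r IH] h.
  rewrite big_nil; apply: alim_cofW (alim_cst s 0).
  by apply: cofT => t; rewrite big_nil.
have {}IH : alim s (fun t => \sum_(i <- r | P i) f i t) (\sum_(i <- r | P i) v i).
  by apply: IH => j jr; apply: h; rewrite in_cons jr orbT.
rewrite big_cons; case: ifP => [Pi|nPi]; last first.
  by apply: alim_cofW IH; apply: cofT => t; rewrite big_cons nPi.
apply: alim_cofW (alimD (h i (mem_head _ _) Pi) IH).
by apply: cofT => t; rewrite big_cons Pi.
Qed.

Lemma alim_qpoch s f v k : alim s f v ->
  alim s (fun t => qpoch q (f t) k) (qpoch q v k).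
Proof.
move=> h; elim: k => [|k IH].
  by rewrite qpoch0; apply: alim_cofW (alim_cst s 1); apply: cofT => t; rewrite qpoch0.
rewrite qpochSr.
have hk := alimD (alim_cst s 1) (alimN (alimM (alim_cst s (q ^+ k)) h)).
by apply: alim_cofW (alimM IH hk); apply: cofT => t; rewrite qpochSr.
Qed.

Lemma alim_cof_neq0 s f v : v != 0 -> alim s f v -> cof (fun t => f t != 0).
Proof.
move=> v0 [p [d [ds e h]]]; rewrite -e in v0 *.
have ps : p.[s] != 0 by apply: contraNneq v0 => ->; rewrite mul0r.
apply: cofI2 h (cof_poly (poly_neq0_at ps)) => t h.
by apply: contraNneq => ft; rewrite -h ft mul0r.
Qed.

End RationalLimits.

Ltac polyfun_tac := repeat first [exact: polyfun_cst | exact: polyfun_id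
  | apply: polyfunM | apply: polyfunD | apply: polyfunN | apply: polyfunX
  | apply: polyfun_qpoch | apply: polyfun_if | (apply: polyfun_sum => ?)].

(** * The vector form of Sears' transformation *)

Section VectorSears.
Variables (F : fieldType) (q : F).
Hypotheses (q0 : q != 0) (q1 : forall k, (0 < k)%N -> q ^+ k != 1).
Variable n : nat.
Implicit Types k l m s D E Q : {ffun 'I_n -> nat}.
Local Notation vb := (vb q).
Local Notation qp := (qpoch q).

Lemma removable m Q (i : 'I_n) : lec Q m ->
  ((0 < m i)%N && lec Q (subc m (unitc i))) = (0 < subc m Q i)%N.
Proof.
move/lecP=> Qm; rewrite vecE subn_gt0; apply/andP/idP => [[mi /lecP/(_ i)]|Qmi].
  by rewrite vecE unitcE eqxx; move: (Qm i); lia.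
split; first by apply: leq_ltn_trans Qmi.
by apply/lecP=> j; rewrite vecE unitcE; move: (Qm j); case: eqP => [->|]; lia.
Qed.

(** A letter removed from D before Q is chosen may as well be removed from D - Q afterwards, by
    [vb_assoc]; [sum_vb_rem] then counts the choices of that letter. *)
Lemma sum_removals D (G : {ffun 'I_n -> nat} -> F) :
  \sum_(i < n | (0 < D i)%N) vb D (subc D (unitc i)) *
    (\sum_(Q <- box (subc D (unitc i))) vb (subc D (unitc i)) Q * G Q)
  = \sum_(Q <- box D) vb D Q * qint q (wt D - wt Q) * G Q.
Proof.
under eq_bigr => i Di.
  rewrite (box_widen _ (subc_unitc_lec D i)) mulr_sumr; over.
rewrite (exchange_big_dep xpredT) //=; apply: eq_box => Q QD.
rewrite -wt_subc // -(sum_vb_rem q0 q1) mulr_sumr mulr_suml.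
apply: eq_big => [i|i /andP[Di Qi]]; first exact: removable.
rewrite mulrA (vb_assoc q0 q1 Qi (subc_unitc_lec _ _)); congr (_ * vb _ _ * _).
by apply/vecP=> j; rewrite !vecE -!subnDA addnC.
Qed.

(** With k written for k + e_i, the two selections become the removal of a letter from k, whose
    total weight is [|k|]. *)
Lemma sum_additions m M (H : {ffun 'I_n -> nat} -> F) : lec M m ->
  \sum_(k <- box M) (\sum_(i < n | (k i < M i)%N)
    vb m k * vb (subc m k) (unitc i) * H (addc k (unitc i)))
  = \sum_(k <- box M) vb m k * qint q (wt k) * H k.
Proof.
move=> Mm; rewrite (exchange_big_dep xpredT) //=.
have step (i : 'I_n) :
  \sum_(k <- box M | (k i < M i)%N)
    vb m k * vb (subc m k) (unitc i) * H (addc k (unitc i)) =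
  \sum_(k <- box M | (0 < k i)%N) vb m k * vb k (subc k (unitc i)) * H k.
  have [Mi|Mi] := posnP (M i).
    rewrite [RHS]big_seq_cond !big1 // => [k /andP[kM ki]|k]; last by rewrite Mi.
    by move: kM; rewrite mem_box => /lecP/(_ i); move: ki; rewrite Mi; lia.
  pose f k := vb m (subc k (unitc i)) * vb (subc m (subc k (unitc i))) (unitc i) * H k.
  have eqa k (ki : (0 < k i)%N) : addc (subc k (unitc i)) (unitc i) = k.
    by apply/vecP=> j; rewrite !vecE unitcE; case: eqP => [->|]; lia.
  transitivity (\sum_(k <- box (subc M (unitc i))) f (addc k (unitc i))).
    rewrite (box_widen _ (subc_unitc_lec M i)) big_seq_cond [RHS]big_seq_cond.
    apply: eq_big => [k|k _]; last first.
      rewrite /f (_ : subc (addc k (unitc i)) (unitc i) = k) //.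
      by apply/vecP=> j; rewrite !vecE addnK.
    rewrite mem_box; apply: andb_id2l => kM.
    by rewrite -subn_gt0 -subcE -(removable i kM) Mi.
  rewrite (box_shift _ (lec_unitc Mi)) big_seq_cond [RHS]big_seq_cond.
  apply: eq_big => [k|k /andP[kM ki]].
    congr (_ && _); apply/lecP/idP => [/(_ i)|ki j]; first by rewrite unitcE eqxx.
    by move/lecP: (lec_unitc ki).
  have {}ki : (0 < k i)%N by move/lecP: ki => /(_ i); rewrite unitcE eqxx.
  have km : lec k m by move: kM; rewrite mem_box => kM; apply: lec_trans kM Mm.
  rewrite eqa // /f (vb_assoc q0 q1 (subc_unitc_lec k i) km); congr (_ * vb _ _ * _).
  by apply/vecP=> j; rewrite !vecE unitcE; case: eqP => [->|_]; rewrite ?subKn // subn0 subnn.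
rewrite (eq_bigr _ (fun i _ => step i)) (exchange_big_dep xpredT) //=.
by apply: eq_box => k kM; rewrite -(sum_vb_rem q0 q1) mulr_sumr mulr_suml.
Qed.

(* In terms of the exchange relation for Phi: a = al, u = be / al, w = ga / be,
   and all denominators are cleared. *)
Definition sears_lterm (a u w : F) (m D E k : nat) : F :=
  qp u k * qp w (m - k) * qp a (E - k) * qp (u * w) (m + D - E) * u ^+ (E - k)
  * qp (u * w * a * q ^+ (m + D - k)) k.

Definition sears_rterm (a u w : F) (m D E Q : nat) : F :=
  qp a Q * qp u (D - Q) * u ^+ Q * qp (u * a) E * qp w (Q + m - E)
  * qp (u * w * a * q ^+ (Q + m)) (D - Q).

Definition sears_lsum (a u w : F) m D E : F :=
  \sum_(k <- box (minc m E)) vb m k * vb (subc (addc m D) k) (subc E k)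
    * sears_lterm a u w (wt m) (wt D) (wt E) (wt k).

(** The guard is needed because, with truncated subtraction, [vb] does not vanish outside its
    range. *)
Definition sears_rsum (a u w : F) m D E : F :=
  qp (u * w) (wt m) * \sum_(Q <- box D) vb D Q *
    (if lec E (addc Q m) then
       vb (addc Q m) E * sears_rterm a u w (wt m) (wt D) (wt E) (wt Q)
     else 0).

Lemma qpoch_shift (a : F) (k : nat) : (1 - a) * qp (q * a) k = qp a k * (1 - q ^+ k * a).
Proof. by rewrite -qpochSl qpochSr. Qed.

Lemma qpoch_unshift (a : F) (k : nat) :
  (1 - a / q) * qp a k = qp (a / q) k * (1 - q ^+ k * a / q).
Proof.
have := qpoch_shift (a / q) k.
by rewrite (_ : q * (a / q) = a) ?mulrA //; field.
Qed.

(** Coefficients of the terms where D is kept and where it loses one letter. They are shared by both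
    sides up to the last factor of (u a)_|D|; the arguments stand for a, u w a and the powers q^|D|
    and q^(|m|+|D|). *)
Definition keepc (a D : F) := (1 - D * a) / D.
Definition dropc (g D N : F) := (1 - q^-1) * (q / D) * (1 - g * N / q).

(** The contiguous relation for one Q: once the common Pochhammer factors are taken out it is a
    rational identity. At Q = D no letter is left to drop. *)
Lemma sears_rterm_step a u w (m D E Q : nat) : (Q <= D)%N ->
  (1 - a) * sears_rterm (q * a) (u / q) w m D E Q =
  keepc a (q ^+ D) * sears_rterm a u w m D E Q +
  (if (Q < D)%N then (1 - u * a * q ^+ D / q) * dropc (u * w * a) (q ^+ D) (q ^+ (m + D))
  * (qint q (D - Q) * sears_rterm a u w m D.-1 E Q) else 0).
Proof.
move=> QD; rewrite /sears_rterm /keepc /dropc.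
have -> : u / q * (q * a) = u * a by field.
have -> : u / q * w * (q * a) = u * w * a by field.
case: ltnP => [|DQ]; last first.
  have -> : D = Q by lia.
  rewrite subnn !qpoch0 addr0 expr_div_n.
  transitivity ((1 - a) * qp (q * a) Q * (u ^+ Q / q ^+ Q) * qp (u * a) E * qp w (Q + m - E)).
    by ring.
  by rewrite qpoch_shift; field; rewrite expf_neq0.
case: D QD => // D _; rewrite ltnS => QD; rewrite /= subSn //.
have -> : (m + D.+1 = Q + m + (D - Q).+1)%N by lia.
rewrite !qpochSr expr_div_n.
transitivity ((1 - a) * qp (q * a) Q * qp (u / q) (D - Q).+1 * (u ^+ Q / q ^+ Q)
  * qp (u * a) E * qp w (Q + m - E)
  * (qp (u * w * a * q ^+ (Q + m)) (D - Q) *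
      (1 - q ^+ (D - Q) * (u * w * a * q ^+ (Q + m))))).
  by rewrite qpochSr; ring.
rewrite qpoch_shift qpochSl (_ : q * (u / q) = u); last by field.
have -> : q ^+ D.+1 = q ^+ Q * q ^+ (D - Q) * q by rewrite -exprD subnKC // exprSr.
rewrite qintE !exprD !exprSr; field.
by rewrite !expf_neq0 // q0 subq_neq0.
Qed.

Lemma sears_rsum_step a u w m D E : lec E (addc m D) ->
  (1 - a) * (1 - u * w * q ^+ wt m / q) * sears_rsum (q * a) (u / q) w m D E =
  (1 - u * w / q) * (keepc a (q ^+ wt D) * sears_rsum a u w m D E +
   (1 - u * a * q ^+ wt D / q) * dropc (u * w * a) (q ^+ wt D) (q ^+ (wt m + wt D)) *
   (\sum_(i < n | (0 < D i)%N && (E i < addc m D i)%N)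
      vb D (subc D (unitc i)) * sears_rsum a u w m (subc D (unitc i)) E)).
Proof.
move=> EN; set c := (1 - _ * _ / _) * dropc _ _ _.
have -> : \sum_(i < n | (0 < D i)%N && (E i < addc m D i)%N)
      vb D (subc D (unitc i)) * sears_rsum a u w m (subc D (unitc i)) E =
   qp (u * w) (wt m) * \sum_(Q <- box D) vb D Q * qint q (wt D - wt Q) *
    (if lec E (addc Q m) then
       vb (addc Q m) E * sears_rterm a u w (wt m) (wt D).-1 (wt E) (wt Q)
     else 0).
  rewrite -sum_removals big_mkcondr mulr_sumr; apply: eq_bigr => i Di.
  have wD : wt (subc D (unitc i)) = (wt D).-1.
    by rewrite wt_subc ?lec_unitc // wt_unitc subn1.
  case: ifP => [_|/negbT]; first by rewrite /sears_rsum wD mulrCA.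
  rewrite -leqNgt => Ni; rewrite box0 ?mulr0 // => Q /lecP/(_ i) QD.
  case: ifP => [/lecP/(_ i) EQ|]; last by rewrite mulr0.
  by move: Ni EQ QD Di; rewrite !vecE unitcE eqxx; lia.
rewrite /sears_rsum (_ : u / q * w = u * w / q); last by field.
have e := qpoch_unshift (u * w) (wt m).
transitivity ((1 - a) * (qp (u * w / q) (wt m) * (1 - q ^+ wt m * (u * w) / q)) *
  \sum_(Q <- box D) vb D Q * (if lec E (addc Q m) then
     vb (addc Q m) E * sears_rterm (q * a) (u / q) w (wt m) (wt D) (wt E) (wt Q) else 0)).
  by ring.
rewrite -e; set S := \sum_(Q <- _) _; set S1 := \sum_(Q <- _) _; set S2 := \sum_(Q <- _) _.
suff h : (1 - a) * S = keepc a (q ^+ wt D) * S1 + c * S2.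
  transitivity ((1 - u * w / q) * qp (u * w) (wt m) * ((1 - a) * S)); first by ring.
  by rewrite h; ring.
rewrite !mulr_sumr -big_split; apply: eq_box => Q QD /=.
case: ifP => [EQ|]; last by rewrite !mulr0 addr0.
transitivity (vb D Q * vb (addc Q m) E *
  ((1 - a) * sears_rterm (q * a) (u / q) w (wt m) (wt D) (wt E) (wt Q))); first by ring.
rewrite sears_rterm_step ?wt_le // -/c; case: ltnP => [_|DQ]; first by ring.
have -> : (wt D - wt Q = 0)%N by lia.
by rewrite qint0; ring.
Qed.

(** On the left the relation fails term by term. The last two lines are the defect, a combination of
    [phi] at k - 1 and k that matches the dropped terms only after summation over k. At k = 0 the
    value of [k.-1] is harmless since [0] = 0. *)
Lemma sears_lterm_step a u w (m D E k : nat) : (k <= m)%N -> (k <= E)%N -> (E <= m + D)%N ->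
  let phi (k : nat) := qp u k * qp w (m - k) * qp a (E - k) * qp (u * w / q) (m + D - E)
    * u ^+ (E - k) * qp (u * w * a * q ^+ (m + D - k) / q) k.+1 in
  (1 - a) * (1 - u * w * q ^+ m / q) * sears_lterm (q * a) (u / q) w m D E k =
  (1 - u * w / q) * (keepc a (q ^+ D) * sears_lterm a u w m D E k) +
  (1 - q^-1) * (q / q ^+ D) *
   (qint q k * (q ^+ (m + D - E) / q ^+ (m - k.-1)) * phi k.-1
    - (q ^+ (m + D - E) - q ^+ (m - k)) / ((1 - q) * q ^+ (m - k)) * phi k).
Proof.
move=> km kE EN /=; rewrite /sears_lterm.
have -> : u / q * w = u * w / q by field.
have -> : u * w / q * (q * a) = u * w * a by field.
rewrite (_ : forall x y z t b c, (1 - u * w / q) * (x * (y * z * t * qp (u * w) (m + D - E) * b * c))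
  = x * (y * z * t * ((1 - u * w / q) * qp (u * w) (m + D - E)) * b * c)); last by move=> *; ring.
rewrite qpoch_unshift expr_div_n /keepc.
rewrite (_ : forall x y z t b c, (1 - a) * x * (y * z * qp (q * a) (E - k) * t * b * c)
  = x * (y * z * ((1 - a) * qp (q * a) (E - k)) * t * b * c)); last by move=> *; ring.
rewrite qpoch_shift.
set P := qp (u * w / q) _.
pose B := (m + D - E)%N; have eB : (B + E = m + D)%N by rewrite /B; lia.
rewrite -/B; clearbody P B.
case: k km kE => [|k] km kE.
  rewrite !subn0 !qpochSr !qpoch0 qint0 !expr0.
  have -> : q ^+ B = q ^+ m * q ^+ D / q ^+ E.
    by rewrite -exprD -eB exprD mulfK // expf_neq0.
  rewrite exprD; field.
  by rewrite !expf_neq0 // q0 subq_neq0.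
rewrite [k.+1.-1]/=.
set N := (m + D)%N.
have -> : (m - k = (m - k.+1).+1)%N by lia.
have -> : (E - k = (E - k.+1).+1)%N by lia.
have eqN : q ^+ (N - k) = q * q ^+ (N - k.+1).
  by rewrite -exprS; congr (_ ^+ _); lia.
rewrite (_ : u * w * a * q ^+ (N - k) / q = u * w * a * q ^+ (N - k.+1)); last first.
  by rewrite eqN; field.
rewrite (qpochSl _ _ k.+1) (_ : q * (u * w * a * q ^+ (N - k.+1) / q) = u * w * a * q ^+ (N - k.+1)); last by field.
set R := qp (u * w * a * _) k.+1.
rewrite (qpochSl _ (u / q)) (_ : q * (u / q) = u); last by field.
rewrite !qpochSr.
have -> : q ^+ B = q ^+ (m - k.+1) * q ^+ D / q ^+ (E - k.+1).
  rewrite -exprD (_ : (m - k.+1 + D = B + (E - k.+1))%N) ?exprD ?mulfK ?expf_neq0 //.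
  by lia.
have -> : q ^+ (N - k.+1) = q ^+ (m - k.+1) * q ^+ D.
  by rewrite -exprD; congr (_ ^+ _); rewrite /N; lia.
have -> : q ^+ m = q * q ^+ k * q ^+ (m - k.+1).
  by rewrite -exprS -exprD; congr (_ ^+ _); lia.
rewrite qintE !exprS; clearbody R.
set qm := q ^+ (m - _); set qE := q ^+ (E - _); set uE := u ^+ (E - _).
field.
by rewrite /qm /qE !expf_neq0 // q0 subq_neq0.
Qed.

(** [phi] of the preceding lemma is the term of a D with one letter fewer, up to 1 - u w / q and the
    last factor of [dropc]. *)
Lemma sears_lterm_drop a u w (m D E k : nat) : (k <= m)%N -> (E < m + D)%N -> (0 < D)%N ->
  (1 - u * w / q) * (1 - u * w * a * q ^+ (m + D) / q) * sears_lterm a u w m D.-1 E k =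
  qp u k * qp w (m - k) * qp a (E - k) * qp (u * w / q) (m + D - E)
    * u ^+ (E - k) * qp (u * w * a * q ^+ (m + D - k) / q) k.+1.
Proof.
case: D => // D km Em _; rewrite /sears_lterm /=.
have -> : (m + D.+1 - E = (m + D - E).+1)%N by lia.
rewrite qpochSl (_ : q * (u * w / q) = u * w); last by field.
have -> : (m + D.+1 - k = (m + D - k).+1)%N by lia.
rewrite (_ : u * w * a * q ^+ (m + D - k).+1 / q = u * w * a * q ^+ (m + D - k)); last first.
  by rewrite exprS; field.
rewrite qpochSr (_ : q ^+ (m + D.+1) = q ^+ k * q ^+ (m + D - k) * q); last first.
  by rewrite -exprD -exprSr; congr (_ ^+ _); lia.
by field.
Qed.

Lemma sears_lsum_step a u w m D E : lec E (addc m D) ->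
  (1 - a) * (1 - u * w * q ^+ wt m / q) * sears_lsum (q * a) (u / q) w m D E =
  (1 - u * w / q) * (keepc a (q ^+ wt D) * sears_lsum a u w m D E +
   dropc (u * w * a) (q ^+ wt D) (q ^+ (wt m + wt D)) *
   (\sum_(i < n | (0 < D i)%N && (E i < addc m D i)%N)
      vb D (subc D (unitc i)) * sears_lsum a u w m (subc D (unitc i)) E)).
Proof.
set N := addc m D; set M := minc m E => EN; have /lecP EN' := EN.
pose phi (k : nat) := qp u k * qp w (wt m - k) * qp a (wt E - k)
  * qp (u * w / q) (wt m + wt D - wt E) * u ^+ (wt E - k)
  * qp (u * w * a * q ^+ (wt m + wt D - k) / q) k.+1.
pose T k := vb (subc N k) (subc E k).
pose S1 k := \sum_(i < n | (k i < M i)%N)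
  vb (subc m k) (unitc i) * T (addc k (unitc i)).
pose S2 k := \sum_(i < n | (0 < D i)%N && (E i < N i)%N)
  vb D (subc D (unitc i)) * vb (subc (subc N k) (unitc i)) (subc E k).
have wN : wt N = (wt m + wt D)%N by rewrite wt_addc.
have EwN : (wt E <= wt m + wt D)%N by rewrite -wN wt_le.
have Mm k : lec k M -> lec k m.
  by move=> /lecP kM; apply/lecP=> i; move: (kM i); rewrite vecE; lia.
have ME k : lec k M -> lec k E.
  by move=> /lecP kM; apply/lecP=> i; move: (kM i); rewrite vecE; lia.
(* For each letter removed from D, [sears_lterm_drop] turns the summand into [phi], which depends on
   sizes alone; [S2] is the coloured part left over. *)
have claimA : (1 - u * w / q) * (dropc (u * w * a) (q ^+ wt D) (q ^+ (wt m + wt D)) *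
   (\sum_(i < n | (0 < D i)%N && (E i < N i)%N)
      vb D (subc D (unitc i)) * sears_lsum a u w m (subc D (unitc i)) E)) =
   (1 - q^-1) * (q / q ^+ wt D) * \sum_(k <- box M) vb m k * (phi (wt k) * S2 k).
  rewrite mulrA [X in X * _](_ : _ = (1 - q^-1) * (q / q ^+ wt D) *
    ((1 - u * w / q) * (1 - u * w * a * q ^+ (wt m + wt D) / q))); last first.
    by rewrite /dropc; ring.
  set c := (1 - q^-1) * (q / q ^+ wt D); clearbody c.
  rewrite -[LHS]mulrA; congr (_ * _).
  under [RHS]eq_bigr => k _ do rewrite /S2 !mulr_sumr.
  rewrite exchange_big mulr_sumr; apply: eq_bigr => i /andP[Di Ei] /=.
  rewrite /sears_lsum !mulr_sumr; apply: eq_box => k kM.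
  have -> : subc (addc m (subc D (unitc i))) k = subc (subc N k) (unitc i).
    apply/vecP=> j; move/lecP: (Mm _ kM) => /(_ j); rewrite !vecE unitcE.
    by case: eqP => [->|_]; lia.
  rewrite wt_subc ?lec_unitc // wt_unitc subn1.
  have D0 : (0 < wt D)%N by apply: leq_trans Di (le_wt _ _).
  have EltN : (wt E < wt m + wt D)%N.
    rewrite -wN ltn_neqAle wt_le // andbT; apply/negP=> /eqP /(lec_wt_eq EN) e.
    by rewrite e ltnn in Ei.
  rewrite /phi -sears_lterm_drop ?wt_le ?Mm //; ring.
(* [vb_removal_relation] for the words m - k and D trades the removals from D in [S2] for removals
   from m - k in [S1]. *)
have claimB k : lec k M -> S2 k = q ^+ (wt m + wt D - wt E) / q ^+ (wt m - wt k) * S1 k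
   - (q ^+ (wt m + wt D - wt E) - q ^+ (wt m - wt k)) / ((1 - q) * q ^+ (wt m - wt k)) * T k.
  move=> kM; have /lecP km := Mm _ kM; have /lecP kE := ME _ kM.
  have eN : addc (subc m k) D = subc N k.
    by apply/vecP=> j; move: (km j); rewrite !vecE; lia.
  have Ek : lec (subc E k) (addc (subc m k) D).
    apply/lecP=> j; move: (km j) (kE j) (EN' j); rewrite !vecE; lia.
  have := vb_removal_relation q0 q1 Ek.
  have -> : wt (subc (addc (subc m k) D) (subc E k)) = (wt m + wt D - wt E)%N.
    rewrite wt_subc // wt_addc !wt_subc ?Mm ?ME //.
    by move: (wt_le (Mm _ kM)) (wt_le (ME _ kM)); lia.
  rewrite eN wt_subc ?Mm // -/(T k).
  have -> : \sum_(i < n | (0 < subc m k i)%N && (0 < subc E k i)%N)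
    vb (subc m k) (unitc i) * vb (subc (subc N k) (unitc i)) (subc (subc E k) (unitc i)) = S1 k.
    apply: eq_big => [i|i _]; first by rewrite !vecE; lia.
    by rewrite /T; congr (_ * vb _ _); apply/vecP=> j; rewrite !vecE -!subnDA.
  have -> : \sum_(i < n | (0 < D i)%N && (subc E k i < subc N k i)%N)
    vb D (subc D (unitc i)) * vb (subc (subc N k) (unitc i)) (subc E k) = S2 k.
    apply: eq_bigl => i; congr (_ && _); move: (km i) (kE i) (EN' i); rewrite !vecE; lia.
  move=> e; have qk := expf_neq0 (wt m - wt k) q0.
  apply: (mulfI qk); rewrite [LHS](_ : _ = q ^+ (wt m - wt k) * S2 k +
    (q ^+ (wt m + wt D - wt E) - q ^+ (wt m - wt k)) / (1 - q) * T k -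
    (q ^+ (wt m + wt D - wt E) - q ^+ (wt m - wt k)) / (1 - q) * T k); last by ring.
  by rewrite -e; field; rewrite qk subq_neq0.
(* [sum_additions] replaces k + e_i by k, which produces the [phi (wt k).-1] of
   [sears_lterm_step]. *)
have claimC : \sum_(k <- box M) vb m k * (phi (wt k) *
    (q ^+ (wt m + wt D - wt E) / q ^+ (wt m - wt k) * S1 k)) =
  \sum_(k <- box M) vb m k * (qint q (wt k) *
    (q ^+ (wt m + wt D - wt E) / q ^+ (wt m - (wt k).-1)) * phi (wt k).-1 * T k).
  pose H k := q ^+ (wt m + wt D - wt E) / q ^+ (wt m - (wt k).-1) * phi (wt k).-1 * T k.
  transitivity (\sum_(k <- box M) vb m k * qint q (wt k) * H k); last first.
    by apply: eq_bigr => k _; rewrite /H; ring.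
  rewrite -sum_additions; last exact/Mm/lec_refl.
  apply: eq_bigr => k _; rewrite /S1 !mulr_sumr; apply: eq_bigr => i _.
  by rewrite /H wt_addc wt_unitc addn1 /=; ring.
rewrite [RHS]mulrDr claimA.
rewrite (eq_box (g := fun k => vb m k * (phi (wt k) *
    (q ^+ (wt m + wt D - wt E) / q ^+ (wt m - wt k) * S1 k)) -
   vb m k * (phi (wt k) * ((q ^+ (wt m + wt D - wt E) - q ^+ (wt m - wt k)) /
     ((1 - q) * q ^+ (wt m - wt k)) * T k)))); last first.
  by move=> k kM; rewrite claimB //; ring.
rewrite sumrB claimC -sumrB /sears_lsum !mulr_sumr -big_split; apply: eq_box => k kM /=.
rewrite -/M -/N -/(T k).
transitivity (vb m k * T k * ((1 - a) * (1 - u * w * q ^+ wt m / q) *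
  sears_lterm (q * a) (u / q) w (wt m) (wt D) (wt E) (wt k))); first by ring.
rewrite sears_lterm_step ?wt_le ?Mm ?ME // -!/(phi _).
by ring.
Qed.

(** Both sides obey one recursion with predecessors D and D - e_i at (a, u), so the hypothesis has
    to cover all D. The two inequalities allow division by the coefficient of the new term. *)
Lemma vector_sears_step a u w m : a != 1 -> 1 - u * w * q ^+ wt m / q != 0 ->
  (forall D E, lec E (addc m D) -> sears_lsum a u w m D E * qp (u * a) (wt D) = sears_rsum a u w m D E) ->
  forall D E, lec E (addc m D) ->
  sears_lsum (q * a) (u / q) w m D E * qp (u / q * (q * a)) (wt D) = sears_rsum (q * a) (u / q) w m D E.
Proof.
move=> a1 c0 IH D E EN.
have {}a1 : 1 - a != 0 by rewrite subr_eq0 eq_sym.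
apply: (mulfI (mulf_neq0 a1 c0)); rewrite sears_rsum_step // [LHS]mulrA sears_lsum_step // -IH //.
have -> : u / q * (q * a) = u * a by field.
set d := dropc _ _ _; set S := \sum_(i < n | _) _; set S' := \sum_(i < n | _) _.
suff -> : (1 - u * a * q ^+ wt D / q) * d * S' = d * (S * qp (u * a) (wt D)) by ring.
rewrite -mulrA mulrCA; congr (_ * _); rewrite mulr_suml mulr_sumr.
apply: eq_bigr => i /andP[Di Ei]; rewrite -IH; last first.
  apply/lecP=> j; move/lecP: EN => /(_ j); rewrite !vecE unitcE.
  by case: eqP => [->|_]; move: Ei; rewrite vecE; lia.
rewrite wt_subc ?lec_unitc // wt_unitc subn1.
have : (0 < wt D)%N by apply: leq_trans Di (le_wt _ _).
by case: (wt D) => // p _; rewrite qpochSr exprS /=; field.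
Qed.

(** At u = 1 the symbol (u;q)_k vanishes for k > 0, which leaves k = 0 on the left and Q = D on the
    right. *)
Lemma vector_sears_base a w m D E : lec E (addc m D) ->
  sears_lsum a 1 w m D E * qp (1 * a) (wt D) = sears_rsum a 1 w m D E.
Proof.
have q10 (k : nat) : (0 < k)%N -> qp 1 k = 0.
  by case: k => // k _; rewrite qpochSl subrr mul0r.
have wt_gt0 k : k != zeroc n -> (0 < wt k)%N.
  by apply: contraNltn; rewrite leqn0 => /eqP/wt0_eq ->.
move=> EN; rewrite /sears_lsum (@box_single _ _ _ (zeroc n)); first last.
- by move=> k _ k0; rewrite /sears_lterm q10 ?wt_gt0 // !mul0r mulr0.
- by apply/lecP=> i; rewrite !vecE.
rewrite /sears_rsum (@box_single _ _ _ D) ?lec_refl //; last first.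
  move=> Q QD nQD; rewrite /sears_rterm q10; first by rewrite mulr0 !mul0r mulr0 if_same mulr0.
  rewrite -wt_subc // wt_gt0 //; apply: contraNneq nQD => /vecP h.
  apply/eqP/vecP=> i; move: (h i); rewrite !vecE; move/lecP: QD => /(_ i); lia.
have -> : addc D m = addc m D by apply/vecP=> i; rewrite !vecE addnC.
have subc0 k : subc k (zeroc n) = k by apply/vecP=> i; rewrite !vecE subn0.
rewrite EN vb_zero // vb_id // !subc0 /sears_lterm /sears_rterm wt_zeroc !subn0 subnn !qpoch0.
by rewrite !mul1r !expr1n [(wt m + wt D)%N]addnC; ring.
Qed.

Lemma vector_sears_pow (j : nat) a w m D E : lec E (addc m D) ->
  sears_lsum a (q^-1 ^+ j) w m D E * qp (q^-1 ^+ j * a) (wt D) = sears_rsum a (q^-1 ^+ j) w m D E.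
Proof.
elim: j a w m D E => [|j IH] a w m D E EN; first exact: vector_sears_base.
rewrite exprSr; set u := q^-1 ^+ j.
have u0 : u != 0 by rewrite expf_neq0 // invr_eq0.
pose f a' w' := sears_lsum a' (u / q) w' m D E * qp (u / q * a') (wt D).
pose g a' w' := sears_rsum a' (u / q) w' m D E.
suff h : forall w' a', f a' w' = g a' w' by apply: h.
(* w' = [c] and a' = q are the values at which the coefficient of [vector_sears_step] vanishes; they
   are recovered by polynomiality in w' and a'. *)
pose c := q / (u * q ^+ wt m).
have gen w' a' : w' != c -> a' != q -> f a' w' = g a' w'.
  move=> wc aq; rewrite /f /g (_ : a' = q * (a' / q)); last by field.
  apply: vector_sears_step (fun D E => IH _ _ _ D E) _ _ EN.
    by apply: contraNneq aq => /(canRL (divfK q0)) ->; rewrite mul1r.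
  apply: contraNneq wc => /eqP; rewrite subr_eq0 eq_sym => /eqP e; rewrite /c.
  have qm := expf_neq0 (wt m) q0.
  by apply/eqP; apply: (mulIf (mulf_neq0 u0 qm)); rewrite divfK ?mulf_neq0 // -[q in RHS]mul1r -e; rewrite -/u; field.
move=> w' a'; apply: (polyfun_eq_cof q0 q1 (f := f a') (g := g a')).
- by rewrite /f /sears_lsum /sears_lterm; polyfun_tac.
- by rewrite /g /sears_rsum /sears_rterm; polyfun_tac.
apply: cofW (cof_neq c) => {}w' wc.
apply: (polyfun_eq_cof q0 q1 (f := f^~ w') (g := g^~ w')).
- by rewrite /f /sears_lsum /sears_lterm; polyfun_tac.
- by rewrite /g /sears_rsum /sears_rterm; polyfun_tac.
by apply: cofW (cof_neq q) => {}a' aq; apply: gen.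
Qed.

Theorem vector_sears a u w m D E : lec E (addc m D) ->
  sears_lsum a u w m D E * qp (u * a) (wt D) = sears_rsum a u w m D E.
Proof.
move=> EN; move: u; apply: (polyfun_eq_seq (x := fun j : nat => q^-1 ^+ j)).
- by rewrite /sears_lsum /sears_lterm; polyfun_tac.
- by rewrite /sears_rsum /sears_rterm; polyfun_tac.
- move=> i j; rewrite !exprVn => /invr_inj; exact: qX_inj.
- by move=> j; apply: vector_sears_pow.
Qed.

End VectorSears.

(** * Associativity and exchange for averages against Phi *)

Section Operators.
Variables (F : fieldType) (q : F).
Hypotheses (q0 : q != 0) (q1 : forall k, (0 < k)%N -> q ^+ k != 1).
Variable n : nat.
Local Notation vec := {ffun 'I_n -> nat}.
Implicit Types k l m s D E Q N A B C : vec.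
Local Notation vb := (vb q).
Local Notation qp := (qpoch q).
Local Notation Phi := (Phi q).

Lemma minc_lecl l m : lec (minc l m) l.
Proof. by apply/lecP=> i; rewrite vecE geq_minl. Qed.

(** [vector_sears] with its denominators restored. The factor (ga/al)_|m| stays multiplied out so
    that the relation survives at its zeros, which occur at finite spin. *)
Lemma Phi_exchange al be ga m D E : al != 0 -> be != 0 -> ga != 0 ->
  qp be (wt D) != 0 -> qp ga (wt m + wt D) != 0 -> lec E (addc m D) ->
  \sum_(k <- box (minc m E)) vb m k * (qp (be / al) (wt k) *
     qp (ga / be) (wt m - wt k) * (ga / be) ^+ wt k) *
     Phi (subc E k) (subc (addc m D) k) al ga
  = qp (ga / al) (wt m) * \sum_(Q <- box D) Phi Q D al be *
     (if lec E (addc Q m) then Phi E (addc Q m) be ga else 0).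
Proof.
move=> al0 be0 ga0 hbe hga EN.
have := vector_sears q0 q1 al (be / al) (ga / be) EN.
have -> : be / al * al = be by field.
set N := addc m D; have wN : wt N = (wt m + wt D)%N by rewrite wt_addc.
have EwN : (wt E <= wt m + wt D)%N by rewrite -wN wt_le.
have gaE : be / al * (ga / be) = ga / al by field; rewrite al0 be0.
have gaE' : be / al * (ga / be) * al = ga by field; rewrite al0 be0.
have c0 : qp ga (wt m + wt D) * qp be (wt D) != 0 by rewrite mulf_neq0.
move=> e; apply: (mulIf c0).
transitivity ((ga / be) ^+ wt E * (sears_lsum q al (be / al) (ga / be) m D E * qp be (wt D))).
  rewrite /sears_lsum !mulr_suml mulr_sumr; apply: eq_box => k kM.
  have km : lec k m by move/lecP: kM => kM; apply/lecP=> i; move: (kM i); rewrite vecE; natlia.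
  have kE : lec k E by move/lecP: kM => kM; apply/lecP=> i; move: (kM i); rewrite vecE; natlia.
  have kN : lec k N by apply: lec_trans kE EN.
  rewrite PhiE /sears_lterm gaE' gaE !wt_subc // wN.
  have wkm := wt_le km; have wkE := wt_le kE.
  have -> : (wt m + wt D - wt k - (wt E - wt k) = wt m + wt D - wt E)%N by natlia.
  have hgak : qp ga (wt m + wt D - wt k) != 0 by apply: qpoch_neq0W hga; natlia.
  have -> : qp ga (wt m + wt D) = qp ga (wt m + wt D - wt k) *
     qp (ga * q ^+ (wt m + wt D - wt k)) (wt k).
    by rewrite [ga * _]mulrC -qpochD subnK //; natlia.
  have -> : al^-1 * ga = ga / al by rewrite mulrC.
  have -> : (ga / be) ^+ wt E = (ga / be) ^+ wt k * (ga / be) ^+ (wt E - wt k).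
    by rewrite -exprD subnKC.
  have -> : (ga / al) ^+ (wt E - wt k) = (ga / be) ^+ (wt E - wt k) * (be / al) ^+ (wt E - wt k).
    by rewrite -exprMn; congr (_ ^+ _); field; rewrite al0 be0.
  move: (vb _ _) (vb _ _) ((ga / be) ^+ _) ((ga / be) ^+ _) ((be / al) ^+ _) => *.
  by field.
rewrite e /sears_rsum gaE mulrCA -[RHS]mulrA; congr (_ * _).
rewrite mulr_suml mulr_sumr; apply: eq_box => Q QD.
case: ifP => EQ; last by rewrite !(mulr0, mul0r).
rewrite !PhiE /sears_rterm gaE' wt_addc.
have -> : be / al * al = be by field.
have wQ := wt_le QD.
have hgaQ : qp ga (wt Q + wt m) != 0 by apply: qpoch_neq0W hga; natlia.
have -> : qp ga (wt m + wt D) = qp ga (wt Q + wt m) *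
   qp (ga * q ^+ (wt Q + wt m)) (wt D - wt Q).
  by rewrite [ga * _]mulrC -qpochD; congr qpoch; natlia.
have -> : al^-1 * be = be / al by rewrite mulrC.
have -> : be^-1 * ga = ga / be by rewrite mulrC.
move: (vb _ _) (vb _ _) ((ga / be) ^+ _) ((be / al) ^+ _) => *.
by field; rewrite hgaQ hbe.
Qed.

Definition Ex (x y : F) m (g : vec -> F) : F := \sum_(l <- box m) Phi l m x y * g l.

Lemma eq_Ex x y m g g' : (forall l, lec l m -> g l = g' l) -> Ex x y m g = Ex x y m g'.
Proof. by move=> e; apply: eq_box => l lm; rewrite e. Qed.

Lemma Ex_swap x y m x' y' m' (g : vec -> vec -> F) :
  Ex x y m (fun l => Ex x' y' m' (g l)) = Ex x' y' m' (fun l' => Ex x y m (g^~ l')).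
Proof.
rewrite /Ex; under [LHS]eq_bigr => l _ do rewrite mulr_sumr.
under [RHS]eq_bigr => l _ do rewrite mulr_sumr.
by rewrite [RHS]exchange_big; do 2![apply: eq_bigr => ? _]; rewrite mulrCA.
Qed.

(** Keeping s out of m and then l out of s amounts to keeping l and then s - l out of m - l: the
    symbols (Y)_|s| cancel and [vb_assoc] handles the colours. *)
Lemma Phi_assoc l s m X Y Z : X != 0 -> Y != 0 -> qp Y (wt m) != 0 ->
  qp (Z / X) (wt m) != 0 -> lec l s -> lec s m ->
  Phi s m Y Z * Phi l s X Y =
  Phi l m X Z * Phi (subc s l) (subc m l) (Y / X) (Z / X).
Proof.
move=> X0 Y0 hY hZX ls sm; have lm := lec_trans ls sm.
rewrite !PhiE !wt_subc //.
have wls := wt_le ls; have wsm := wt_le sm.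
have -> : (wt m - wt l - (wt s - wt l) = wt m - wt s)%N by natlia.
have hYs : qp Y (wt s) != 0 by apply: qpoch_neq0W hY.
have hZXs : qp (Z / X) (wt m - wt l) != 0 by apply: qpoch_neq0W hZX; natlia.
have -> : (Y / X)^-1 * (Z / X) = Y^-1 * Z by field; rewrite ?X0 ?Y0.
have -> : Y / X = X^-1 * Y by rewrite mulrC.
rewrite -[X^-1 * Z]mulrC.
have -> : (Z / Y) ^+ wt s = (Z / Y) ^+ wt l * (Z / Y) ^+ (wt s - wt l).
  by rewrite -exprD subnKC.
have -> : (Z / X) / (X^-1 * Y) = Z / Y by field; rewrite ?X0 ?Y0.
have -> : (Z / X) ^+ wt l = (Z / Y) ^+ wt l * (X^-1 * Y) ^+ wt l.
  by rewrite -exprMn; congr (_ ^+ _); field; rewrite ?X0 ?Y0.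
have e := vb_assoc q0 q1 ls sm.
set c1 := vb m s in e *; set c2 := vb s l in e *.
set c3 := vb m l in e *; set c4 := vb _ _ in e *.
set d1 := _ ^+ wt l; set d2 := _ ^+ wt l; set d3 := _ ^+ _.
transitivity (qp (Y^-1 * Z) (wt m - wt s) / qp Z (wt m) * (d1 * d3) * qp X (wt l) *
  qp (X^-1 * Y) (wt s - wt l) * d2 * (c1 * c2)).
  by move: (qp Z _)^-1 => t; field.
by rewrite e; move: (qp Z _)^-1 => t; field.
Qed.

Lemma Ex_assoc X Y Z m (g : vec -> vec -> F) : X != 0 -> Y != 0 ->
  qp Y (wt m) != 0 -> qp (Z / X) (wt m) != 0 ->
  Ex Y Z m (fun s => Ex X Y s (fun l => g l (subc s l))) =
  Ex X Z m (fun l => Ex (Y / X) (Z / X) (subc m l) (g l)).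
Proof.
move=> X0 Y0 hY hZX; rewrite /Ex.
under eq_bigr => s _ do rewrite mulr_sumr.
rewrite (box_exchange m (fun s l => Phi s m Y Z * (Phi l s X Y * g l (subc s l)))).
apply: eq_box => l lm; rewrite mulr_sumr; apply: eq_box => r rml.
have e : subc (addc l r) l = r by apply/vecP=> i; rewrite !vecE addKn.
rewrite e [LHS](_ : _ = Phi (addc l r) m Y Z * Phi l (addc l r) X Y * g l r); last by ring.
rewrite Phi_assoc // ?e; first by ring.
  by apply/lecP=> i; rewrite vecE leq_addr.
apply/lecP=> i; move/lecP: lm => /(_ i); move/lecP: rml => /(_ i).
rewrite !vecE; natlia.
Qed.

(** The coefficient of g E, with E = k + R on the left, is [Phi_exchange] divided by (ga/al)_|m|. *)
Lemma Ex_exchange al be ga m D (g : vec -> F) : al != 0 -> be != 0 -> ga != 0 ->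
  qp be (wt D) != 0 -> qp ga (wt m + wt D) != 0 -> qp (ga / al) (wt m) != 0 ->
  Ex (be / al) (ga / al) m
    (fun k => Ex al ga (subc (addc m D) k) (fun R => g (addc k R)))
  = Ex al be D (fun Q => Ex be ga (addc Q m) g).
Proof.
move=> al0 be0 ga0 hbe hga hgal; rewrite /Ex; set N := addc m D.
transitivity (\sum_(E <- box N) (\sum_(Q <- box D) Phi Q D al be *
     (if lec E (addc Q m) then Phi E (addc Q m) be ga else 0)) * g E); last first.
  under eq_bigr => E _ do rewrite mulr_suml.
  rewrite exchange_big; apply: eq_box => Q QD /=.
  rewrite (_ : \sum_(l <- box (addc Q m)) Phi l (addc Q m) be ga * g l =
    \sum_(E <- box N) (if lec E (addc Q m) then Phi E (addc Q m) be ga * g E else 0)).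
    by rewrite mulr_sumr; apply: eq_bigr => E _; case: ifP => _; ring.
  rewrite -big_mkcond -box_widen //; apply/lecP=> i.
  by move/lecP: QD => /(_ i); rewrite !vecE; natlia.
transitivity (\sum_(E <- box N) (\sum_(k <- box (minc m E))
   Phi k m (be / al) (ga / al) * Phi (subc E k) (subc N k) al ga) * g E).
  under [RHS]eq_bigr => E _ do rewrite mulr_suml (box_widen _ (minc_lecl m E)).
  rewrite [RHS](exchange_big_dep xpredT) //=; apply: eq_box => k km.
  have kN : lec k N by apply/lecP=> i; move/lecP: km => /(_ i); rewrite vecE; natlia.
  rewrite (box_shift _ kN) mulr_sumr; apply: eq_big => [E|E /lecP kE].
    apply/lecP/lecP => h i; move: (h i); rewrite ?vecE; last by natlia.
    by move/lecP: km => /(_ i); natlia.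
  rewrite (_ : addc k (subc E k) = E); first by ring.
  by apply/vecP=> i; rewrite !vecE subnKC.
apply: eq_box => E EN; congr (_ * _); apply: (mulfI hgal).
rewrite -Phi_exchange // mulr_sumr; apply: eq_box => k kM.
rewrite [Phi k m _ _]PhiE.
have -> : (be / al)^-1 * (ga / al) = ga / be by field; rewrite ?al0 ?be0.
have -> : ga / al / (be / al) = ga / be by field; rewrite ?al0 ?be0.
move: (Phi _ _ _ _) ((ga / be) ^+ _) (vb _ _) => *.
by field.
Qed.

End Operators.

(** * Braid relations and the Yang-Baxter equation for generic parameters *)

Section Braid.
Variables (F : fieldType) (q : F).
Hypotheses (q0 : q != 0) (q1 : forall k, (0 < k)%N -> q ^+ k != 1).
Variable n : nat.
Local Notation vec := {ffun 'I_n -> nat}.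
Implicit Types (k l m D E Q N A B C : vec) (s t : F) (g : vec -> vec -> vec -> F).
Local Notation qp := (qpoch q).
Local Notation Ex := (Ex q).

(* Uop keeps P of the particles D1 of the first site and moves the others to the
   second one; Vop moves R of the particles D2 of the second site to the first. *)
Definition Uop (x y : F) (h : vec -> vec -> F) D1 D2 :=
  Ex x y D1 (fun P => h P (addc D2 (subc D1 P))).
Definition Vop (x y : F) (h : vec -> vec -> F) D1 D2 :=
  Ex x y D2 (fun R => h (addc D1 R) (subc D2 R)).

Definition on12 (op : (vec -> vec -> F) -> vec -> vec -> F) g D1 D2 D3 :=
  op (fun A B => g A B D3) D1 D2.
Definition on23 (op : (vec -> vec -> F) -> vec -> vec -> F) g D1 D2 D3 :=
  op (g D1) D2 D3.

Lemma Uop_ext x y h h' D1 D2 :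
  (forall A B, addc A B = addc D1 D2 -> h A B = h' A B) ->
  Uop x y h D1 D2 = Uop x y h' D1 D2.
Proof.
move=> e; apply: eq_Ex => P /lecP PD; apply: e.
by apply/vecP=> i; move: (PD i); rewrite !vecE; natlia.
Qed.

Lemma Vop_ext x y h h' D1 D2 :
  (forall A B, addc A B = addc D1 D2 -> h A B = h' A B) ->
  Vop x y h D1 D2 = Vop x y h' D1 D2.
Proof.
move=> e; apply: eq_Ex => P /lecP PD; apply: e.
by apply/vecP=> i; move: (PD i); rewrite !vecE; natlia.
Qed.

(* Operators preserve the total occupation, so functions only matter on the
   states of a given total. *)
Definition eqN N g g' :=
  forall A B C, addc (addc A B) C = N -> g A B C = g' A B C.

Lemma eqN_trans N g g' g'' : eqN N g g' -> eqN N g' g'' -> eqN N g g''.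
Proof. by move=> e e' A B C h; rewrite e // e'. Qed.

Lemma eqN_sym N g g' : eqN N g g' -> eqN N g' g.
Proof. by move=> e A B C h; rewrite e. Qed.

Lemma addcA l m D : addc l (addc m D) = addc (addc l m) D.
Proof. by apply/vecP=> i; rewrite !vecE addnA. Qed.

Lemma eqN_U12 N x y g g' : eqN N g g' -> eqN N (on12 (Uop x y) g) (on12 (Uop x y) g').
Proof. by move=> e A B C h; apply: Uop_ext => A' B' h'; apply: e; rewrite h'. Qed.
Lemma eqN_V12 N x y g g' : eqN N g g' -> eqN N (on12 (Vop x y) g) (on12 (Vop x y) g').
Proof. by move=> e A B C h; apply: Vop_ext => A' B' h'; apply: e; rewrite h'. Qed.
Lemma eqN_U23 N x y g g' : eqN N g g' -> eqN N (on23 (Uop x y) g) (on23 (Uop x y) g').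
Proof.
move=> e A B C h; apply: Uop_ext => A' B' h'; apply: e.
by rewrite -addcA h' addcA.
Qed.
Lemma eqN_V23 N x y g g' : eqN N g g' -> eqN N (on23 (Vop x y) g) (on23 (Vop x y) g').
Proof.
move=> e A B C h; apply: Vop_ext => A' B' h'; apply: e.
by rewrite -addcA h' addcA.
Qed.

(** U brings letters from site 1 to site 2 and V from site 3 to site 2. Neither draws on site 2, so
    the choices are independent. *)
Lemma V23U12 N x y x' y' g :
  eqN N (on23 (Vop x' y') (on12 (Uop x y) g)) (on12 (Uop x y) (on23 (Vop x' y') g)).
Proof.
move=> D1 D2 D3 _; rewrite /on12 /on23 /Uop /Vop Ex_swap.
apply: eq_Ex => P _; apply: eq_Ex => R _; congr (g _ _ _).
by apply/vecP=> i; rewrite !vecE addnAC.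
Qed.

(** Both operators draw on site 2, which is split into a part going to site 1, a part staying and a
    part going to site 3; the two orders of splitting are [Ex_assoc]. *)
Lemma V12U23 N X s t g : X != 0 -> s != 0 ->
  qp (X * s) (wt N) != 0 -> qp t (wt N) != 0 ->
  eqN N (on12 (Vop X (X * t)) (on23 (Uop s t) g))
        (on23 (Uop (X * s) (X * t)) (on12 (Vop X (X * s)) g)).
Proof.
move=> X0 s0 hY hZX D1 D2 D3 hN.
have le2 : (wt D2 <= wt N)%N by rewrite -hN !wt_addc; natlia.
have Es : X * s / X = s by field.
have Et : X * t / X = t by field.
have := @Ex_assoc _ _ q0 q1 _ X (X * s) (X * t) D2
  (fun R P => g (addc D1 R) P (addc D3 (subc (subc D2 R) P))) X0 (mulf_neq0 X0 s0).
rewrite Es Et => /(_ (qpoch_neq0W le2 hY) (qpoch_neq0W le2 hZX)) e.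
rewrite /on12 /on23 /Uop /Vop -e; apply: eq_Ex => S /lecP Sle; apply: eq_Ex => R /lecP Rle.
by congr (g _ _ _); apply/vecP=> i; move: (Sle i) (Rle i); rewrite !vecE; natlia.
Qed.

(** The final state is determined by the content E of the first site, so this is [Ex_exchange] with
    m = D1 and D = D2. *)
Lemma UV_swap al s t h D1 D2 : al != 0 -> s != 0 -> t != 0 ->
  qp (al * s) (wt D2) != 0 -> qp (al * t) (wt D1 + wt D2) != 0 -> qp t (wt D1) != 0 ->
  Uop s t (Vop al (al * t) h) D1 D2 =
  Vop al (al * s) (Uop (al * s) (al * t) h) D1 D2.
Proof.
move=> al0 s0 t0 h1 h2 h3.
have Es : al * s / al = s by field.
have Et : al * t / al = t by field.
have := @Ex_exchange _ _ q0 q1 _ al (al * s) (al * t) D1 D2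
  (fun E => h E (subc (addc D1 D2) E)) al0 (mulf_neq0 al0 s0) (mulf_neq0 al0 t0).
rewrite Es Et => /(_ h1 h2 h3) e; rewrite /Uop /Vop.
transitivity (Ex s t D1 (fun k => Ex al (al * t) (subc (addc D1 D2) k)
   (fun R => h (addc k R) (subc (addc D1 D2) (addc k R))))); last first.
  rewrite e; apply: eq_Ex => P /lecP Ple.
  rewrite (_ : addc P D1 = addc D1 P); last by apply/vecP=> i; rewrite !vecE addnC.
  apply: eq_Ex => R /lecP Rle; congr (h _ _).
  by apply/vecP=> i; move: (Ple i) (Rle i); rewrite !vecE; natlia.
apply: eq_Ex => P /lecP Ple.
rewrite (_ : addc D2 (subc D1 P) = subc (addc D1 D2) P); last first.
  by apply/vecP=> i; move: (Ple i); rewrite !vecE; natlia.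
by apply: eq_Ex => R _; congr (h _ _); apply/vecP=> i; rewrite !vecE subnDA.
Qed.

(** [Ex_assoc] lets the part l staying on site 1 be chosen first; the letters leaving it then meet
    those of site 2 in an instance of [Ex_exchange]. *)
Lemma UUU N X al s t g : X != 0 -> al != 0 -> s != 0 -> t != 0 ->
  qp (X * s) (wt N) != 0 -> qp t (wt N) != 0 ->
  qp (al * s) (wt N) != 0 -> qp (al * t) (wt N) != 0 ->
  eqN N (on12 (Uop (X * s) (X * t)) (on23 (Uop al (al * t)) (on12 (Uop X (X * s)) g)))
    (on23 (Uop al (al * s)) (on12 (Uop X (X * t)) (on23 (Uop (al * s) (al * t)) g))).
Proof.
move=> X0 al0 s0 t0 hXs ht has hat D1 D2 D3 hN.
have wN : wt N = (wt D1 + wt D2 + wt D3)%N by rewrite -hN !wt_addc.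
have Es (z : F) : z != 0 -> z * s / z = s by move=> z0; field.
have Et (z : F) : z != 0 -> z * t / z = t by move=> z0; field.
have le1 : (wt D1 <= wt N)%N by natlia.
have := @Ex_assoc _ _ q0 q1 _ X (X * s) (X * t) D1
  (fun l r => Ex al (al * t) (subc (addc (subc D1 l) D2) r) (fun R =>
     g l (addc r R) (subc (addc D3 (addc D2 (subc D1 l))) (addc r R)))) X0 (mulf_neq0 X0 s0).
rewrite Es // Et // => /(_ (qpoch_neq0W le1 hXs) (qpoch_neq0W le1 ht)) e.
transitivity (Ex (X * s) (X * t) D1 (fun S => Ex X (X * s) S (fun l =>
   Ex al (al * t) (subc (addc (subc D1 l) D2) (subc S l)) (fun R =>
     g l (addc (subc S l) R) (subc (addc D3 (addc D2 (subc D1 l))) (addc (subc S l) R)))))).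
  rewrite /on12 /on23 /Uop; apply: eq_Ex => P /lecP Ple.
  rewrite Ex_swap; apply: eq_Ex => l /lecP lP.
  rewrite (_ : addc D2 (subc D1 P) = subc (addc (subc D1 l) D2) (subc P l)); last first.
    by apply/vecP=> i; move: (Ple i) (lP i); rewrite !vecE; natlia.
  apply: eq_Ex => R /lecP Rle.
  by congr (g _ _ _); apply/vecP=> i; move: (Ple i) (lP i) (Rle i); rewrite !vecE; natlia.
rewrite e /on12 /on23 /Uop [RHS]Ex_swap; apply: eq_Ex => l lD; have /lecP ll := lD.
have wl : (wt (subc D1 l) <= wt D1)%N by apply: wt_le; apply/lecP=> i; rewrite vecE leq_subr.
have := @Ex_exchange _ _ q0 q1 _ al (al * s) (al * t) (subc D1 l) D2
  (fun E => g l E (subc (addc D3 (addc D2 (subc D1 l))) E))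
  al0 (mulf_neq0 al0 s0) (mulf_neq0 al0 t0).
rewrite Es // Et // => -> //; first last.
- by apply: qpoch_neq0W ht; natlia.
- by apply: qpoch_neq0W hat; natlia.
- by apply: qpoch_neq0W has; natlia.
apply: eq_Ex => P /lecP Ple; apply: eq_Ex => R /lecP Rle.
by congr (g _ _ _); apply/vecP=> i; move: (Ple i) (Rle i); rewrite !vecE; natlia.
Qed.

(** Mirror image of [UUU], with the identities in the opposite order: [Ex_exchange] for a fixed S
    drawn from site 3, then [Ex_assoc] for the splitting of S. *)
Lemma VVV N al s t z g : al != 0 -> s != 0 -> t != 0 ->
  qp (al * s) (wt N) != 0 -> qp z (wt N) != 0 -> qp t (wt N) != 0 ->
  qp (al * t) (wt N) != 0 ->
  eqN N (on12 (Vop s t) (on23 (Vop (al * s) (al * z)) (on12 (Vop al (al * t)) g)))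
    (on23 (Vop al (al * z)) (on12 (Vop (al * s) (al * t)) (on23 (Vop s z) g))).
Proof.
move=> al0 s0 t0 has hz ht hat D1 D2 D3 hN.
have wN : wt N = (wt D1 + wt D2 + wt D3)%N by rewrite -hN !wt_addc.
have Ez (w : F) : al * w / al = w by field.
transitivity (Ex (al * s) (al * z) D3 (fun S => Ex al (al * s) S (fun Qv =>
  Ex (al * s) (al * t) (addc Qv D2) (fun E =>
    g (addc D1 E) (subc (addc (addc Qv (subc S Qv)) D2) E) (subc D3 (addc Qv (subc S Qv))))))).
  rewrite /on12 /on23 /Vop Ex_swap; apply: eq_Ex => S SD; have /lecP Sle := SD.
  have wS := wt_le SD.
  have := @Ex_exchange _ _ q0 q1 _ al (al * s) (al * t) D2 S
    (fun E => g (addc D1 E) (subc (addc S D2) E) (subc D3 S))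
    al0 (mulf_neq0 al0 s0) (mulf_neq0 al0 t0).
  rewrite !Ez => e; transitivity (Ex s t D2 (fun k => Ex al (al * t) (subc (addc D2 S) k)
    (fun R => g (addc D1 (addc k R)) (subc (addc S D2) (addc k R)) (subc D3 S)))).
    apply: eq_Ex => k /lecP kle.
    rewrite (_ : addc (subc D2 k) S = subc (addc D2 S) k); last first.
      by apply/vecP=> i; move: (kle i); rewrite !vecE; natlia.
    apply: eq_Ex => R /lecP Rle.
    by congr (g _ _ _); apply/vecP=> i; move: (kle i) (Rle i); rewrite !vecE; natlia.
  rewrite e; first last.
  - by apply: qpoch_neq0W ht; natlia.
  - by apply: qpoch_neq0W hat; natlia.
  - by apply: qpoch_neq0W has; natlia.
  apply: eq_Ex => k /lecP kle; apply: eq_Ex => E _.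
  rewrite (_ : addc k (subc S k) = S) //.
  by apply/vecP=> i; move: (kle i); rewrite !vecE; natlia.
have le3 : (wt D3 <= wt N)%N by natlia.
have := @Ex_assoc _ _ q0 q1 _ al (al * s) (al * z) D3 (fun Qv r =>
  Ex (al * s) (al * t) (addc Qv D2) (fun E =>
    g (addc D1 E) (subc (addc (addc Qv r) D2) E) (subc D3 (addc Qv r)))) al0 (mulf_neq0 al0 s0).
rewrite !Ez => -> //; first last.
- by apply: qpoch_neq0W hz.
- by apply: qpoch_neq0W has.
rewrite /on12 /on23 /Vop; apply: eq_Ex => Qv /lecP Qle; rewrite Ex_swap.
rewrite (_ : addc D2 Qv = addc Qv D2); last by apply/vecP=> i; rewrite !vecE addnC.
apply: eq_Ex => E /lecP Ele; apply: eq_Ex => r /lecP rle.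
by congr (g _ _ _); apply/vecP=> i; move: (Qle i) (Ele i) (rle i); rewrite !vecE; natlia.
Qed.

Definition Rop (a b c d : F) h := Uop (c / b) (a / b) (Vop (b / d) (a / d) h).

Lemma ratioM (x y z : F) : x != 0 -> x / y * (z / x) = z / y.
Proof. by move=> x0; rewrite mulrC mulrA divfK. Qed.

Section YangBaxter.
Variables (N : vec) (a1 a2 a3 b1 b2 b3 : F).
Hypotheses (nz : all (fun x => x != 0) [:: a1; a2; a3; b1; b2; b3]).
Let ok x := qp x (wt N) != 0.
Hypotheses (ok_ab : allrel (fun a b => ok (a / b)) [:: a1; a2; a3] [:: b1; b2; b3]).
Hypotheses (ok_a : [&& ok (a1 / a2), ok (a1 / a3) & ok (a2 / a3)]).
Hypotheses (ok_b : [&& ok (b1 / b2), ok (b1 / b3) & ok (b2 / b3)]).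

Lemma Rop12 a b c d g : on12 (Rop a b c d) g = on12 (Uop (c / b) (a / b)) (on12 (Vop (b / d) (a / d)) g).
Proof. by []. Qed.
Lemma Rop23 a b c d g : on23 (Rop a b c d) g = on23 (Uop (c / b) (a / b)) (on23 (Vop (b / d) (a / d)) g).
Proof. by []. Qed.

Theorem yang_baxter g :
  eqN N (on12 (Rop a1 b1 a2 b2) (on23 (Rop a1 b1 a3 b3) (on12 (Rop a2 b2 a3 b3) g)))
        (on23 (Rop a2 b2 a3 b3) (on12 (Rop a1 b1 a3 b3) (on23 (Rop a1 b1 a2 b2) g))).
Proof.
have : [/\ a1 != 0, a2 != 0, a3 != 0 & [/\ b1 != 0, b2 != 0 & b3 != 0]].
  by move: nz => /= /and4P[? ? ? /and4P[? ? ? _]].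
case=> a10 a20 a30 [b10 b20 b30].
move: ok_ab ok_a ok_b; rewrite /allrel /= !andbT => /and3P[].
move=> /and3P[k11 k12 k13] /and3P[k21 k22 k23] /and3P[k31 k32 k33].
move=> /and3P[ka12 ka13 ka23] /and3P[kb12 kb13 kb23].
have dv x y : x != 0 -> y != 0 -> x / y != 0 :> F by move=> *; rewrite mulf_neq0 ?invr_eq0.
have M := ratioM.
pose G := on12 (Vop (b2 / b3) (a2 / b3)) g.
pose G' := on23 (Vop (b1 / b2) (a1 / b2)) g.
(* Normal form of the left side: all U's, then all V's. The right side gets the analogous form in
   [hR], and [UUU] and [VVV] identify the two. *)
apply: (@eqN_trans _ _ (on12 (Uop (a2 / b1) (a1 / b1)) (on23 (Uop (a3 / b2) (a1 / b2))
   (on12 (Uop (a3 / b1) (a2 / b1)) (on12 (Vop (b1 / b2) (a2 / b2))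
     (on23 (Vop (b1 / b3) (a1 / b3)) (on12 (Vop (b2 / b3) (a2 / b3)) g))))))).
  rewrite !Rop12 Rop23 -/G; apply: eqN_U12.
  apply: (@eqN_trans _ _ (on12 (Vop (b1 / b2) (a1 / b2)) (on23 (Uop (a3 / b1) (a1 / b1))
    (on12 (Uop (a3 / b2) (a2 / b2)) (on23 (Vop (b1 / b3) (a1 / b3)) G))))).
    by apply: eqN_V12; apply: eqN_U23; apply: V23U12.
  set G2 := on23 (Vop (b1 / b3) _) G.
  apply: (@eqN_trans _ _ (on23 (Uop (a3 / b2) (a1 / b2)) (on12 (Vop (b1 / b2) (a3 / b2))
    (on12 (Uop (a3 / b2) (a2 / b2)) G2)))).
    have := @V12U23 N (b1 / b2) (a3 / b1) (a1 / b1) (on12 (Uop (a3 / b2) (a2 / b2)) G2).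
    by rewrite !M //; apply; rewrite ?dv.
  apply: eqN_U23 => D1 D2 D3 hN; rewrite /on12.
  have wN : wt N = (wt D1 + wt D2 + wt D3)%N by rewrite -hN !wt_addc.
  have := @UV_swap (b1 / b2) (a3 / b1) (a2 / b1) (fun A B => G2 A B D3) D1 D2.
  rewrite !M // => -> //; rewrite ?dv //.
  - by apply: qpoch_neq0W k32; natlia.
  - by apply: qpoch_neq0W k22; natlia.
  - by apply: qpoch_neq0W k21; natlia.
pose mid := on23 (Vop (b2 / b3) (a1 / b3)) (on12 (Vop (b1 / b3) (a2 / b3)) G').
have hR : eqN N (on23 (Rop a2 b2 a3 b3) (on12 (Rop a1 b1 a3 b3) (on23 (Rop a1 b1 a2 b2) g)))
    (on23 (Uop (a3 / b2) (a2 / b2)) (on12 (Uop (a3 / b1) (a1 / b1))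
      (on23 (Uop (a2 / b2) (a1 / b2)) mid))).
  rewrite !Rop23 Rop12 -/G'; apply: eqN_U23.
  apply: (@eqN_trans _ _ (on12 (Uop (a3 / b1) (a1 / b1)) (on23 (Vop (b2 / b3) (a2 / b3))
     (on12 (Vop (b1 / b3) (a1 / b3)) (on23 (Uop (a2 / b1) (a1 / b1)) G'))))).
    exact: V23U12.
  apply: eqN_U12.
  apply: (@eqN_trans _ _ (on23 (Vop (b2 / b3) (a2 / b3)) (on23 (Uop (a2 / b3) (a1 / b3))
     (on12 (Vop (b1 / b3) (a2 / b3)) G')))).
    apply: eqN_V23; have := @V12U23 N (b1 / b3) (a2 / b1) (a1 / b1) G'.
    by rewrite !M //; apply; rewrite ?dv.
  move=> D1 D2 D3 hN; rewrite /mid /on23.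
  have wN : wt N = (wt D1 + wt D2 + wt D3)%N by rewrite -hN !wt_addc.
  have := @UV_swap (b2 / b3) (a2 / b2) (a1 / b2) (on12 (Vop (b1 / b3) (a2 / b3)) G' D1) D2 D3.
  rewrite !M // => e; symmetry; apply: e; rewrite ?dv //.
  - by apply: qpoch_neq0W k23; natlia.
  - by apply: qpoch_neq0W k13; natlia.
  - by apply: qpoch_neq0W k12; natlia.
apply: eqN_trans (eqN_sym hR).
pose H := on12 (Vop (b1 / b2) (a2 / b2)) (on23 (Vop (b1 / b3) (a1 / b3)) (on12 (Vop (b2 / b3) (a2 / b3)) g)).
apply: (@eqN_trans _ _ (on23 (Uop (a3 / b2) (a2 / b2)) (on12 (Uop (a3 / b1) (a1 / b1))
   (on23 (Uop (a2 / b2) (a1 / b2)) H)))).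
  have := @UUU N (a3 / b1) (a3 / b2) (a2 / a3) (a1 / a3) H.
  by rewrite !M //; apply; rewrite ?dv.
apply: eqN_U23; apply: eqN_U12; apply: eqN_U23; rewrite /H /mid /G'.
have := @VVV N (b2 / b3) (b1 / b2) (a2 / b2) (a1 / b2) g.
by rewrite !M //; apply; rewrite ?dv.
Qed.

End YangBaxter.
End Braid.

(** * Matrix elements of R and their two factorizations *)

Section Kernel.
Variables (F : fieldType) (q : F).
Hypotheses (q0 : q != 0) (q1 : forall k, (0 < k)%N -> q ^+ k != 1).
Variable n : nat.
Local Notation vec := {ffun 'I_n -> nat}.
Implicit Types (k l m D E Q N A B C P : vec) (s t : F) (g : vec -> vec -> vec -> F).
Local Notation qp := (qpoch q).
Local Notation vb := (vb q).
Local Notation Phi := (Phi q).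
Local Notation Rop := (Rop q).

(* The weight of (C, D) -> (A, B), where C = A + B - D. *)
Definition vertex_kernel (a b c d : F) A B (D : vec) : F :=
  \sum_(P <- box (minc A D))
    Phi (subc A P) (subc (addc A B) P) (b / d) (a / d) * Phi P D (c / b) (a / b).

Lemma RopE a b c d h D C : Rop a b c d h D C =
  \sum_(A <- box (addc D C))
    vertex_kernel a b c d A (subc (addc D C) A) D * h A (subc (addc D C) A).
Proof.
set N := addc D C; have DN P : lec P D -> lec P N.
  by move/lecP=> h'; apply/lecP=> i; move: (h' i); rewrite vecE; natlia.
transitivity (\sum_(P <- box D) \sum_(A <- box N | lec P A) Phi P D (c / b) (a / b) *
   (Phi (subc A P) (subc N P) (b / d) (a / d) * h A (subc N A))).
  rewrite /Rop /Uop /Vop /Ex; apply: eq_box => P PD; rewrite -mulr_sumr; congr (_ * _).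
  have e : addc C (subc D P) = subc N P.
    by apply/vecP=> i; move/lecP: PD => /(_ i); rewrite !vecE; natlia.
  rewrite e (box_shift _ (DN _ PD)); apply: eq_bigr => A /lecP PA.
  have -> : addc P (subc A P) = A by apply/vecP=> i; rewrite !vecE subnKC.
  congr (_ * h _ _).
  by apply/vecP=> i; move: (PA i); rewrite !vecE; natlia.
rewrite (exchange_big_dep xpredT) //=; apply: eq_box => A AN.
rewrite /vertex_kernel (_ : minc A D = minc D A); last by apply/vecP=> i; rewrite !vecE minnC.
rewrite (box_widen _ (minc_lecl D A)) mulr_suml.
rewrite [LHS]big_seq_cond [RHS]big_seq_cond; apply: eq_big => P.
  rewrite mem_box; apply: andb_id2l => /lecP PD.
  apply/lecP/lecP => h' i; move: (h' i) (PD i); rewrite ?vecE; first by natlia.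
  by natlia.
rewrite (_ : addc A (subc N A) = N) => [_|]; first by ring.
by apply/vecP=> i; move/lecP: AN => /(_ i); rewrite !vecE; natlia.
Qed.

(* Worig and Walt are what is left of the kernel after splitting off the factors
   that become singular at a / b = q^-L and at c / d = q^-M; Walt comes from
   performing V before U. *)
Definition Worig (a b c d : F) A B D : F :=
  \sum_(P <- box (minc A D))
    vb D P * (qp (c / b) (wt P) * qp (a / c) (wt D - wt P) * (a / c) ^+ wt P) *
    (qp (b / d) (wt (subc A P)) / qp (a / d) (wt (subc (addc A B) P))
     * (a / b) ^+ wt (subc A P) * vb (subc (addc A B) P) (subc A P)).

Lemma Wk_orig a b c d A B D : b != 0 -> c != 0 -> d != 0 ->
  vertex_kernel a b c d A B D = qp (a / b) (wt B) * Worig a b c d A B D / qp (a / b) (wt D).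
Proof.
move=> b0 c0 d0; rewrite /vertex_kernel /Worig mulrAC mulr_sumr; apply: eq_box => P PM.
have PA : lec P A := lec_trans PM (minc_lecl _ _).
have PN : lec P (addc A B).
  by apply/lecP=> i; move/lecP: PA => /(_ i); rewrite vecE; natlia.
rewrite !PhiE.
have -> : (wt (subc (addc A B) P) - wt (subc A P) = wt B)%N.
  by rewrite !wt_subc // wt_addc; move: (wt_le PA); natlia.
have -> : (b / d)^-1 * (a / d) = a / b by field; rewrite ?b0 ?d0.
have -> : a / d / (b / d) = a / b by field; rewrite ?b0 ?d0.
have -> : (c / b)^-1 * (a / b) = a / c by field; rewrite ?b0 ?c0.
have -> : a / b / (c / b) = a / c by field; rewrite ?b0 ?c0.
by move: (_ ^-1) (_ ^-1) (vb _ _) (vb _ _) ((a / b) ^+ _) ((a / c) ^+ _) => *; ring.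
Qed.

Definition Walt (a b c d : F) A C D : F :=
  \sum_(Q <- box C)
    vb C Q * (qp (b / d) (wt Q) * qp (c / b) (wt C - wt Q) * (c / b) ^+ wt Q) *
    (if lec A (addc Q D) then
       qp (a / c) (wt (addc Q D) - wt A) / qp (a / d) (wt (addc Q D))
       * (a / c) ^+ wt A * vb (addc Q D) A
     else 0).

(** UV = VU for matrix elements, multiplied through by (a/b)_|D| so as to remain valid where that
    symbol vanishes, that is, at b = q^L a for |D| > L. *)
Lemma Wk_alt_cleared a b c d A B C D : a != 0 -> b != 0 -> c != 0 -> d != 0 ->
  addc A B = addc C D -> qp (a / d) (wt (addc C D)) != 0 ->
  qp (c / d) (wt C) != 0 ->
  \sum_(k <- box (minc A D)) vb D k * (qp (c / b) (wt k) *
     qp (a / c) (wt D - wt k) * (a / c) ^+ wt k) *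
     Phi (subc A k) (subc (addc A B) k) (b / d) (a / d) =
  qp (a / b) (wt D) * (qp (c / d) (wt A) * Walt a b c d A C D / qp (c / d) (wt C)).
Proof.
move=> a0 b0 c0 d0 eN had hcd.
have eN' : addc A B = addc D C by rewrite eN; apply/vecP=> i; rewrite !vecE addnC.
have AN : lec A (addc D C) by rewrite -eN'; apply/lecP=> i; rewrite vecE leq_addr.
have dv x y : x != 0 -> y != 0 -> x / y != 0 :> F by move=> *; rewrite mulf_neq0 ?invr_eq0.
have had' : qp (a / d) (wt D + wt C) != 0 by rewrite addnC -wt_addc.
have := Phi_exchange q0 q1 (dv _ _ b0 d0) (dv _ _ c0 d0) (dv _ _ a0 d0) hcd had' AN.
have -> : c / d / (b / d) = c / b by field; rewrite ?b0 ?d0.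
have -> : a / d / (c / d) = a / c by field; rewrite ?c0 ?d0.
have -> : a / d / (b / d) = a / b by field; rewrite ?b0 ?d0.
rewrite eN' (_ : minc A D = minc D A); last by apply/vecP=> i; rewrite !vecE minnC.
move=> ->; congr (_ * _); rewrite /Walt mulrAC mulr_sumr; apply: eq_box => Q QC.
case: ifP => _; last by rewrite !mulr0.
rewrite !PhiE.
have -> : (b / d)^-1 * (c / d) = c / b by field; rewrite ?b0 ?d0.
have -> : c / d / (b / d) = c / b by field; rewrite ?b0 ?d0.
have -> : (c / d)^-1 * (a / d) = a / c by field; rewrite ?c0 ?d0.
have -> : a / d / (c / d) = a / c by field; rewrite ?c0 ?d0.
by move: (_ ^-1) (_ ^-1) (vb _ _) (vb _ _) ((c / b) ^+ _) ((a / c) ^+ _) => *; ring.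
Qed.

Lemma Wk_clear a b c d A B D : b != 0 -> c != 0 -> qp (a / b) (wt D) != 0 ->
  qp (a / b) (wt D) * vertex_kernel a b c d A B D =
  \sum_(k <- box (minc A D)) vb D k * (qp (c / b) (wt k) *
     qp (a / c) (wt D - wt k) * (a / c) ^+ wt k) *
     Phi (subc A k) (subc (addc A B) k) (b / d) (a / d).
Proof.
move=> b0 c0 hD; rewrite /vertex_kernel mulr_sumr; apply: eq_box => P PM.
rewrite [Phi P D _ _]PhiE.
have -> : (c / b)^-1 * (a / b) = a / c by field; rewrite ?b0 ?c0.
have -> : a / b / (c / b) = a / c by field; rewrite ?b0 ?c0.
by move: (vb _ _) ((a / c) ^+ _) (Phi _ _ _ _) => *; field.
Qed.

Lemma Wk_alt a b c d A B C D : a != 0 -> b != 0 -> c != 0 -> d != 0 ->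
  addc A B = addc C D -> qp (a / d) (wt (addc C D)) != 0 ->
  qp (c / d) (wt C) != 0 -> qp (a / b) (wt D) != 0 ->
  vertex_kernel a b c d A B D = qp (c / d) (wt A) * Walt a b c d A C D / qp (c / d) (wt C).
Proof.
move=> a0 b0 c0 d0 eN had hcd hab; apply: (mulfI hab).
by rewrite Wk_clear // (@Wk_alt_cleared a b c d A B C D).
Qed.

(** On an indicator the product of operators is a matrix element. The modules leave in the opposite
    order, whence J3, I3, K3 against K1, I1, J1, and conservation leaves one free intermediate
    vector. The test on J1 excludes a truncated difference K2. *)
Lemma chain_right a1 a2 a3 b1 b2 b3 J1 I1 K1 J3 I3 K3 :
  addc (addc J3 I3) K3 = addc (addc K1 I1) J1 ->
  on12 (Rop a1 b1 a2 b2) (on23 (Rop a1 b1 a3 b3) (on12 (Rop a2 b2 a3 b3)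
    (fun A B C => ((A == K1) && (B == I1) && (C == J1))%:R))) J3 I3 K3 =
  \sum_(I2 <- box (addc J3 I3))
    let J2 := subc (addc J3 I3) I2 in
    let K2 := subc (addc J2 K3) J1 in
    if lec J1 (addc J2 K3) then
      vertex_kernel a1 b1 a2 b2 I2 J2 J3 * vertex_kernel a1 b1 a3 b3 K2 J1 J2 * vertex_kernel a2 b2 a3 b3 K1 I1 I2
    else 0.
Proof.
move=> eN; rewrite {1}/on12 RopE; apply: eq_box => I2 I2le.
set J2 := subc _ I2; rewrite /= /on23 RopE.
rewrite (_ : _ * _ = \sum_(K2 <- box (addc J2 K3))
  (if subc (addc J2 K3) K2 == J1 then
     vertex_kernel a1 b1 a2 b2 I2 J2 J3 * (vertex_kernel a1 b1 a3 b3 K2 (subc (addc J2 K3) K2) J2 *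
       vertex_kernel a2 b2 a3 b3 K1 I1 I2)
   else 0)); last first.
  rewrite mulr_sumr; apply: eq_box => K2 K2le; rewrite /on12 RopE.
  case: eqP => [e|ne]; last first.
    rewrite [X in _ * (_ * X)]big1 ?mulr0 // => A _.
    by rewrite andbF mulr0.
  have eKI : addc I2 K2 = addc K1 I1.
    apply/vecP=> i; move/vecP: eN => /(_ i); move/vecP: e => /(_ i).
    move/lecP: K2le => /(_ i); move/lecP: I2le => /(_ i).
    by rewrite /J2 !vecE; natlia.
  congr (_ * (_ * _)); rewrite (@box_single _ _ _ K1).
  - have -> : subc (addc I2 K2) K1 = I1 by rewrite eKI; apply/vecP=> i; rewrite !vecE addKn.
    by rewrite !eqxx mulr1.
  - by rewrite eKI; apply/lecP=> i; rewrite vecE leq_addr.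
  - by move=> A _ /negPf ->; rewrite mulr0.
case: ifP => [J1le|nJ1]; last first.
  rewrite box0 // => K2 /lecP K2le; case: eqP => // /vecP e.
  by move/negP: nJ1; case; apply/lecP=> i; move: (e i) (K2le i); rewrite !vecE; natlia.
have J1e : subc (addc J2 K3) (subc (addc J2 K3) J1) = J1.
  by apply/vecP=> i; move/lecP: J1le => /(_ i); rewrite !vecE; natlia.
rewrite (@box_single _ _ _ (subc (addc J2 K3) J1)).
- by rewrite J1e eqxx; ring.
- by apply/lecP=> i; rewrite vecE leq_subr.
- move=> K2 /lecP K2le ne; case: eqP => // /vecP e; case/eqP: ne.
  by apply/vecP=> i; move: (e i) (K2le i); rewrite !vecE; natlia.
Qed.

Lemma chain_left a1 a2 a3 b1 b2 b3 J1 I1 K1 J3 I3 K3 :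
  addc (addc J3 I3) K3 = addc (addc K1 I1) J1 ->
  on23 (Rop a2 b2 a3 b3) (on12 (Rop a1 b1 a3 b3) (on23 (Rop a1 b1 a2 b2)
    (fun A B C => ((A == K1) && (B == I1) && (C == J1))%:R))) J3 I3 K3 =
  \sum_(K2 <- box (addc I3 K3))
    let I2 := subc (addc I3 K3) K2 in
    let J2 := subc (addc J3 K2) K1 in
    if lec K1 (addc J3 K2) then
      vertex_kernel a2 b2 a3 b3 K2 I2 I3 * vertex_kernel a1 b1 a3 b3 K1 J2 J3 * vertex_kernel a1 b1 a2 b2 I1 J1 J2
    else 0.
Proof.
move=> eN; rewrite {1}/on23 RopE; apply: eq_box => K2 K2le.
set I2 := subc _ K2; rewrite /= /on12 RopE.
rewrite (_ : _ * _ = \sum_(A <- box (addc J3 K2))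
  (if A == K1 then
     vertex_kernel a2 b2 a3 b3 K2 I2 I3 * (vertex_kernel a1 b1 a3 b3 A (subc (addc J3 K2) A) J3 *
       vertex_kernel a1 b1 a2 b2 I1 J1 (subc (addc J3 K2) A))
   else 0)); last first.
  rewrite mulr_sumr; apply: eq_box => A Ale; rewrite /on23 RopE.
  case: eqP => [e|ne]; last first.
    rewrite [X in _ * (_ * X)]big1 ?mulr0 // => A' _.
    by rewrite mulr0.
  set J2 := subc _ A.
  have eIJ : addc J2 I2 = addc I1 J1.
    apply/vecP=> i; move/vecP: eN => /(_ i); move: Ale; rewrite e => /lecP/(_ i).
    move/lecP: K2le => /(_ i).
    by rewrite /J2 /I2 e !vecE; natlia.
  congr (_ * (_ * _)); rewrite (@box_single _ _ _ I1).
  - have -> : subc (addc J2 I2) I1 = J1 by rewrite eIJ; apply/vecP=> i; rewrite !vecE addKn.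
    by rewrite !eqxx mulr1.
  - by rewrite eIJ; apply/lecP=> i; rewrite vecE leq_addr.
  - by move=> A' _ /negPf ->; rewrite mulr0.
case: ifP => [K1le|nK1]; last first.
  by rewrite box0 // => A Ale; case: eqP => // e; rewrite e nK1 in Ale.
rewrite (@box_single _ _ _ K1) //; first by rewrite eqxx; ring.
by move=> A _ /negPf ->.
Qed.

End Kernel.

(** * Limits of the matrix elements at finite spin *)

Section Truncation.
Variables (F : fieldType) (q : F).
Hypotheses (q0 : q != 0) (q1 : forall k, (0 < k)%N -> q ^+ k != 1).
Variable n : nat.
Local Notation vec := {ffun 'I_n -> nat}.
Implicit Types (A B C D N : vec) (s t : F).
Local Notation qp := (qpoch q).
Local Notation Phi := (Phi q).
Local Notation Wk := (vertex_kernel q).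

Lemma alim_div s f g v w : w != 0 -> alim s f v -> alim s g w ->
  alim s (fun t => f t / g t) (v / w).
Proof. by move=> w0 hf hg; apply: alimM hf (alimV w0 hg). Qed.

Lemma alim_Phi s (l m : vec) x y x0 y0 : x0 != 0 -> qp y0 (wt m) != 0 ->
  alim s x x0 -> alim s y y0 -> alim s (fun t => Phi l m (x t) (y t)) (Phi l m x0 y0).
Proof.
move=> x00 hy hx hy0; rewrite PhiE.
have h := alimM (alimX (wt l) (alim_div x00 hy0 hx)) (alim_cst s (vb q m l)).
have h1 := alimM (alim_qpoch q (wt l) hx)
  (alim_qpoch q (wt m - wt l) (alimM (alimV x00 hx) hy0)).
have h2 := alimM (alim_div hy h1 (alim_qpoch q (wt m) hy0)) h.
rewrite -[_ * vb q m l]mulrA; apply: alim_cofW h2.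
by apply: cofT => t; rewrite PhiE -[RHS]mulrA.
Qed.

Lemma alim_Wk s (a b c d : F -> F) a0 b0 c0 d0 A B D :
  alim s a a0 -> alim s b b0 -> alim s c c0 -> alim s d d0 ->
  b0 != 0 -> c0 != 0 -> d0 != 0 ->
  qp (a0 / d0) (wt (addc A B)) != 0 -> qp (a0 / b0) (wt D) != 0 ->
  alim s (fun t => Wk (a t) (b t) (c t) (d t) A B D) (Wk a0 b0 c0 d0 A B D).
Proof.
move=> ha hb hc hd b00 c00 d00 had hab.
apply: alim_sum => P; rewrite mem_box => /lecP PM _.
have dv x y : x != 0 -> y != 0 -> x / y != 0 :> F by move=> *; rewrite mulf_neq0 ?invr_eq0.
apply: alimM; apply: alim_Phi; try exact: dv; try exact: alim_div; rewrite //.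
by apply: qpoch_neq0W had; apply: wt_le; apply/lecP=> i; rewrite vecE leq_subr.
Qed.

(** For a factor multiplied by another one tending to 0, only the existence of its limit matters. *)
Definition exlim s f := exists v, alim s f v.

Lemma exlimM s f g : exlim s f -> exlim s g -> exlim s (fun t => f t * g t).
Proof. by move=> [v hv] [w hw]; exists (v * w); apply: alimM. Qed.

Lemma exlim_sum s (I : eqType) (r : seq I) (f : I -> F -> F) :
  (forall i, i \in r -> exlim s (f i)) -> exlim s (fun t => \sum_(i <- r) f i t).
Proof.
elim: r => [|i r IH] h.
  by exists 0; apply: alim_cofW (alim_cst s 0); apply: cofT => t; rewrite big_nil.
have [v hv] := h i (mem_head _ _).
have [|w hw] := IH; first by move=> j jr; apply: h; rewrite in_cons jr orbT.
exists (v + w); apply: alim_cofW (alimD hv hw).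
by apply: cofT => t; rewrite big_cons.
Qed.

Lemma exlim_cst s c : exlim s (fun=> c). Proof. by exists c; apply: alim_cst. Qed.
Lemma alim_ex s f v : alim s f v -> exlim s f. Proof. by exists v. Qed.
Lemma exlimX s f k : exlim s f -> exlim s (fun t => f t ^+ k).
Proof. by move=> [v hv]; exists (v ^+ k); apply: alimX. Qed.
Lemma exlim_qpoch s f k : exlim s f -> exlim s (fun t => qp (f t) k).
Proof. by move=> [v hv]; exists (qp v k); apply: alim_qpoch. Qed.
Lemma exlimV s f v : v != 0 -> alim s f v -> exlim s (fun t => (f t)^-1).
Proof. by move=> v0 hv; exists v^-1; apply: alimV. Qed.

Lemma exlim_Worig s (a b c d : F -> F) a0 b0 c0 d0 A B D :
  alim s a a0 -> alim s b b0 -> alim s c c0 -> alim s d d0 ->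
  b0 != 0 -> c0 != 0 -> d0 != 0 -> qp (a0 / d0) (wt (addc A B)) != 0 ->
  exlim s (fun t => Worig q (a t) (b t) (c t) (d t) A B D).
Proof.
move=> ha hb hc hd b00 c00 d00 had.
rewrite /Worig; apply: exlim_sum => P; rewrite mem_box => /lecP PM.
have hP : qp (a0 / d0) (wt (subc (addc A B) P)) != 0.
  by apply: qpoch_neq0W had; apply: wt_le; apply/lecP=> i; rewrite vecE leq_subr.
have D1 := alim_ex (alim_div b00 hc hb); have D2 := alim_ex (alim_div c00 ha hc).
have D3 := alim_ex (alim_div d00 hb hd); have D4 := alim_div d00 ha hd.
have D5 := alim_ex (alim_div b00 ha hb).
repeat first [exact: exlim_cst | exact: exlimV hP (alim_qpoch q _ D4)
  | apply: exlim_qpoch | apply: exlimX | done | apply: exlimM].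
Qed.

Lemma exlim_Walt s (a b c d : F -> F) a0 b0 c0 d0 A C D :
  alim s a a0 -> alim s b b0 -> alim s c c0 -> alim s d d0 ->
  b0 != 0 -> c0 != 0 -> d0 != 0 -> qp (a0 / d0) (wt (addc C D)) != 0 ->
  exlim s (fun t => Walt q (a t) (b t) (c t) (d t) A C D).
Proof.
move=> ha hb hc hd b00 c00 d00 had.
rewrite /Walt; apply: exlim_sum => Q; rewrite mem_box => /lecP QC.
have hQ : qp (a0 / d0) (wt (addc Q D)) != 0.
  by apply: qpoch_neq0W had; apply: wt_le; apply/lecP=> i; rewrite !vecE leq_add2r.
have D1 := alim_ex (alim_div b00 hc hb); have D2 := alim_ex (alim_div c00 ha hc).
have D3 := alim_ex (alim_div d00 hb hd); have D4 := alim_div d00 ha hd.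
case: (lec A (addc Q D));
repeat first [exact: exlim_cst | exact: exlimV hQ (alim_qpoch q _ D4)
  | apply: exlim_qpoch | apply: exlimX | done | apply: exlimM].
Qed.

(* The product vanishes in the limit although the factors f2 and f3 may have
   poles: each pole is cancelled by a zero of an earlier factor, and one zero
   is always left over. *)
Lemma alim_triple s (hp hr hs : F -> F) vp vr vs f1 f2 f3 X1 Y1 X2 Y2 X3 Y3 :
  alim s hp vp -> alim s hr vr -> alim s hs vs -> cof (fun t => hr t != 0) ->
  exlim s X1 -> exlim s Y1 -> exlim s X2 -> exlim s Y2 -> exlim s X3 -> exlim s Y3 ->
  cof (fun t => f1 t = hp t * X1 t) -> cof (fun t => f1 t = hr t * Y1 t) ->
  cof (fun t => f2 t = X2 t / hp t) -> cof (fun t => f2 t = hs t * Y2 t) ->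
  cof (fun t => f3 t = X3 t / hr t) -> cof (fun t => f3 t = Y3 t / hs t) ->
  [|| vp == 0, vr == 0 | vs == 0] ->
  alim s (fun t => f1 t * f2 t * f3 t) 0.
Proof.
move=> lp lr ls nr [x1 hX1] [y1 hY1] [x2 hX2] [y2 hY2] [x3 hX3] [y3 hY3].
move=> e1 e1' e2 e2' e3 e3' hv.
(* For vs = 0 the factor f3 may have a pole in both of its forms: the form hr Y1 of f1 cancels hr in
   X3 / hr, and f2 = hs Y2 supplies the zero. Otherwise f3 is regular and f1 f2 tends to 0. *)
have [vs0|vs0] := eqVneq vs 0.
  have h := alimM (alimM ls hY2) (alimM hY1 hX3); rewrite vs0 !mul0r in h.
  apply: alim_cofW h.
  have hh := cofI nr (cofI e1' (cofI e2' e3)).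
  apply: cofW hh => t [rt [-> [-> ->]]].
  by field.
have l3 : alim s f3 (y3 / vs).
  by apply: alim_cofW (alim_div vs0 hY3 ls); apply: cofW e3' => t ->.
have [vp0|vp0] := eqVneq vp 0.
  have h := alimM (alimM lp hX1) (alimM ls hY2); rewrite vp0 !mul0r in h.
  rewrite -[0](mul0r (y3 / vs)); apply: alimM l3; apply: alim_cofW h.
  by apply: cofI2 e1 e2' => t -> ->.
move: hv; rewrite (negPf vp0) (negPf vs0) orbF /= => /eqP vr0.
have h := alimM (alimM lr hY1) (alim_div vp0 hX2 lp); rewrite vr0 !mul0r in h.
rewrite -[0](mul0r (y3 / vs)); apply: alimM l3; apply: alim_cofW h.
by apply: cofI2 e1' e2 => t -> ->.
Qed.

Lemma cof_qpoch (c : F) e K : (0 < e)%N -> cof (fun t => qp (c / t ^+ e) K != 0).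
Proof.
move=> e0; elim: K => [|K IH].
  by apply: cofT => t; rewrite qpoch0 oner_neq0.
have p0 : 'X^e - (q ^+ K * c)%:P != 0 :> {poly F}.
  by rewrite -size_poly_eq0 size_XnsubC.
apply: cofI2 IH (cofI (cof_poly p0) (cof_neq 0)) => t IH [].
rewrite !hornerE => ht t0.
rewrite qpochSr mulf_neq0 // mulrA; apply: contraNneq ht => /eqP.
have te := expf_neq0 e t0.
by rewrite subr_eq0 => /eqP h; rewrite subr_eq0 -[t ^+ e]mul1r h divfK.
Qed.

Lemma qpoch_negpow_neq0 L k : (k <= L)%N -> qp (q ^+ L)^-1 k != 0.
Proof.
move=> kL; rewrite /qpoch; apply/prodf_neq0 => j _.
have jL : (j < L)%N := leq_trans (ltn_ord j) kL.
have qj := expf_neq0 j q0; have qL := expf_neq0 (L - j) q0.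
rewrite -(subnKC (ltnW jL)) exprD invfM mulrA divff // mul1r.
by rewrite subr_eq0 eq_sym invr_eq1 q1 // subn_gt0.
Qed.

Lemma qpoch_negpow_eq0 L k : (L < k)%N -> qp (q ^+ L)^-1 k = 0.
Proof.
move=> Lk; apply: qpoch_eq0W Lk _; rewrite qpochSr divff ?expf_neq0 //.
by rewrite subrr mulr0.
Qed.

Lemma qpoch_negpow_eq0E L k : (qp (q ^+ L)^-1 k == 0) = (L < k)%N.
Proof.
case: ltnP => [/qpoch_negpow_eq0 ->|/qpoch_negpow_neq0/negPf ->] //.
by rewrite eqxx.
Qed.

Definition core_weight (L M : nat) (x y : F) A B D := Wk x (q ^+ L * x) y (q ^+ M * y) A B D.

(* For distinct indices i the deformed parameters of the three modules have
   generic ratios, and they become q^L x at t = 1. *)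
Definition def (i L : nat) (x t : F) := t ^+ i * (q ^+ L * x).

Lemma alim_def i L x : alim 1 (def i L x) (q ^+ L * x).
Proof.
have h := alimM (alimX i (alim_id 1)) (alim_cst 1 (q ^+ L * x)).
by rewrite expr1n mul1r in h.
Qed.

Lemma def_neq0 L x : x != 0 -> q ^+ L * x != 0.
Proof. by move=> x0; rewrite mulf_neq0 ?expf_neq0. Qed.

Lemma alim_h i L x k : x != 0 -> alim 1 (fun t => qp (x / def i L x t) k) (qp (q ^+ L)^-1 k).
Proof.
move=> x0; have qL := expf_neq0 L q0.
have := alim_qpoch q k (alim_div (def_neq0 L x0) (alim_cst 1 x) (alim_def i L x)).
by rewrite (_ : x / (q ^+ L * x) = (q ^+ L)^-1) //; field; rewrite ?x0 ?qL.
Qed.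

Lemma cof_ratio i L x y K : (0 < i)%N -> y != 0 ->
  cof (fun t => qp (x / def i L y t) K != 0).
Proof.
move=> i0 y0; apply: cofI2 (cof_neq 0) (cof_qpoch (x / (q ^+ L * y)) K i0) => t t0.
have qL := expf_neq0 L q0; have ti := expf_neq0 i t0.
rewrite (_ : x / def i L y t = x / (q ^+ L * y) / t ^+ i) // /def.
by field; rewrite ?ti ?y0 ?qL.
Qed.

Lemma cof_ratio_def i j L M x y K : (i < j)%N -> y != 0 ->
  cof (fun t => qp (def i L x t / def j M y t) K != 0).
Proof.
move=> ij y0; apply: cofI2 (cof_neq 0)
  (cof_qpoch (q ^+ L * x / (q ^+ M * y)) K (e := j - i) _) => [t t0|]; last first.
  by rewrite subn_gt0.
have qM := expf_neq0 M q0; have ti := expf_neq0 i t0; have tji := expf_neq0 (j - i) t0.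
rewrite (_ : def i L x t / _ = q ^+ L * x / (q ^+ M * y) / t ^+ (j - i)) // /def.
rewrite -{1}(subnKC (ltnW ij)) exprD.
by field; rewrite ?ti ?y0 ?qM ?tji.
Qed.

Lemma cof_def_neq0 i L x : x != 0 -> cof (fun t => def i L x t != 0).
Proof.
move=> x0; apply: cofW (cof_neq 0) => t t0.
by rewrite mulf_neq0 ?expf_neq0 ?def_neq0.
Qed.

(** The cofactors X and Y are regular at t = 1, so all zeros and poles sit in the displayed symbols.
    The sizes are not bounded, so states above the spins are covered. *)
Lemma weight_lims i j L M x y A B C D : (0 < i)%N -> (0 < j)%N -> x != 0 -> y != 0 ->
  addc A B = addc C D -> qp (x / (q ^+ M * y)) (wt (addc C D)) != 0 ->
  exists X Y : F -> F, [/\ exlim 1 X, exlim 1 Y,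
    cof (fun t => Wk x (def i L x t) y (def j M y t) A B D =
      qp (x / def i L x t) (wt B) * X t / qp (x / def i L x t) (wt D)) &
    cof (fun t => Wk x (def i L x t) y (def j M y t) A B D =
      qp (y / def j M y t) (wt A) * Y t / qp (y / def j M y t) (wt C))].
Proof.
move=> i0 j0 x0 y0 eN hxy.
exists (fun t => Worig q x (def i L x t) y (def j M y t) A B D).
exists (fun t => Walt q x (def i L x t) y (def j M y t) A C D); split.
- apply: exlim_Worig (alim_cst 1 x) (alim_def i L x) (alim_cst 1 y) (alim_def j M y) _ _ _ _;
  by rewrite ?def_neq0 ?eN.
- apply: exlim_Walt (alim_cst 1 x) (alim_def i L x) (alim_cst 1 y) (alim_def j M y) _ _ _ _;
  by rewrite ?def_neq0.
- apply: cofI2 (cof_def_neq0 i L x0) (cof_def_neq0 j M y0) => t b0 d0.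
  exact: Wk_orig.
- have h := cofI (cof_def_neq0 i L x0) (cof_def_neq0 j M y0).
  have h1 := cofI h (cof_ratio M x (wt (addc C D)) j0 y0).
  have h2 := cofI (cof_ratio M y (wt C) j0 y0) (cof_ratio L x (wt D) i0 x0).
  apply: cofI2 h1 h2 => t [[b0 d0] had] [hcd hab].
  exact: Wk_alt.
Qed.

End Truncation.

(** * The Yang-Baxter equation at finite spins, for generic x1, x2, x3 *)

Section TruncatedYangBaxter.
Variables (F : fieldType) (q : F).
Hypotheses (q0 : q != 0) (q1 : forall k, (0 < k)%N -> q ^+ k != 1).
Variable n : nat.
Local Notation vec := {ffun 'I_n -> nat}.
Local Notation qp := (qpoch q).
Local Notation Wk := (vertex_kernel q).
Local Notation WW := (core_weight q).
Local Notation def := (def q).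

Variables (L1 L2 L3 : nat) (x1 x2 x3 : F) (N J1 I1 K1 J3 I3 K3 : vec).
Hypotheses (nz : [&& x1 != 0, x2 != 0 & x3 != 0]).
Let ok x := qp x (wt N) != 0.
Hypotheses (ok_x : [&& ok (x1 / x2), ok (x1 / x3) & ok (x2 / x3)]).
Hypotheses (ok_xy : [&& ok (x1 / (q ^+ L2 * x2)), ok (x1 / (q ^+ L3 * x3)) &
  ok (x2 / (q ^+ L3 * x3))]).
Hypotheses (tot3 : addc (addc J3 I3) K3 = N) (tot1 : addc (addc K1 I1) J1 = N).
Hypotheses (J3L : (wt J3 <= L1)%N) (I3L : (wt I3 <= L2)%N) (K3L : (wt K3 <= L3)%N).

Let W12 t := @vertex_kernel F q n x1 (def 1 L1 x1 t) x2 (def 2 L2 x2 t).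
Let W13 t := @vertex_kernel F q n x1 (def 1 L1 x1 t) x3 (def 3 L3 x3 t).
Let W23 t := @vertex_kernel F q n x2 (def 2 L2 x2 t) x3 (def 3 L3 x3 t).

Let okW (x : F) k : ok x -> (k <= wt N)%N -> qp x k != 0.
Proof. by move=> h kN; apply: qpoch_neq0W kN h. Qed.

Let alim_WW i j L M x y (A B C D : vec) : x != 0 -> y != 0 ->
  qp (x / (q ^+ M * y)) (wt (addc A B)) != 0 -> (wt D <= L)%N ->
  alim 1 (fun t => Wk x (def i L x t) y (def j M y t) A B D) (WW L M x y A B D).
Proof.
move=> x0 y0 h DL.
apply: alim_Wk (alim_cst 1 x) (alim_def q i L x) (alim_cst 1 y) (alim_def q j M y) _ _ _ _ _;
  rewrite ?def_neq0 //.
have qL := expf_neq0 L q0.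
rewrite (_ : x / (q ^+ L * x) = (q ^+ L)^-1); first exact: qpoch_negpow_neq0.
by field; rewrite ?x0 ?qL.
Qed.

Let cof_h i L x k : (0 < i)%N -> x != 0 -> cof (fun t => qp (x / def i L x t) k != 0).
Proof. exact: cof_ratio. Qed.

Let exlim_hM i L x k f : x != 0 -> exlim 1 f -> exlim 1 (fun t => qp (x / def i L x t) k * f t).
Proof. by move=> x0; apply: exlimM; apply: alim_ex; apply: alim_h. Qed.

Let exlim_div_h i L x k f : x != 0 -> (k <= L)%N -> exlim 1 f ->
  exlim 1 (fun t => f t / qp (x / def i L x t) k).
Proof.
move=> x0 kL hf; apply: exlimM hf _.
by apply: exlimV (alim_h q0 i L k x0); apply: qpoch_negpow_neq0.
Qed.

(** Each intermediate vector occurs in a numerator and in a later denominator: J2 in kernels 1 and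
    2, I2 in 1 and 3, K2 in 2 and 3. This is the pattern of [alim_triple], with limit zeros exactly
    for sizes above the spins. *)
Let alim_right I2 J2 K2 : addc I2 J2 = addc J3 I3 -> addc K2 J1 = addc J2 K3 ->
  alim 1 (fun t => W12 t I2 J2 J3 * W13 t K2 J1 J2 * W23 t K1 I1 I2)
    (if [&& wt J2 <= L1, wt I2 <= L2 & wt K2 <= L3]%N then
       WW L1 L2 x1 x2 I2 J2 J3 * WW L1 L3 x1 x3 K2 J1 J2 * WW L2 L3 x2 x3 K1 I1 I2
     else 0).
Proof.
move=> e12 e13; case/and3P: nz => x10 x20 x30.
case/and3P: ok_xy => ok12 ok13 ok23.
have e12' : addc I2 J2 = addc I3 J3 by rewrite e12; apply/vecP=> i; rewrite !vecE addnC.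
have e13' : addc K2 J1 = addc K3 J2 by rewrite e13; apply/vecP=> i; rewrite !vecE addnC.
have e23 : addc K1 I1 = addc K2 I2.
  apply/vecP=> i; move/vecP: tot1 => /(_ i); move/vecP: tot3 => /(_ i).
  by move/vecP: e12 => /(_ i); move/vecP: e13 => /(_ i); rewrite !vecE; natlia.
have w12 : (wt (addc I3 J3) <= wt N)%N by rewrite -tot3 !wt_addc; natlia.
have w13 : (wt (addc K3 J2) <= wt N)%N.
  by rewrite -e13'; move: (f_equal (@wt n) e12) (f_equal (@wt n) e13); rewrite -tot3 !wt_addc; natlia.
have w23 : (wt (addc K2 I2) <= wt N)%N by rewrite -e23 -tot1 !wt_addc; natlia.
case: ifP => [/and3P[J2L I2L K2L]|/negbT out].
  apply: alimM; [apply: alimM|]; apply: alim_WW => //.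
  - by rewrite e12'; apply: okW.
  - by rewrite e13'; apply: okW.
  - by rewrite e23; apply: okW.
have [//|//|X1 [Y1 [hX1 hY1 E1 E1']]] :=
  weight_lims q0 q1 (i := 1) (j := 2) L1 _ _ x10 x20 e12' (okW ok12 w12).
have [//|//|X2 [Y2 [hX2 hY2 E2 E2']]] :=
  weight_lims q0 q1 (i := 1) (j := 3) L1 _ _ x10 x30 e13' (okW ok13 w13).
have [//|//|X3 [Y3 [hX3 hY3 E3 E3']]] :=
  weight_lims q0 q1 (i := 2) (j := 3) L2 _ _ x20 x30 e23 (okW ok23 w23).
(* The symbols of J3, I3, K3 have nonzero limits because these vectors respect the spins; they are
   absorbed in the regular cofactors. *)
apply: (alim_triple (alim_h q0 1 L1 (wt J2) x10) (alim_h q0 2 L2 (wt I2) x20)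
  (alim_h q0 3 L3 (wt K2) x30) (cof_h L2 (wt I2) (ltn0Sn 1) x20)
  (exlim_div_h 1 x10 J3L hX1) (exlim_div_h 2 x20 I3L hY1)
  (exlim_hM 1 L1 (wt J1) x10 hX2) (exlim_div_h 3 x30 K3L hY2)
  (exlim_hM 2 L2 (wt I1) x20 hX3) (exlim_hM 3 L3 (wt K1) x30 hY3)).
- by apply: cofW E1 => t; rewrite /W12 => ->; rewrite -mulrA.
- by apply: cofW E1' => t; rewrite /W12 => ->; rewrite -mulrA.
- by [].
- by apply: cofW E2' => t; rewrite /W13 => ->; rewrite -mulrA.
- by [].
- by [].
by move: out; rewrite !negb_and -!ltnNge !qpoch_negpow_eq0E.
Qed.

Let alim_left K2 I2 J2 : addc K2 I2 = addc I3 K3 -> addc K1 J2 = addc J3 K2 ->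
  alim 1 (fun t => W23 t K2 I2 I3 * W13 t K1 J2 J3 * W12 t I1 J1 J2)
    (if [&& wt J2 <= L1, wt I2 <= L2 & wt K2 <= L3]%N then
       WW L2 L3 x2 x3 K2 I2 I3 * WW L1 L3 x1 x3 K1 J2 J3 * WW L1 L2 x1 x2 I1 J1 J2
     else 0).
Proof.
move=> e23 e13; case/and3P: nz => x10 x20 x30.
case/and3P: ok_xy => ok12 ok13 ok23.
have e23' : addc K2 I2 = addc K3 I3 by rewrite e23; apply/vecP=> i; rewrite !vecE addnC.
have e13' : addc K1 J2 = addc K2 J3 by rewrite e13; apply/vecP=> i; rewrite !vecE addnC.
have e12 : addc I1 J1 = addc I2 J2.
  apply/vecP=> i; move/vecP: tot1 => /(_ i); move/vecP: tot3 => /(_ i).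
  by move/vecP: e23 => /(_ i); move/vecP: e13 => /(_ i); rewrite !vecE; natlia.
have w23 : (wt (addc K3 I3) <= wt N)%N by rewrite -tot3 !wt_addc; natlia.
have w13 : (wt (addc K2 J3) <= wt N)%N.
  by move: (f_equal (@wt n) e23); rewrite -tot3 !wt_addc; natlia.
have w12 : (wt (addc I2 J2) <= wt N)%N by rewrite -e12 -tot1 !wt_addc; natlia.
case: ifP => [/and3P[J2L I2L K2L]|/negbT out].
  apply: alimM; [apply: alimM|]; apply: alim_WW => //.
  - by rewrite e23'; apply: okW.
  - by rewrite e13'; apply: okW.
  - by rewrite e12; apply: okW.
have [//|//|X1 [Y1 [hX1 hY1 E1 E1']]] :=
  weight_lims q0 q1 (i := 2) (j := 3) L2 _ _ x20 x30 e23' (okW ok23 w23).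
have [//|//|X2 [Y2 [hX2 hY2 E2 E2']]] :=
  weight_lims q0 q1 (i := 1) (j := 3) L1 _ _ x10 x30 e13' (okW ok13 w13).
have [//|//|X3 [Y3 [hX3 hY3 E3 E3']]] :=
  weight_lims q0 q1 (i := 1) (j := 2) L1 _ _ x10 x20 e12 (okW ok12 w12).
(* K2, I2, J2 take the roles of J2, I2, K2 above, which exchanges the two factorizations. *)
apply: (alim_triple (alim_h q0 3 L3 (wt K2) x30) (alim_h q0 2 L2 (wt I2) x20)
  (alim_h q0 1 L1 (wt J2) x10) (cof_h L2 (wt I2) (ltn0Sn 1) x20)
  (exlim_div_h 3 x30 K3L hY1) (exlim_div_h 2 x20 I3L hX1)
  (exlim_hM 3 L3 (wt K1) x30 hY2) (exlim_div_h 1 x10 J3L hX2)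
  (exlim_hM 2 L2 (wt I1) x20 hY3) (exlim_hM 1 L1 (wt J1) x10 hX3)).
- by apply: cofW E1' => t; rewrite /W23 => ->; rewrite -mulrA.
- by apply: cofW E1 => t; rewrite /W23 => ->; rewrite -mulrA.
- by [].
- by apply: cofW E2 => t; rewrite /W13 => ->; rewrite -mulrA.
- by [].
- by [].
rewrite !(qpoch_negpow_eq0E q0 q1); move: out; rewrite !negb_and -!ltnNge => /or3P[] ->; by rewrite ?orbT.
Qed.

Theorem truncated_yang_baxter :
  \sum_(I2 <- box (addc J3 I3))
    (let J2 := subc (addc J3 I3) I2 in
     let K2 := subc (addc J2 K3) J1 in
     if lec J1 (addc J2 K3) then
       if [&& wt J2 <= L1, wt I2 <= L2 & wt K2 <= L3]%N then
         WW L1 L2 x1 x2 I2 J2 J3 * WW L1 L3 x1 x3 K2 J1 J2 * WW L2 L3 x2 x3 K1 I1 I2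
       else 0
     else 0)
  = \sum_(K2 <- box (addc I3 K3))
    (let I2 := subc (addc I3 K3) K2 in
     let J2 := subc (addc J3 K2) K1 in
     if lec K1 (addc J3 K2) then
       if [&& wt J2 <= L1, wt I2 <= L2 & wt K2 <= L3]%N then
         WW L2 L3 x2 x3 K2 I2 I3 * WW L1 L3 x1 x3 K1 J2 J3 * WW L1 L2 x1 x2 I1 J1 J2
       else 0
     else 0).
Proof.
have eN : addc (addc J3 I3) K3 = addc (addc K1 I1) J1 by rewrite tot3 tot1.
(* The untruncated deformed sums agree at generic t by [yang_baxter], and their limits at t = 1 are
   the two truncated sums. *)
apply: (alim_unique q0 q1 (s := 1) (f := fun t => \sum_(I2 <- box (addc J3 I3))
    (let J2 := subc (addc J3 I3) I2 in
     let K2 := subc (addc J2 K3) J1 in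
     if lec J1 (addc J2 K3) then
       W12 t I2 J2 J3 * W13 t K2 J1 J2 * W23 t K1 I1 I2 else 0))).
  apply: alim_sum => I2; rewrite mem_box => /lecP I2le _ /=.
  case: ifP => [/lecP J1le|_]; last exact: alim_cst.
  by apply: alim_right; apply/vecP=> i; move: (I2le i) (J1le i); rewrite !vecE; natlia.
have h : alim 1 (fun t => \sum_(K2 <- box (addc I3 K3))
    (let I2 := subc (addc I3 K3) K2 in
     let J2 := subc (addc J3 K2) K1 in
     if lec K1 (addc J3 K2) then
       W23 t K2 I2 I3 * W13 t K1 J2 J3 * W12 t I1 J1 J2 else 0))
  (\sum_(K2 <- box (addc I3 K3))
    (let I2 := subc (addc I3 K3) K2 in
     let J2 := subc (addc J3 K2) K1 in
     if lec K1 (addc J3 K2) then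
       if [&& wt J2 <= L1, wt I2 <= L2 & wt K2 <= L3]%N then
         WW L2 L3 x2 x3 K2 I2 I3 * WW L1 L3 x1 x3 K1 J2 J3 * WW L1 L2 x1 x2 I1 J1 J2
       else 0
     else 0)).
  apply: alim_sum => K2; rewrite mem_box => /lecP K2le _ /=.
  case: ifP => [/lecP K1le|_]; last exact: alim_cst.
  by apply: alim_left; apply/vecP=> i; move: (K2le i) (K1le i); rewrite !vecE; natlia.
apply: alim_cofW h.
case/and3P: nz => x10 x20 x30.
have c1 := cofI (cof_def_neq0 q0 1 L1 x10) (cofI (cof_def_neq0 q0 2 L2 x20) (cof_def_neq0 q0 3 L3 x30)).
have r x y i L (i0 : (0 < i)%N) (y0 : y != 0) := cof_ratio q0 (q := q) L x (wt N) i0 y0.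
have c2 := cofI (r x1 x1 1 L1 isT x10) (cofI (r x1 x2 2 L2 isT x20) (r x1 x3 3 L3 isT x30)).
have c3 := cofI (r x2 x1 1 L1 isT x10) (cofI (r x2 x2 2 L2 isT x20) (r x2 x3 3 L3 isT x30)).
have c4 := cofI (r x3 x1 1 L1 isT x10) (cofI (r x3 x2 2 L2 isT x20) (r x3 x3 3 L3 isT x30)).
have rd i j L M x y (ij : (i < j)%N) (y0 : y != 0) := cof_ratio_def q0 L M x (wt N) ij y0.
have c5 := cofI (rd 1%N 2%N L1 L2 x1 x2 isT x20) (cofI (rd 1%N 3%N L1 L3 x1 x3 isT x30)
  (rd 2%N 3%N L2 L3 x2 x3 isT x30)).
apply: cofI2 (cofI c1 c5) (cofI c2 (cofI c3 c4)) => t [[b1 [b2 b3]] [d1 [d2 d3]]].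
case=> [[e1 [e2 e3]]] [[e4 [e5 e6]] [e7 [e8 e9]]].
rewrite -chain_left // -chain_right //; symmetry; apply: (yang_baxter q0 q1 (N := N)).
- by rewrite /= x10 x20 x30 b1 b2 b3.
- by rewrite /allrel /= e1 e2 e3 e4 e5 e6 e7 e8 e9.
- exact: ok_x.
- by rewrite d1 d2 d3.
- exact: tot3.
Qed.

End TruncatedYangBaxter.

(** * The Yang-Baxter equation at finite spins, for special x1, x2, x3 *)

Section Specialization.
Variables (F : fieldType) (q : F).
Hypotheses (q0 : q != 0) (q1 : forall k, (0 < k)%N -> q ^+ k != 1).
Variable n : nat.
Local Notation vec := {ffun 'I_n -> nat}.
Local Notation qp := (qpoch q).
Local Notation WW := (core_weight q).

Variables (L1 L2 L3 : nat) (x1 x2 x3 : F) (N J1 I1 K1 J3 I3 K3 : vec).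
Hypotheses (nz : [&& x1 != 0, x2 != 0 & x3 != 0]).
Hypotheses (tot3 : addc (addc J3 I3) K3 = N) (tot1 : addc (addc K1 I1) J1 = N).
Hypotheses (J3L : (wt J3 <= L1)%N) (I3L : (wt I3 <= L2)%N) (K3L : (wt K3 <= L3)%N).

(** This deformation moves x1, x2, x3 apart but keeps b = q^L a, so the truncation by the spins
    holds all along it. *)
Let sp (i : nat) (x t : F) := t ^+ i * x.

Let alim_sp i x : alim 1 (sp i x) x.
Proof.
have h := alimM (alimX i (alim_id 1)) (alim_cst 1 x).
by rewrite expr1n mul1r in h.
Qed.

Let cof_sp i j L x y K : (i < j)%N -> y != 0 ->
  cof (fun t => qp (sp i x t / (q ^+ L * sp j y t)) K != 0).
Proof.
move=> ij y0; apply: cofI2 (cof_neq 0)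
  (cof_qpoch q (x / (q ^+ L * y)) K (e := j - i) _) => [t t0|]; last first.
  by rewrite subn_gt0.
have qL := expf_neq0 L q0; have ti := expf_neq0 i t0; have tji := expf_neq0 (j - i) t0.
rewrite (_ : sp i x t / _ = x / (q ^+ L * y) / t ^+ (j - i)) // /sp.
rewrite -{1}(subnKC (ltnW ij)) exprD.
by field; rewrite ?ti ?y0 ?qL ?tji.
Qed.

Let alim_WW i j L M x y (A B D : vec) : x != 0 -> y != 0 ->
  qp (x / (q ^+ M * y)) (wt (addc A B)) != 0 -> (wt D <= L)%N ->
  alim 1 (fun t => WW L M (sp i x t) (sp j y t) A B D) (WW L M x y A B D).
Proof.
move=> x0 y0 h DL.
have hq L' k z : alim 1 (fun t => q ^+ L' * sp k z t) (q ^+ L' * z).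
  exact: alimM (alim_cst 1 _) (alim_sp k z).
apply: alim_Wk (alim_sp i x) (hq L i x) (alim_sp j y) (hq M j y) _ _ _ _ _;
  rewrite ?(def_neq0 q0) //.
have qL := expf_neq0 L q0.
rewrite (_ : x / (q ^+ L * x) = (q ^+ L)^-1); first exact: qpoch_negpow_neq0.
by field; rewrite ?x0 ?qL.
Qed.

(** Nonvanishing is asked only for sizes met by an actual weight within the spins, since definedness
    of the S gives no more. *)
Hypothesis right_ok : forall I2 J2 K2 : vec,
  addc I2 J2 = addc J3 I3 -> addc K2 J1 = addc J2 K3 ->
  (wt J2 <= L1)%N -> (wt I2 <= L2)%N -> (wt K2 <= L3)%N ->
  [/\ qp (x1 / (q ^+ L2 * x2)) (wt (addc I2 J2)) != 0,
      qp (x1 / (q ^+ L3 * x3)) (wt (addc K2 J1)) != 0 &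
      qp (x2 / (q ^+ L3 * x3)) (wt (addc K1 I1)) != 0].
Hypothesis left_ok : forall K2 I2 J2 : vec,
  addc K2 I2 = addc I3 K3 -> addc K1 J2 = addc J3 K2 ->
  (wt J2 <= L1)%N -> (wt I2 <= L2)%N -> (wt K2 <= L3)%N ->
  [/\ qp (x2 / (q ^+ L3 * x3)) (wt (addc K2 I2)) != 0,
      qp (x1 / (q ^+ L3 * x3)) (wt (addc K1 J2)) != 0 &
      qp (x1 / (q ^+ L2 * x2)) (wt (addc I1 J1)) != 0].

Theorem special_yang_baxter :
  \sum_(I2 <- box (addc J3 I3))
    (let J2 := subc (addc J3 I3) I2 in
     let K2 := subc (addc J2 K3) J1 in
     if lec J1 (addc J2 K3) then
       if [&& wt J2 <= L1, wt I2 <= L2 & wt K2 <= L3]%N then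
         WW L1 L2 x1 x2 I2 J2 J3 * WW L1 L3 x1 x3 K2 J1 J2 * WW L2 L3 x2 x3 K1 I1 I2
       else 0
     else 0)
  = \sum_(K2 <- box (addc I3 K3))
    (let I2 := subc (addc I3 K3) K2 in
     let J2 := subc (addc J3 K2) K1 in
     if lec K1 (addc J3 K2) then
       if [&& wt J2 <= L1, wt I2 <= L2 & wt K2 <= L3]%N then
         WW L2 L3 x2 x3 K2 I2 I3 * WW L1 L3 x1 x3 K1 J2 J3 * WW L1 L2 x1 x2 I1 J1 J2
       else 0
     else 0).
Proof.
case/and3P: (nz) => x10 x20 x30.
pose f1 := sp 0 x1; pose f2 := sp 1 x2; pose f3 := sp 2 x3.
apply: (alim_unique q0 q1 (s := 1) (f := fun t => \sum_(I2 <- box (addc J3 I3))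
    (let J2 := subc (addc J3 I3) I2 in
     let K2 := subc (addc J2 K3) J1 in
     if lec J1 (addc J2 K3) then
       if [&& wt J2 <= L1, wt I2 <= L2 & wt K2 <= L3]%N then
         WW L1 L2 (f1 t) (f2 t) I2 J2 J3 * WW L1 L3 (f1 t) (f3 t) K2 J1 J2
         * WW L2 L3 (f2 t) (f3 t) K1 I1 I2
       else 0
     else 0))).
  apply: alim_sum => I2; rewrite mem_box => /lecP I2le _ /=.
  case: ifP => [/lecP J1le|_]; last exact: alim_cst.
  case: ifP => [/and3P[J2L I2L K2L]|_]; last exact: alim_cst.
  set J2 := subc _ I2 in J1le J2L K2L *; set K2 := subc _ J1 in K2L *.
  have e1 : addc I2 J2 = addc J3 I3.
    by apply/vecP=> i; move: (I2le i); rewrite !vecE; natlia.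
  have e2 : addc K2 J1 = addc J2 K3.
    by apply/vecP=> i; move: (J1le i); rewrite !vecE; natlia.
  have [h1 h2 h3] := right_ok e1 e2 J2L I2L K2L.
  by apply: alimM; [apply: alimM|]; apply: alim_WW.
have h : alim 1 (fun t => \sum_(K2 <- box (addc I3 K3))
    (let I2 := subc (addc I3 K3) K2 in
     let J2 := subc (addc J3 K2) K1 in
     if lec K1 (addc J3 K2) then
       if [&& wt J2 <= L1, wt I2 <= L2 & wt K2 <= L3]%N then
         WW L2 L3 (f2 t) (f3 t) K2 I2 I3 * WW L1 L3 (f1 t) (f3 t) K1 J2 J3
         * WW L1 L2 (f1 t) (f2 t) I1 J1 J2
       else 0
     else 0))
  (\sum_(K2 <- box (addc I3 K3))
    (let I2 := subc (addc I3 K3) K2 in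
     let J2 := subc (addc J3 K2) K1 in
     if lec K1 (addc J3 K2) then
       if [&& wt J2 <= L1, wt I2 <= L2 & wt K2 <= L3]%N then
         WW L2 L3 x2 x3 K2 I2 I3 * WW L1 L3 x1 x3 K1 J2 J3 * WW L1 L2 x1 x2 I1 J1 J2
       else 0
     else 0)).
  apply: alim_sum => K2; rewrite mem_box => /lecP K2le _ /=.
  case: ifP => [/lecP K1le|_]; last exact: alim_cst.
  case: ifP => [/and3P[J2L I2L K2L]|_]; last exact: alim_cst.
  set I2 := subc _ K2 in I2L *; set J2 := subc _ K1 in J2L *.
  have e1 : addc K2 I2 = addc I3 K3.
    by apply/vecP=> i; move: (K2le i); rewrite !vecE; natlia.
  have e2 : addc K1 J2 = addc J3 K2.
    by apply/vecP=> i; move: (K1le i); rewrite !vecE; natlia.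
  have [h1 h2 h3] := left_ok e1 e2 J2L I2L K2L.
  by apply: alimM; [apply: alimM|]; apply: alim_WW.
apply: alim_cofW h.
have c0 x y i j (ij : (i < j)%N) (y0 : y != 0) := cof_sp 0 x (wt N) ij y0.
have c1 := cofI (c0 x1 x2 0%N 1%N isT x20) (cofI (c0 x1 x3 0%N 2%N isT x30) (c0 x2 x3 1%N 2%N isT x30)).
have c x y i j L (ij : (i < j)%N) (y0 : y != 0) := cof_sp L x (wt N) ij y0.
have c2 := cofI (c x1 x2 0%N 1%N L2 isT x20)
  (cofI (c x1 x3 0%N 2%N L3 isT x30) (c x2 x3 1%N 2%N L3 isT x30)).
apply: cofI2 (cofI (cof_neq 0) c1) c2 => t [t0 [a1 [a2 a3]]] [b1 [b2 b3]].
rewrite /= !mul1r in a1 a2 a3.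
symmetry; apply: (truncated_yang_baxter q0 q1 (N := N)) => //.
- by rewrite !mulf_neq0 ?expf_neq0.
- by apply/and3P; split.
- by apply/and3P; split.
Qed.

End Specialization.

Lemma fsbig_seqE (V : nmodType) (T : choiceType) (A : set T) (r : seq T) (f : T -> V) :
  uniq r -> (forall i, i \in r -> A i) -> (forall i, A i -> i \notin r -> f i = 0) ->
  \sum_(i \in A) f i = \sum_(i <- r) f i.
Proof.
move=> ur rA f0; rewrite (fsbigE r) //; rewrite big_seq_cond [RHS]big_seq.
by apply: eq_bigl => i; rewrite andb_idr // => /rA ir; apply: mem_set.
Qed.

(** * Compositions of fixed size and the bilinear form in the exponent *)

Section Compositions.
Variable n : nat.
Implicit Types X Y A B C D : composition n.

Lemma wt_comp X : wt X = (X ord0 + wt (tail X))%N.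
Proof.
rewrite /wt big_ord_recl; congr (_ + _)%N.
by apply: eq_bigr => i _; rewrite ffunE.
Qed.

Lemma tail_addc X Y : tail (addc X Y) = addc (tail X) (tail Y).
Proof. by apply/vecP=> i; rewrite !ffunE. Qed.

(* The composition of size M with tail v, when wt v <= M. *)
Definition extc (M : nat) (v : {ffun 'I_n -> nat}) : composition n :=
  [ffun i => if unlift ord0 i is Some j then v j else (M - wt v)%N].

Lemma extc0 M v : extc M v ord0 = (M - wt v)%N.
Proof. by rewrite ffunE unlift_none. Qed.

Lemma tail_extc M v : tail (extc M v) = v.
Proof. by apply/vecP=> i; rewrite !ffunE liftK. Qed.

Lemma wt_extc M v : (wt v <= M)%N -> wt (extc M v) = M.
Proof. by move=> vM; rewrite wt_comp extc0 tail_extc subnK. Qed.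

Lemma compP X Y : X ord0 = Y ord0 -> tail X = tail Y -> X = Y.
Proof.
move=> e0 /vecP e; apply/vecP=> i; case: (unliftP ord0 i) => [j|] -> //.
by move: (e j); rewrite !ffunE.
Qed.

Lemma extc_tail X : extc (wt X) (tail X) = X.
Proof. by apply: compP; rewrite ?tail_extc // extc0 wt_comp addnK. Qed.

Lemma wt_tail_le X : (wt (tail X) <= wt X)%N.
Proof. by rewrite wt_comp leq_addl. Qed.

(** The bilinear form behind the exponent of q in S, which up to linear terms is pairing A B -
    pairing D C. With the conservation laws, bilinearity makes the exponents telescope. *)
Definition pairing (a b : composition n) : int :=
  (a ord0)%:Z * (b ord0)%:Z
  - \sum_(i < n.+1) \sum_(j < n.+1 | (0 < i < j)%N) (a j)%:Z * (b i)%:Z.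

Lemma pairingDl a a' b : pairing (addc a a') b = pairing a b + pairing a' b.
Proof.
rewrite /pairing addcE PoszD mulrDl.
rewrite (eq_bigr (fun i : 'I_n.+1 => \sum_(j < n.+1 | (0 < i < j)%N) (a j)%:Z * (b i)%:Z +
   \sum_(j < n.+1 | (0 < i < j)%N) (a' j)%:Z * (b i)%:Z)).
  by rewrite big_split /=; ring.
move=> i _; rewrite -big_split; apply: eq_bigr => j _.
by rewrite addcE PoszD mulrDl.
Qed.

Lemma pairingDr a b b' : pairing a (addc b b') = pairing a b + pairing a b'.
Proof.
rewrite /pairing addcE PoszD mulrDr.
rewrite (eq_bigr (fun i : 'I_n.+1 => \sum_(j < n.+1 | (0 < i < j)%N) (a j)%:Z * (b i)%:Z +
   \sum_(j < n.+1 | (0 < i < j)%N) (a j)%:Z * (b' i)%:Z)).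
  by rewrite big_split /=; ring.
move=> i _; rewrite -big_split; apply: eq_bigr => j _.
by rewrite addcE PoszD mulrDr.
Qed.

End Compositions.

(** * Factorization of S into gauge factors and a matrix element of R *)

Section Weights.
Variables (F : fieldType) (q : F).
Hypotheses (q0 : q != 0) (q1 : forall k, (0 < k)%N -> q ^+ k != 1).
Variable n : nat.
Implicit Types X Y A B C D : composition n.
Local Notation qp := (qpoch q).
Local Notation WW := (core_weight q).
Local Notation Sw := (Sweight q).

Definition wexp L M A B C D : int :=
  M%:Z * (D ord0)%:Z - L%:Z * (A ord0)%:Z + pairing A B - pairing D C.

(** For k <= L this is the product of the last k factors of (u;q)_L. *)
Definition dyn_qpoch (L k : nat) (u : F) := qp (q ^ (L%:Z - k%:Z) * u) k.
Definition comp_qfact X := \prod_(i < n.+1) qp q (X i).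

Lemma qfact_neq0 X : comp_qfact X != 0.
Proof. by apply/prodf_neq0 => i _; apply: qq_neq0. Qed.

Lemma exprzB (a b : nat) : q ^ (a%:Z - b%:Z) = q ^+ a / q ^+ b.
Proof. by rewrite expfzDr // -exprnP -exprnN. Qed.

Lemma Sweight_core L M A D x y (B : composition n) : x != 0 -> y != 0 ->
  \sum_(P \in Srange A D)
   (Phi q (subc (tail A) P) (subc (addc (tail A) (tail B)) P)
       (q ^ (L%:Z - M%:Z) * x * y^-1) (q ^ (- M%:Z) * x * y^-1)
    * Phi q P (tail D) (q ^ (- L%:Z) * x^-1 * y) (q ^ (- L%:Z)))
  = WW L M x y (tail A) (tail B) (tail D).
Proof.
move=> x0 y0; have qL := expf_neq0 L q0; have qM := expf_neq0 M q0.
rewrite exprzB -!exprnN.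
rewrite (@fsbig_seqE _ _ _ (box (minc (tail A) (tail D)))).
- rewrite /core_weight /vertex_kernel; apply: eq_bigr => P _; congr (_ * _); congr Phi;
  by field; rewrite ?x0 ?y0 ?qL ?qM.
- exact: box_uniq.
- move=> P /=; rewrite mem_box => /lecP PM i; move: (PM i).
  by rewrite vecE.
- move=> P PM; rewrite mem_box => /lecP; case=> i; rewrite vecE.
  exact: PM.
Qed.

Definition wdyn L M A B C D x y v : F :=
  (dyn_qpoch L (D ord0) (v * x) / dyn_qpoch L (B ord0) (q ^ (M%:Z - (A ord0)%:Z) * (v * x)))
  * (dyn_qpoch M (C ord0) (q ^ (L%:Z - (D ord0)%:Z) * (v * y)) / dyn_qpoch M (A ord0) (v * y)).

Lemma Sweight_decomp L M A B C D x y v : Sadmissible L M A B C D ->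
  x != 0 -> y != 0 ->
  Sw L M A B C D x y v =
  q ^ wexp L M A B C D * wdyn L M A B C D x y v
  * (comp_qfact A * comp_qfact B / (comp_qfact C * comp_qfact D))
  * WW L M x y (tail A) (tail B) (tail D).
Proof.
move=> adm x0 y0; rewrite /Sweight adm Sweight_core // /wdyn [q ^ wexp _ _ _ _ _ _ * (_ * _)]mulrA.
congr (_ * _ * _ * _ * _).
- congr (_ ^ _); rewrite /Sexponent /wexp /pairing.
  case/and5P: adm => /eqP /vecP/(_ ord0); rewrite !addcE => e0 _ _ _ _.
  rewrite (eq_bigr (fun i : 'I_n.+1 => \sum_(j < n.+1 | (0 < i < j)%N) (D j)%:Z * (C i)%:Z -
     \sum_(j < n.+1 | (0 < i < j)%N) (A j)%:Z * (B i)%:Z)); last by move=> i _; rewrite sumrB.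
  rewrite sumrB; set s1 := \sum_(i < n.+1) _; set s2 := \sum_(i < n.+1) _.
  have -> : (B ord0)%:Z = (C ord0)%:Z + (D ord0)%:Z - (A ord0)%:Z by lia.
  by ring.
- congr (_ / _); rewrite /dyn_qpoch; congr qp; rewrite -?mulrA //.
  by rewrite !mulrA -expfzDr //; congr (_ ^ _ * _ * _); ring.
- congr (_ / _); rewrite /dyn_qpoch; congr qp; rewrite -?mulrA //.
  by rewrite !mulrA -expfzDr //; congr (_ ^ _ * _ * _); ring.
- by rewrite /comp_qfact big_split prodfV !big_split.
Qed.

Lemma Sdefined_bounds L M A B C D x y v : Sadmissible L M A B C D ->
  Sdefined q L M A B C D x y v ->
  [/\ x != 0, y != 0,
     dyn_qpoch L (B ord0) (q ^ (M%:Z - (A ord0)%:Z) * (v * x)) != 0,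
     dyn_qpoch M (A ord0) (v * y) != 0 &
     qp (x / (q ^+ M * y)) (wt (addc (tail A) (tail B))) != 0].
Proof.
move=> adm def; have [[x0 y0] h1 h2 _ h3] := def adm; split=> //.
- rewrite /dyn_qpoch; move: h1; congr (is_true (qp _ _ != 0)).
  by rewrite !mulrA -expfzDr //; congr (_ ^ _ * _ * _); ring.
- by rewrite /dyn_qpoch mulrA.
(* P = 0 always lies in the range and gives the longest denominator. *)
- have [|[_ h _] _] := h3 (zeroc n); first by move=> i; rewrite zerocE.
  have qM := expf_neq0 M q0.
  move: h; rewrite (_ : subc _ (zeroc n) = addc (tail A) (tail B)); last first.
    by apply/vecP=> i; rewrite !vecE subn0.
  rewrite -exprnN (_ : q ^- M * x / y = x / (q ^+ M * y)) //.
  by field; rewrite ?y0 ?qM.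
Qed.

End Weights.

(** * Telescoping of the gauge factors *)

Section DynamicalYangBaxter.
Variables (F : fieldType) (q : F).
Hypotheses (q0 : q != 0) (q1 : forall k, (0 < k)%N -> q ^+ k != 1).
Variables (n L M T : nat) (x y z v : F) (I1 J1 K1 I3 J3 K3 : composition n).
Local Notation qp := (qpoch q).
Local Notation WW := (core_weight q).
Local Notation Sw := (Sweight q).
Local Notation dyn := (dyn_qpoch q).
Local Notation wdyn := (wdyn q).
Local Notation qfact := (comp_qfact q).
Local Notation sh N k := (q ^ (N%:Z - k%:Z)).

(** Here and in [gdyn] and [gfact], the factor common to both sides is written with the outer
    compositions alone, so that it leaves the sums over I2, J2, K2. *)
Definition gexp : int :=
  M%:Z * ((J3 ord0)%:Z - (K1 ord0)%:Z) + T%:Z * ((I3 ord0)%:Z + (J3 ord0)%:Z)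
  - L%:Z * ((I1 ord0)%:Z + (K1 ord0)%:Z)
  + pairing I1 J1 + pairing K1 I1 + pairing K1 J1
  - pairing J3 I3 - pairing J3 K3 - pairing I3 K3.

Definition gdyn : F :=
  dyn L (J3 ord0) (v * x) * dyn M (I3 ord0) (sh L (J3 ord0) * (v * y))
  * dyn T (K3 ord0) (sh M (I3 ord0) * (sh L (J3 ord0) * (v * z)))
  / (dyn L (J1 ord0) (sh M (I1 ord0) * (sh T (K1 ord0) * (v * x)))
     * dyn M (I1 ord0) (sh T (K1 ord0) * (v * y)) * dyn T (K1 ord0) (v * z)).

Definition gfact : F :=
  qfact I1 * qfact J1 * qfact K1 / (qfact I3 * qfact J3 * qfact K3).

(** Each conservation law is paired with a composition that does not occur in it, which rewrites the
    mixed pairings of the outer compositions. *)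
Lemma gexp_left (I2 J2 K2 : composition n) : addc I1 J1 = addc I2 J2 -> addc K1 J2 = addc K2 J3 ->
  addc K2 I2 = addc K3 I3 ->
  wexp L M I1 J1 I2 J2 + wexp L T K1 J2 K2 J3 + wexp M T K2 I2 K3 I3 = gexp.
Proof.
move=> e1 e2 e3; rewrite /gexp /wexp.
have h1 := f_equal (fun X => pairing X I2) e2.
have h2 := f_equal (fun X => pairing K1 X) e1.
have h3 := f_equal (fun X => pairing J3 X) e3.
rewrite /= !pairingDl in h1; rewrite /= !pairingDr in h2 h3.
have := e2 => /vecP/(_ ord0); rewrite !addcE => e20.
have -> : (J3 ord0)%:Z - (K1 ord0)%:Z = (J2 ord0)%:Z - (K2 ord0)%:Z by lia.
have -> : pairing K1 I1 = pairing K1 I2 + pairing K1 J2 - pairing K1 J1 by rewrite -h2; ring.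
have -> : pairing K1 I2 = pairing K2 I2 + pairing J3 I2 - pairing J2 I2 by rewrite -h1; ring.
have -> : pairing J3 K3 = pairing J3 K2 + pairing J3 I2 - pairing J3 I3 by rewrite h3; ring.
by ring.
Qed.

Lemma gexp_right (I2 J2 K2 : composition n) : addc K1 I1 = addc K2 I2 -> addc K2 J1 = addc K3 J2 ->
  addc I2 J2 = addc I3 J3 ->
  wexp M T K1 I1 K2 I2 + wexp L T K2 J1 K3 J2 + wexp L M I2 J2 I3 J3 = gexp.
Proof.
move=> e1 e2 e3; rewrite /gexp /wexp.
have h1 := f_equal (fun X => pairing I2 X) e2.
have h2 := f_equal (fun X => pairing X J1) e1.
have h3 := f_equal (fun X => pairing X K3) e3.
rewrite /= !pairingDr in h1; rewrite /= !pairingDl in h2 h3.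
have := e3 => /vecP/(_ ord0); rewrite !addcE => e30.
have := e1 => /vecP/(_ ord0); rewrite !addcE => e10.
have -> : (I3 ord0)%:Z + (J3 ord0)%:Z = (I2 ord0)%:Z + (J2 ord0)%:Z by lia.
have -> : (I1 ord0)%:Z + (K1 ord0)%:Z = (I2 ord0)%:Z + (K2 ord0)%:Z by lia.
have -> : pairing I1 J1 = pairing K2 J1 + pairing I2 J1 - pairing K1 J1 by rewrite -h2; ring.
have -> : pairing I3 K3 = pairing I2 K3 + pairing J2 K3 - pairing J3 K3 by rewrite h3; ring.
have -> : pairing I2 K3 = pairing I2 K2 + pairing I2 J1 - pairing I2 J2 by rewrite h1; ring.
by ring.
Qed.

Lemma shiftC (a b c d : int) (u : F) : a + b = c + d ->
  q ^ a * (q ^ b * u) = q ^ c * (q ^ d * u).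
Proof. by move=> e; rewrite !mulrA -!expfzDr // e. Qed.

(** The symbols of J2, I2 and K2 cancel in pairs. For I2 the two shifts of v agree because K1 + J2 =
    K2 + J3, which is the origin of the dynamical shifts. *)
Lemma gdyn_left (I2 J2 K2 : composition n) : addc I1 J1 = addc I2 J2 -> addc K1 J2 = addc K2 J3 ->
  addc K2 I2 = addc K3 I3 ->
  dyn L (J2 ord0) (sh T (K1 ord0) * (v * x)) != 0 ->
  dyn M (I2 ord0) (sh T (K2 ord0) * (sh L (J3 ord0) * (v * y))) != 0 ->
  dyn T (K2 ord0) (sh L (J3 ord0) * (v * z)) != 0 ->
  wdyn L M I1 J1 I2 J2 x y (sh T (K1 ord0) * v) * wdyn L T K1 J2 K2 J3 x z v
  * wdyn M T K2 I2 K3 I3 y z (sh L (J3 ord0) * v) = gdyn.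
Proof.
move=> e1 e2 e3 nJ nI nK; rewrite /wdyn /gdyn -!(mulrA (q ^ _) v).
have := e2 => /vecP/(_ ord0); rewrite !addcE => e20.
rewrite (@shiftC (L%:Z - (J2 ord0)%:Z) _ (T%:Z - (K2 ord0)%:Z) (L%:Z - (J3 ord0)%:Z)); last by lia.
rewrite !invfM; set a := (dyn L (J1 ord0) _)^-1; set b := (dyn M (I1 ord0) _)^-1.
set c := (dyn T (K1 ord0) _)^-1; clearbody a b c.
by field; rewrite nJ nI nK.
Qed.

Lemma gdyn_right (I2 J2 K2 : composition n) :
  addc K1 I1 = addc K2 I2 -> addc K2 J1 = addc K3 J2 -> addc I2 J2 = addc I3 J3 ->
  dyn M (I2 ord0) (v * y) != 0 ->
  dyn T (K2 ord0) (sh M (I2 ord0) * (v * z)) != 0 ->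
  dyn L (J2 ord0) (sh M (I2 ord0) * (v * x)) != 0 ->
  wdyn M T K1 I1 K2 I2 y z v * wdyn L T K2 J1 K3 J2 x z (sh M (I2 ord0) * v)
  * wdyn L M I2 J2 I3 J3 x y v = gdyn.
Proof.
move=> e1 e2 e3 nI nK nJ; rewrite /wdyn /gdyn -!(mulrA (q ^ _) v).
have := e3 => /vecP/(_ ord0); rewrite !addcE => e30.
have := e1 => /vecP/(_ ord0); rewrite !addcE => e10.
rewrite (@shiftC (L%:Z - (J2 ord0)%:Z) (M%:Z - (I2 ord0)%:Z) (M%:Z - (I3 ord0)%:Z) (L%:Z - (J3 ord0)%:Z)); last by lia.
rewrite (@shiftC (T%:Z - (K2 ord0)%:Z) _ (M%:Z - (I1 ord0)%:Z) (T%:Z - (K1 ord0)%:Z)); last by lia.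
rewrite !invfM; set a := (dyn L (J1 ord0) _)^-1; set b := (dyn M (I1 ord0) _)^-1.
set c := (dyn T (K1 ord0) _)^-1; clearbody a b c.
by field; rewrite nJ nI nK.
Qed.

Lemma left_term (I2 J2 K2 : composition n) :
  Sadmissible L M I1 J1 I2 J2 ->
  Sdefined q L M I1 J1 I2 J2 x y (sh T (K1 ord0) * v) ->
  Sadmissible L T K1 J2 K2 J3 -> Sdefined q L T K1 J2 K2 J3 x z v ->
  Sadmissible M T K2 I2 K3 I3 ->
  Sdefined q M T K2 I2 K3 I3 y z (sh L (J3 ord0) * v) ->
  Sw L M I1 J1 I2 J2 x y (sh T (K1 ord0) * v) * Sw L T K1 J2 K2 J3 x z v
  * Sw M T K2 I2 K3 I3 y z (sh L (J3 ord0) * v)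
  = q ^ gexp * gdyn * gfact * (WW M T y z (tail K2) (tail I2) (tail I3)
      * WW L T x z (tail K1) (tail J2) (tail J3)
      * WW L M x y (tail I1) (tail J1) (tail J2)).
Proof.
move=> ad1 df1 ad2 df2 ad3 df3.
have [x0 y0 _ _ _] := Sdefined_bounds q0 ad1 df1.
have [_ z0 nJ2 _ _] := Sdefined_bounds q0 ad2 df2.
have [_ _ nI2 nK2 _] := Sdefined_bounds q0 ad3 df3.
rewrite !Sweight_decomp //.
have /and5P[/eqP e1 _ _ _ _] := ad1; have /and5P[/eqP e2 _ _ _ _] := ad2.
have /and5P[/eqP e3 _ _ _ _] := ad3.
rewrite -(mulrA (q ^ _) v) in nI2; rewrite -(mulrA (q ^ _) v) in nK2.
rewrite -(gexp_left e1 e2 e3) -(gdyn_left e1 e2 e3 nJ2 nI2 nK2).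
rewrite !expfzDr // /gfact.
move: (qfact_neq0 q1 I2) (qfact_neq0 q1 J2) (qfact_neq0 q1 K2).
move: (qfact_neq0 q1 I3) (qfact_neq0 q1 J3) (qfact_neq0 q1 K3).
move: (q ^ _) (q ^ _) (q ^ _) (wdyn _ _ _ _ _ _ _ _ _) (wdyn _ _ _ _ _ _ _ _ _) (wdyn _ _ _ _ _ _ _ _ _).
move: (WW _ _ _ _ _ _ _) (WW _ _ _ _ _ _ _) (WW _ _ _ _ _ _ _) => *.
by field; apply/and5P; split=> //; apply/andP.
Qed.

Lemma right_term (I2 J2 K2 : composition n) :
  Sadmissible M T K1 I1 K2 I2 -> Sdefined q M T K1 I1 K2 I2 y z v ->
  Sadmissible L T K2 J1 K3 J2 ->
  Sdefined q L T K2 J1 K3 J2 x z (sh M (I2 ord0) * v) ->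
  Sadmissible L M I2 J2 I3 J3 -> Sdefined q L M I2 J2 I3 J3 x y v ->
  Sw M T K1 I1 K2 I2 y z v * Sw L T K2 J1 K3 J2 x z (sh M (I2 ord0) * v)
  * Sw L M I2 J2 I3 J3 x y v
  = q ^ gexp * gdyn * gfact * (WW L M x y (tail I2) (tail J2) (tail J3)
      * WW L T x z (tail K2) (tail J1) (tail J2)
      * WW M T y z (tail K1) (tail I1) (tail I2)).
Proof.
move=> ad1 df1 ad2 df2 ad3 df3.
have [y0 z0 _ _ _] := Sdefined_bounds q0 ad1 df1.
have [x0 _ _ nK2 _] := Sdefined_bounds q0 ad2 df2.
have [_ _ nJ2 nI2 _] := Sdefined_bounds q0 ad3 df3.
rewrite !Sweight_decomp //.
have /and5P[/eqP e1 _ _ _ _] := ad1; have /and5P[/eqP e2 _ _ _ _] := ad2.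
have /and5P[/eqP e3 _ _ _ _] := ad3.
rewrite -(mulrA (q ^ _) v) in nK2.
rewrite -(gexp_right e1 e2 e3) -(gdyn_right e1 e2 e3 nI2 nK2 nJ2).
rewrite !expfzDr // /gfact.
move: (qfact_neq0 q1 I2) (qfact_neq0 q1 J2) (qfact_neq0 q1 K2).
move: (qfact_neq0 q1 I3) (qfact_neq0 q1 J3) (qfact_neq0 q1 K3).
move: (q ^ _) (q ^ _) (q ^ _) (wdyn _ _ _ _ _ _ _ _ _) (wdyn _ _ _ _ _ _ _ _ _) (wdyn _ _ _ _ _ _ _ _ _).
move: (WW _ _ _ _ _ _ _) (WW _ _ _ _ _ _ _) (WW _ _ _ _ _ _ _) => *.
by field; apply/and5P; split=> //; apply/andP.
Qed.

End DynamicalYangBaxter.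

(** * From sums over triples of compositions to sums over one tail *)

Section PartTwo.
Variables (F : fieldType) (q : F).
Hypotheses (q0 : q != 0) (q1 : forall k, (0 < k)%N -> q ^+ k != 1).
Variables (n L M T : nat) (x y z v : F) (I1 J1 K1 I3 J3 K3 : composition n).
Local Notation qp := (qpoch q).
Local Notation WW := (core_weight q).
Local Notation Sw := (Sweight q).
Local Notation sh N k := (q ^ (N%:Z - k%:Z)).

Hypothesis left_def : forall I2 J2 K2 : composition n,
  [/\ Sdefined q L M I1 J1 I2 J2 x y (sh T (K1 ord0) * v),
      Sdefined q L T K1 J2 K2 J3 x z v &
      Sdefined q M T K2 I2 K3 I3 y z (sh L (J3 ord0) * v)].
Hypothesis right_def : forall I2 J2 K2 : composition n,
  [/\ Sdefined q M T K1 I1 K2 I2 y z v,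
      Sdefined q L T K2 J1 K3 J2 x z (sh M (I2 ord0) * v) &
      Sdefined q L M I2 J2 I3 J3 x y v].

Let lterm (t : composition n * composition n * composition n) : F :=
  let: (I2, J2, K2) := t in
  Sw L M I1 J1 I2 J2 x y (sh T (K1 ord0) * v) * Sw L T K1 J2 K2 J3 x z v
  * Sw M T K2 I2 K3 I3 y z (sh L (J3 ord0) * v).
Let rterm (t : composition n * composition n * composition n) : F :=
  let: (I2, J2, K2) := t in
  Sw M T K1 I1 K2 I2 y z v * Sw L T K2 J1 K3 J2 x z (sh M (I2 ord0) * v)
  * Sw L M I2 J2 I3 J3 x y v.

Let ladm (I2 J2 K2 : composition n) := [/\ Sadmissible L M I1 J1 I2 J2,
  Sadmissible L T K1 J2 K2 J3 & Sadmissible M T K2 I2 K3 I3].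
Let radm (I2 J2 K2 : composition n) := [/\ Sadmissible M T K1 I1 K2 I2,
  Sadmissible L T K2 J1 K3 J2 & Sadmissible L M I2 J2 I3 J3].

Lemma Sweight_adm N N' (A B C D : composition n) a b c :
  Sw N N' A B C D a b c != 0 -> Sadmissible N N' A B C D.
Proof. by rewrite /Sweight; case: ifP => //; rewrite eqxx. Qed.

Let lterm_neq0 I2 J2 K2 : lterm (I2, J2, K2) != 0 -> ladm I2 J2 K2.
Proof.
rewrite /lterm !mulf_eq0 !negb_or => /andP[/andP[h1 h2] h3].
by split; [exact: Sweight_adm h1 | exact: Sweight_adm h2 | exact: Sweight_adm h3].
Qed.

Let rterm_neq0 I2 J2 K2 : rterm (I2, J2, K2) != 0 -> radm I2 J2 K2.
Proof.
rewrite /rterm !mulf_eq0 !negb_or => /andP[/andP[h1 h2] h3].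
by split; [exact: Sweight_adm h1 | exact: Sweight_adm h2 | exact: Sweight_adm h3].
Qed.

(** Necessary conditions for either side to have a nonzero term; when they fail both sums are 0. *)
Let boundary := [/\ [/\ wt I1 = M, wt J1 = L & wt K1 = T],
  [/\ wt I3 = M, wt J3 = L & wt K3 = T] &
  addc (addc J3 I3) K3 = addc (addc K1 I1) J1].

Let ladm_boundary I2 J2 K2 : ladm I2 J2 K2 -> boundary.
Proof.
case=> /and5P[/eqP e1 /eqP ? _ /eqP ? _] /and5P[/eqP e2 /eqP ? _ _ /eqP ?].
case/and5P=> [/eqP e3 _ /eqP ? _ /eqP ?]; split=> //.
apply/vecP=> i; move/vecP: e1 => /(_ i); move/vecP: e2 => /(_ i); move/vecP: e3 => /(_ i).
by rewrite !vecE; natlia.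
Qed.

Let radm_boundary I2 J2 K2 : radm I2 J2 K2 -> boundary.
Proof.
case=> /and5P[/eqP e1 /eqP ? _ /eqP ? _] /and5P[/eqP e2 _ /eqP ? /eqP ? _].
case/and5P=> [/eqP e3 _ /eqP ? _ /eqP ?]; split=> //.
apply/vecP=> i; move/vecP: e1 => /(_ i); move/vecP: e2 => /(_ i); move/vecP: e3 => /(_ i).
by rewrite !vecE; natlia.
Qed.

Lemma addc_comp_eq (A B C D : composition n) : wt A = wt C -> wt B = wt D ->
  addc (tail A) (tail B) = addc (tail C) (tail D) -> addc A B = addc C D.
Proof.
move=> eA eB e; apply: compP; last by rewrite !tail_addc.
have := f_equal (@wt n) e; rewrite !wt_addc !addcE.
by move: eA eB; rewrite !wt_comp; natlia.
Qed.

Lemma Sadmissible_intro N N' (A B C D : composition n) :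
  wt A = N' -> wt C = N' -> wt B = N -> wt D = N ->
  addc (tail A) (tail B) = addc (tail C) (tail D) -> Sadmissible N N' A B C D.
Proof.
move=> eA eC eB eD e; rewrite /Sadmissible eA eB eC eD !eqxx !andbT.
by apply/eqP/addc_comp_eq; rewrite ?eA ?eB.
Qed.

Lemma Sadmissible_tail N N' (A B C D : composition n) : Sadmissible N N' A B C D ->
  addc (tail A) (tail B) = addc (tail C) (tail D).
Proof. by case/and5P=> /eqP e _ _ _ _; rewrite -!tail_addc e. Qed.

Section Boundary.
Hypothesis bd : boundary.

Local Notation tI1 := (tail I1).
Local Notation tJ1 := (tail J1).
Local Notation tK1 := (tail K1).
Local Notation tI3 := (tail I3).
Local Notation tJ3 := (tail J3).
Local Notation tK3 := (tail K3).

Let ltot : addc (addc tJ3 tI3) tK3 = addc (addc tK1 tI1) tJ1.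
Proof. by case: bd => _ _ e; rewrite -!tail_addc e. Qed.

Let le_tails : [/\ (wt tI3 <= M)%N, (wt tJ3 <= L)%N & (wt tK3 <= T)%N].
Proof. by case: bd => _ [<- <- <-] _; rewrite !wt_tail_le. Qed.

Let ladm_intro (i j k : {ffun 'I_n -> nat}) : addc k i = addc tI3 tK3 ->
  addc tK1 j = addc tJ3 k -> (wt j <= L)%N -> (wt i <= M)%N -> (wt k <= T)%N ->
  ladm (extc M i) (extc L j) (extc T k).
Proof.
case: bd => [[wI1 wJ1 wK1] [wI3 wJ3 wK3] _] e1 e2 jL iM kT.
split; apply: Sadmissible_intro; rewrite ?wt_extc ?tail_extc //.
- apply/vecP=> l; move/vecP: ltot => /(_ l); move/vecP: e1 => /(_ l); move/vecP: e2 => /(_ l).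
  by rewrite !vecE; natlia.
- by rewrite e2; apply/vecP=> l; rewrite !vecE addnC.
- by rewrite e1; apply/vecP=> l; rewrite !vecE addnC.
Qed.

Let radm_intro (i j k : {ffun 'I_n -> nat}) : addc i j = addc tJ3 tI3 ->
  addc k tJ1 = addc j tK3 -> (wt j <= L)%N -> (wt i <= M)%N -> (wt k <= T)%N ->
  radm (extc M i) (extc L j) (extc T k).
Proof.
case: bd => [[wI1 wJ1 wK1] [wI3 wJ3 wK3] _] e1 e2 jL iM kT.
split; apply: Sadmissible_intro; rewrite ?wt_extc ?tail_extc //.
- apply/vecP=> l; move/vecP: ltot => /(_ l); move/vecP: e1 => /(_ l); move/vecP: e2 => /(_ l).
  by rewrite !vecE; natlia.
- by rewrite e2; apply/vecP=> l; rewrite !vecE addnC.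
- by rewrite e1; apply/vecP=> l; rewrite !vecE addnC.
Qed.

Let G := q ^ gexp L M T I1 J1 K1 I3 J3 K3 * gdyn q L M T x y z v I1 J1 K1 I3 J3 K3
  * gfact q I1 J1 K1 I3 J3 K3.

Let left_sum : \sum_(t \in [set: composition n * composition n * composition n]) lterm t =
  G * \sum_(K2 <- box (addc tI3 tK3))
    (let I2 := subc (addc tI3 tK3) K2 in
     let J2 := subc (addc tJ3 K2) tK1 in
     if lec tK1 (addc tJ3 K2) then
       if [&& wt J2 <= L, wt I2 <= M & wt K2 <= T]%N then
         WW M T y z K2 I2 tI3 * WW L T x z tK1 J2 tJ3 * WW L M x y tI1 tJ1 J2
       else 0
     else 0).
Proof.
(* Sizes and conservation leave only the tail k of K2 free; [tr k] rebuilds the triple, and all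
   other triples contribute 0. *)
pose I2 k := subc (addc tI3 tK3) k; pose J2 k := subc (addc tJ3 k) tK1.
pose P k := lec tK1 (addc tJ3 k) && [&& wt (J2 k) <= L, wt (I2 k) <= M & wt k <= T]%N.
pose tr k := (extc M (I2 k), extc L (J2 k), extc T k).
have adm k : lec k (addc tI3 tK3) -> P k ->
    ladm (extc M (I2 k)) (extc L (J2 k)) (extc T k).
  move=> /lecP kle /andP[/lecP K1le /and3P[jL iM kT]].
  apply: ladm_intro => //; apply/vecP=> l; move: (kle l) (K1le l); rewrite !vecE; natlia.
rewrite (@fsbig_seqE _ _ _ [seq tr k | k <- [seq k <- box (addc tI3 tK3) | P k]]) //.
- rewrite big_map big_filter mulr_sumr big_mkcond; apply: eq_box => k kle /=.
  rewrite -/(I2 k) -/(J2 k); have [Pk|] := boolP (P k); last first.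
    by rewrite /P; case: (lec _ _) => /= [/negPf ->|_]; rewrite mulr0.
  have /andP[-> ->] := Pk.
  have [ad1 ad2 ad3] := adm k kle Pk.
  have [df1 df2 df3] := left_def (extc M (I2 k)) (extc L (J2 k)) (extc T k).
  by rewrite /lterm (left_term q0 q1 ad1 df1 ad2 df2 ad3 df3) !tail_extc.
- rewrite map_inj_uniq ?filter_uniq ?box_uniq // => k k' [_ _ e].
  by rewrite -(tail_extc T k) e tail_extc.
move=> [[i j] k] _ nin; apply/eqP/negPn/negP => /lterm_neq0 [ad1 ad2 ad3].
move/negP: nin; apply; apply/mapP; exists (tail k).
  have := Sadmissible_tail ad3 => e3; have := Sadmissible_tail ad2 => e2.
  have ei : I2 (tail k) = tail i.
    by apply/vecP=> l; move/vecP: e3 => /(_ l); rewrite !vecE; natlia.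
  have ej : J2 (tail k) = tail j.
    by apply/vecP=> l; move/vecP: e2 => /(_ l); rewrite !vecE; natlia.
  rewrite mem_filter mem_box /P ei ej.
  have /and5P[_ /eqP <- _ /eqP <- _] := ad3.
  have /and5P[_ _ _ /eqP <- _] := ad2; rewrite !wt_tail_le !andbT.
  apply/andP; split; apply/lecP=> l.
    by move/vecP: e2 => /(_ l); rewrite !vecE; natlia.
  by move/vecP: e3 => /(_ l); rewrite !vecE; natlia.
have := Sadmissible_tail ad3 => e3; have := Sadmissible_tail ad2 => e2.
rewrite /tr; congr (_, _, _).
- rewrite (_ : I2 _ = tail i); last first.
    by apply/vecP=> l; move/vecP: e3 => /(_ l); rewrite !vecE; natlia.
  by have /and5P[_ _ _ /eqP <- _] := ad3; rewrite extc_tail.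
- rewrite (_ : J2 _ = tail j); last first.
    by apply/vecP=> l; move/vecP: e2 => /(_ l); rewrite !vecE; natlia.
  by have /and5P[_ _ _ /eqP <- _] := ad2; rewrite extc_tail.
- by have /and5P[_ /eqP <- _ _ _] := ad3; rewrite extc_tail.
Qed.

Let right_sum : \sum_(t \in [set: composition n * composition n * composition n]) rterm t =
  G * \sum_(I2 <- box (addc tJ3 tI3))
    (let J2 := subc (addc tJ3 tI3) I2 in
     let K2 := subc (addc J2 tK3) tJ1 in
     if lec tJ1 (addc J2 tK3) then
       if [&& wt J2 <= L, wt I2 <= M & wt K2 <= T]%N then
         WW L M x y I2 J2 tJ3 * WW L T x z K2 tJ1 J2 * WW M T y z tK1 tI1 I2
       else 0
     else 0).
Proof.
(* On this side the free tail is that of I2. *)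
pose J2 i := subc (addc tJ3 tI3) i; pose K2 i := subc (addc (J2 i) tK3) tJ1.
pose P i := lec tJ1 (addc (J2 i) tK3) && [&& wt (J2 i) <= L, wt i <= M & wt (K2 i) <= T]%N.
pose tr i := (extc M i, extc L (J2 i), extc T (K2 i)).
have adm i : lec i (addc tJ3 tI3) -> P i ->
    radm (extc M i) (extc L (J2 i)) (extc T (K2 i)).
  move=> /lecP ile /andP[/lecP J1le /and3P[jL iM kT]].
  apply: radm_intro => //; apply/vecP=> l; move: (ile l) (J1le l); rewrite !vecE; natlia.
rewrite (@fsbig_seqE _ _ _ [seq tr k | k <- [seq k <- box (addc tJ3 tI3) | P k]]) //.
- rewrite big_map big_filter mulr_sumr big_mkcond; apply: eq_box => i ile /=.
  rewrite -/(J2 i) -/(K2 i); have [Pi|] := boolP (P i); last first.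
    by rewrite /P; case: (lec _ _) => /= [/negPf ->|_]; rewrite mulr0.
  have /andP[-> ->] := Pi.
  have [ad1 ad2 ad3] := adm i ile Pi.
  have [df1 df2 df3] := right_def (extc M i) (extc L (J2 i)) (extc T (K2 i)).
  by rewrite /rterm (right_term q0 q1 ad1 df1 ad2 df2 ad3 df3) !tail_extc.
- rewrite map_inj_uniq ?filter_uniq ?box_uniq // => k k' [e _ _].
  by rewrite -(tail_extc M k) e tail_extc.
move=> [[i j] k] _ nin; apply/eqP/negPn/negP => /rterm_neq0 [ad1 ad2 ad3].
move/negP: nin; apply.
have := Sadmissible_tail ad3 => e3; have := Sadmissible_tail ad2 => e2.
have ej : J2 (tail i) = tail j.
  by apply/vecP=> l; move/vecP: e3 => /(_ l); rewrite !vecE; natlia.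
have ek : K2 (tail i) = tail k.
  by rewrite /K2 ej; apply/vecP=> l; move/vecP: e2 => /(_ l); rewrite !vecE; natlia.
have /and5P[_ /eqP wi _ /eqP wj _] := ad3.
have /and5P[_ /eqP wk _ _ _] := ad2.
apply/mapP; exists (tail i).
  rewrite mem_filter mem_box /P ej ek -{1}wj -{1}wi -{1}wk !wt_tail_le !andbT.
  apply/andP; split; apply/lecP=> l.
    by move/vecP: e2 => /(_ l); rewrite !vecE; natlia.
  by move/vecP: e3 => /(_ l); rewrite !vecE; natlia.
by rewrite /tr ej ek -{1}wj -{1}wi -{1}wk !extc_tail.
Qed.

Lemma dynamical_yang_baxter_boundary :
  \sum_(t \in [set: composition n * composition n * composition n]) lterm t =
  \sum_(t \in [set: composition n * composition n * composition n]) rterm t.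
Proof.
rewrite left_sum right_sum; congr (_ * _); symmetry.
case: (bd) => [[wI1 wJ1 wK1] [wI3 wJ3 wK3] _].
(* The weight with C = A and D = B is always admissible, and its definedness makes x and y
   nonzero. *)
have [x0 y0] : x != 0 /\ y != 0.
  have [df _ _] := left_def I1 J1 K1.
  by have [] := Sdefined_bounds q0 (Sadmissible_intro wI1 wI1 wJ1 wJ1 erefl) df.
have z0 : z != 0.
  have [df _ _] := right_def I1 J1 K1.
  by have [] := Sdefined_bounds q0 (Sadmissible_intro wK1 wK1 wI1 wI1 erefl) df.
case: le_tails => lI lJ lK.
apply: (special_yang_baxter q0 q1 _ ltot) => //; first by apply/and3P; split.
- move=> i j k e1 e2 jL iM kT; have [ad1 ad2 ad3] := radm_intro e1 e2 jL iM kT.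
  have [df1 df2 df3] := right_def (extc M i) (extc L j) (extc T k).
  have [_ _ _ _ h1] := Sdefined_bounds q0 ad1 df1.
  have [_ _ _ _ h2] := Sdefined_bounds q0 ad2 df2.
  have [_ _ _ _ h3] := Sdefined_bounds q0 ad3 df3.
  by rewrite !tail_extc in h1 h2 h3.
- move=> k i j e1 e2 jL iM kT; have [ad1 ad2 ad3] := ladm_intro e1 e2 jL iM kT.
  have [df1 df2 df3] := left_def (extc M i) (extc L j) (extc T k).
  have [_ _ _ _ h1] := Sdefined_bounds q0 ad1 df1.
  have [_ _ _ _ h2] := Sdefined_bounds q0 ad2 df2.
  have [_ _ _ _ h3] := Sdefined_bounds q0 ad3 df3.
  by rewrite !tail_extc in h1 h2 h3.
Qed.

End Boundary.

Theorem dynamical_yang_baxter :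
  \sum_(t \in [set: composition n * composition n * composition n]) lterm t =
  \sum_(t \in [set: composition n * composition n * composition n]) rterm t.
Proof.
have [bd|nbd] := pselect boundary; first exact: dynamical_yang_baxter_boundary.
rewrite !fsbig1 // => -[[i j] k] _; apply/eqP/negPn/negP.
  by move/rterm_neq0/radm_boundary.
by move/lterm_neq0/ladm_boundary.
Qed.

End PartTwo.

(** * The summation formula and the prefactors of S *)

Section Normalization.
Variables (F : fieldType) (q : F).
Hypotheses (q0 : q != 0) (q1 : forall k, (0 < k)%N -> q ^+ k != 1).
Variable n : nat.
Local Notation vec := {ffun 'I_n -> nat}.
Local Notation qp := (qpoch q).
Local Notation vb := (vb q).
Local Notation WW := (core_weight q).
Local Notation Sw := (Sweight q).
Local Notation qfact := (comp_qfact q).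

(** [vector_sears] with m = E = 0, where the left side reduces to k = 0. *)
Lemma q_saalschutz a u w (D : vec) :
  \sum_(Q <- box D) vb D Q * (qp a (wt Q) * qp w (wt Q) * qp u (wt D - wt Q)
    * u ^+ wt Q * qp (u * w * a * q ^+ wt Q) (wt D - wt Q))
  = qp (u * w) (wt D) * qp (u * a) (wt D).
Proof.
have z0 k : lec (zeroc n) k by apply/lecP=> i; rewrite zerocE.
have := @vector_sears _ _ q0 q1 n a u w (zeroc n) D (zeroc n) (z0 _).
rewrite /sears_lsum (@box_single _ _ _ (zeroc n)) ?z0 //; last first.
  move=> k /lecP kz /eqP; case; apply/vecP=> i.
  by move: (kz i); rewrite !vecE; natlia.
rewrite /sears_rsum /sears_lterm /sears_rterm wt_zeroc !qpoch0 mul1r.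
have -> : subc (zeroc n) (zeroc n) = zeroc n by apply/vecP=> i; rewrite !vecE.
rewrite !vb_zero // !subn0 add0n !expr0 !(mul1r, mulr1) => ->.
apply: eq_box => Q _; rewrite z0 vb_zero // !subn0 !addn0.
by ring.
Qed.

(** Converts the factorials of the entries X_0 = L - |tail X| in S into symbols in q^-L. *)
Lemma qpoch_negpow L k : (k <= L)%N ->
  qp (q ^+ L)^-1 k * qp q (L - k) * q ^+ (L * k) = (-1) ^+ k * q ^+ 'C(k, 2) * qp q L.
Proof.
elim: k => [|k IH] kL.
  by rewrite subn0 qpoch0 muln0 !expr0 !mul1r mulr1.
have {}IH := IH (ltnW kL).
have e : (L - k = (L - k.+1).+1)%N by natlia.
rewrite e qpochSr in IH.
have qL := expf_neq0 L q0.
have qLE : q ^+ L = q ^+ k * q ^+ (L - k.+1) * q.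
  by rewrite -exprD -exprSr; congr (_ ^+ _); natlia.
have hk := expf_neq0 k q0; have hm := expf_neq0 (L - k.+1) q0.
rewrite qpochSr mulnS exprD binS bin1 exprD exprS.
transitivity (- q ^+ k * (qp (q ^+ L)^-1 k * (qp q (L - k.+1) * (1 - q ^+ (L - k.+1) * q)) * q ^+ (L * k))).
  move: (qp _ k) (qp q (L - _)) (q ^+ (L * k)) => *; rewrite qLE.
  by field; rewrite ?hk ?hm ?q0.
by rewrite IH; ring.
Qed.

Definition inv2 (c d : vec) := (\sum_(i < n) \sum_(j < n | (i < j)%N) c i * d j)%N.

Lemma pairing_tail (X Y : composition n) :
  pairing X Y = (X ord0)%:Z * (Y ord0)%:Z - (inv2 (tail Y) (tail X))%:Z.
Proof.
rewrite /pairing big_ord_recl big_pred0 ?add0r => [|j]; last by [].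
congr (_ - _); rewrite /inv2 (big_morph Posz PoszD (erefl _)).
apply: eq_bigr => i _; rewrite (big_morph Posz PoszD (erefl _)).
rewrite big_mkcond big_ord_recl /= add0r [RHS]big_mkcond; apply: eq_bigr => j _.
by rewrite /bump /= !add1n ltnS; case: ifP => // _; rewrite !ffunE PoszM mulrC.
Qed.

Definition qfactv (c : vec) : F := \prod_(i < n) qp q (c i).

Lemma qfactv_neq0 c : qfactv c != 0.
Proof. by apply/prodf_neq0 => i _; apply: qq_neq0. Qed.

Lemma vb_inv2 (c d : vec) : vb (addc c d) d = q ^+ inv2 c d *
  (qfactv (addc c d) / (qfactv c * qfactv d)).
Proof.
rewrite vbE; congr (_ ^+ _ * _).
  by apply: eq_bigr => i _; apply: eq_bigr => j _; rewrite vecE addnK.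
rewrite /qfactv -big_split -prodfV -big_split; apply: eq_bigr => i _ /=.
by rewrite vecE addnK [X in _ / X]mulrC.
Qed.

Lemma qfact_tail (X : composition n) : qfact X = qp q (X ord0) * qfactv (tail X).
Proof.
rewrite /comp_qfact big_ord_recl; congr (_ * _).
by apply: eq_bigr => i _; rewrite ffunE.
Qed.

Lemma bin2_add a b : ('C(a + b, 2) = 'C(a, 2) + 'C(b, 2) + a * b)%N.
Proof.
elim: b => [|b IH]; first by rewrite addn0 muln0 bin0n !addn0.
by rewrite addnS !binS !bin1 IH; natlia.
Qed.

(** Factorials of index 0 become symbols in q^-L and q^-M, the others become [vb]. Up to the second
    factor on the left, which depends only on A and B, the prefactors reduce to a function of |tail
    C| times [vb] at tail D, the form that can be summed. *)
Lemma weight_const L M (A B C D : composition n) :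
  Sadmissible L M A B C D ->
  qfact A * qfact B * q ^ wexp L M A B C D
  / (qfact C * qfact D * qp (q ^+ L)^-1 (wt (tail D)))
  * (vb (addc (tail A) (tail B)) (tail A) * qp (q ^+ L)^-1 (wt (tail B))
     * qp (q ^+ M)^-1 (wt (tail A)) * q ^+ (M * (wt (tail A) + wt (tail B)))
     / q ^+ (L * wt (tail A)))
  = q ^+ (M * wt (tail C)) * qp (q ^+ M)^-1 (wt (tail C))
    * vb (addc (tail A) (tail B)) (tail D).
Proof.
move=> adm; have := adm => /and5P[/eqP eABCD /eqP wA /eqP wC /eqP wB /eqP wD].
have et := f_equal (@tail n) eABCD; rewrite !tail_addc in et.
rewrite wt_comp in wA; rewrite wt_comp in wB.
rewrite wt_comp in wC; rewrite wt_comp in wD.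
rewrite {2}et vb_inv2 (_ : addc (tail A) (tail B) = addc (tail B) (tail A)); last first.
  by apply/vecP=> i; rewrite !vecE addnC.
rewrite vb_inv2 (_ : addc (tail B) (tail A) = addc (tail C) (tail D)); last first.
  by rewrite -et; apply/vecP=> i; rewrite !vecE addnC.
rewrite !qfact_tail.
have ew := f_equal (@wt n) et; rewrite !wt_addc in ew.
set a := wt (tail A) in wA ew *; set b := wt (tail B) in wB ew *.
set c := wt (tail C) in wC ew *; set d := wt (tail D) in wD ew *.
have eA : A ord0 = (M - a)%N by rewrite -wA addnK.
have eB : B ord0 = (L - b)%N by rewrite -wB addnK.
have eC : C ord0 = (M - c)%N by rewrite -wC addnK.
have eD : D ord0 = (L - d)%N by rewrite -wD addnK.
have lea : (a <= M)%N by rewrite -wA leq_addl.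
have leb : (b <= L)%N by rewrite -wB leq_addl.
have lec : (c <= M)%N by rewrite -wC leq_addl.
have led : (d <= L)%N by rewrite -wD leq_addl.
set eab := inv2 (tail B) (tail A); set ecd := inv2 (tail C) (tail D).
have ewx : q ^ wexp L M A B C D =
    q ^+ (a * b) * q ^+ (L * c) * q ^+ ecd / (q ^+ (M * b) * q ^+ (d * c) * q ^+ eab).
  rewrite -!exprD -(exprzB q0); congr (exprz _ _).
  rewrite /wexp !pairing_tail -/eab -/ecd !PoszD !PoszM.
  have -> : (A ord0)%:Z = M%:Z - a%:Z by rewrite eA subzn.
  have -> : (B ord0)%:Z = L%:Z - b%:Z by rewrite eB subzn.
  have -> : (C ord0)%:Z = M%:Z - c%:Z by rewrite eC subzn.
  have -> : (D ord0)%:Z = L%:Z - d%:Z by rewrite eD subzn.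
  have -> : c%:Z = a%:Z + b%:Z - d%:Z by clear -ew; lia.
  by ring.
rewrite ewx eA eB eC eD.
have qq (k : nat) := qq_neq0 q1 k.
have qn0 (k : nat) := expf_neq0 k q0.
have np N k : (k <= N)%N -> qp (q ^+ N)^-1 k =
    (-1) ^+ k * q ^+ 'C(k, 2) * qp q N / (qp q (N - k) * q ^+ (N * k)).
  move=> kN; rewrite -(qpoch_negpow kN) -[_ * _ * q ^+ (N * k)]mulrA mulfK //.
  by rewrite mulf_neq0.
rewrite !np //.
(* The relation |a| + |b| = |c| + |d| enters through signs, binomials and powers of q^L. *)
have hb := f_equal (fun k : nat => (-1) ^+ k * q ^+ 'C(k, 2) : F) ew.
rewrite /= !bin2_add !exprD in hb.
have hL := f_equal (fun k : nat => q ^+ (L * k)) ew; rewrite /= !mulnDr !exprD in hL.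
have hd : (-1) ^+ d * q ^+ 'C(d, 2) != 0 by rewrite mulf_neq0 // signr_eq0.
have fv (k : vec) := qfactv_neq0 k.
rewrite mulnDr exprD [(d * c)%N]mulnC.
move: hb hL hd; rewrite mulf_eq0 negb_or => hb hL /andP[hd1 hd2].
have {}hb : (-1) ^+ a * (-1) ^+ b * (q ^+ 'C(a, 2) * q ^+ 'C(b, 2) * q ^+ (a * b)) =
  (-1) ^+ c * (-1) ^+ d * (q ^+ 'C(c, 2) * q ^+ 'C(d, 2) * q ^+ (c * d)) by [].
(* The factorials are cancelled first; then [hb] and [hL] trade the pair a, b for c, d. *)
transitivity ((-1) ^+ a * (-1) ^+ b * (q ^+ 'C(a, 2) * q ^+ 'C(b, 2) * q ^+ (a * b))
  * (q ^+ (L * c) * q ^+ (L * d)) / (q ^+ (L * a) * q ^+ (L * b))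
  / ((-1) ^+ d * q ^+ 'C(d, 2) * q ^+ (c * d))
  * q ^+ ecd * qp q M / qp q (M - c) * (qfactv (addc (tail C) (tail D)) / (qfactv (tail C) * qfactv (tail D)))).
  move: (qq (M - a)%N) (qq (L - b)%N) (qq (M - c)%N) (qq (L - d)%N) (qq L).
  move: (qn0 (L * a)%N) (qn0 (L * b)%N) (qn0 (L * d)%N) (qn0 (M * a)%N) (qn0 (M * b)%N).
  move: (qn0 (c * d)%N) (qn0 eab) (fv (tail A)) (fv (tail B)) (fv (tail C)) (fv (tail D)).
  move: hd1 hd2; clear.
  move: ((-1) ^+ a) ((-1) ^+ b) ((-1) ^+ d) (qfactv _) (qfactv _) (qfactv _) (qfactv _) (qfactv _) => *.
  field.
  by do !(apply/andP; split).
rewrite hb hL; move: (qq (M - c)%N) (qn0 (L * c)%N) (qn0 (L * d)%N) (qn0 (M * c)%N) (qn0 (c * d)%N).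
move: (fv (tail C)) (fv (tail D)) hd1 hd2; clear.
move: ((-1) ^+ c) ((-1) ^+ d) (qfactv _) (qfactv _) (qfactv _) => *.
field.
by do !(apply/andP; split).
Qed.

End Normalization.

(** * Evaluation of the double sum over D and P *)

Section DoubleSum.
Variables (F : fieldType) (q : F).
Hypotheses (q0 : q != 0) (q1 : forall k, (0 < k)%N -> q ^+ k != 1).
Variable n : nat.
Local Notation vec := {ffun 'I_n -> nat}.
Local Notation qp := (qpoch q).
Local Notation vb := (vb q).
Variables (L M : nat) (x y v : F) (a b : vec).
Hypotheses (x0 : x != 0) (y0 : y != 0).
Let N := addc a b.
Hypotheses (hxy : qp (x / (q ^+ M * y)) (wt N) != 0)
  (hvx : qp (v * x) (wt N) != 0) (hvy : qp (v * y) (wt N) != 0).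

(* The sum over P in S, times (q^-L; q)_|d|. *)
Definition cleared (d : vec) : F :=
  \sum_(P <- box (minc a d)) vb d P * (qp (y / (q ^+ L * x)) (wt P) *
     qp (x / y) (wt d - wt P) * (x / y) ^+ wt P) *
     Phi q (subc a P) (subc (addc a b) P) (q ^+ L * x / (q ^+ M * y)) (x / (q ^+ M * y)).

Let qL := expf_neq0 L q0.
Let qM := expf_neq0 M q0.

(** [q_saalschutz] over k = d - P with parameters x/y, q^-M, q^(|P|+M) v y: their product q^|P| v x
    completes (v x)_|d| to (v x)_|N|. *)
Let inner (P : vec) : lec P N ->
  \sum_(k <- box (subc N P)) vb (subc N P) k *
    (qp (q ^+ M * (v * y)) (wt P + wt k) / qp (v * x) (wt P + wt k)
     * (q ^+ (M * (wt N - (wt P + wt k))) * qp (q ^+ M)^-1 (wt N - (wt P + wt k)))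
     * qp (x / y) (wt k))
  = qp (q ^+ M * (v * y)) (wt P) * q ^+ (M * (wt N - wt P)) / qp (v * x) (wt N)
    * (qp (q ^+ wt P * (v * y)) (wt N - wt P) * qp (x / (q ^+ M * y)) (wt N - wt P)).
Proof.
move=> PN; have wP := wt_le PN.
have := q_saalschutz q0 q1 (x / y) (q ^+ M)^-1 (q ^+ wt P * (q ^+ M * (v * y))) (subc N P).
have -> : (q ^+ M)^-1 * (q ^+ wt P * (q ^+ M * (v * y))) = q ^+ wt P * (v * y) by field.
have -> : (q ^+ M)^-1 * (x / y) = x / (q ^+ M * y) by field; rewrite ?qM ?y0.
rewrite !wt_subc // => <-; rewrite mulr_sumr; apply: eq_box => k kle.
have wk := wt_le kle; rewrite wt_subc // in wk.
have e1 : (wt N - (wt P + wt k) = wt N - wt P - wt k)%N by natlia.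
have e2 : (wt N = wt P + wt k + (wt N - wt P - wt k))%N by natlia.
have hpk : qp (v * x) (wt P + wt k) != 0 by apply: qpoch_neq0W hvx; natlia.
have hv : qp (v * x) (wt N) = qp (v * x) (wt P + wt k) *
    qp (q ^+ wt P * (v * y) * (x / y) * q ^+ wt k) (wt N - wt P - wt k).
  rewrite {1}e2 qpochD; congr (_ * qp _ _); rewrite exprD.
  by field; rewrite ?y0.
have hr : qp (q ^+ wt P * (v * y) * (x / y) * q ^+ wt k) (wt N - wt P - wt k) != 0.
  by move: hvx; rewrite hv mulf_eq0 negb_or => /andP[].
rewrite e1 qpochD hv.
have -> : q ^+ (M * (wt N - wt P)) = q ^+ (M * (wt N - wt P - wt k)) * q ^+ (M * wt k).
  by rewrite -exprD -mulnDr subnK //; natlia.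
have -> : (q ^+ M)^-1 ^+ wt k = (q ^+ (M * wt k))^-1 by rewrite exprVn -exprM.
have hMk := expf_neq0 (M * wt k) q0.
move: hpk hr hMk; move: (vb _ _) (q ^+ (M * _)) (q ^+ (M * _)) => *.
by field; do !(apply/andP; split).
Qed.

(** [q_saalschutz] with parameters y/(q^L x), q^L x/(q^M y), q^M v y: their product v y completes (v
    y)_|P| to (v y)_|a|. *)
Let outer : \sum_(P <- box a) vb a P * (qp (y / (q ^+ L * x)) (wt P) * (x / y) ^+ wt P
    * qp (q ^+ L * x / (q ^+ M * y)) (wt a - wt P) / q ^+ (L * (wt a - wt P))
    * qp (q ^+ M * (v * y)) (wt P) * q ^+ (M * (wt N - wt P)) / qp (v * y) (wt P))
  = q ^+ (M * wt N) / q ^+ (L * wt a) / qp (v * y) (wt a)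
    * (qp (q ^+ L * (v * x)) (wt a) * qp (q ^+ M)^-1 (wt a)).
Proof.
have aN : (wt a <= wt N)%N by rewrite wt_addc leq_addr.
have := q_saalschutz q0 q1 (y / (q ^+ L * x)) (q ^+ L * x / (q ^+ M * y)) (q ^+ M * (v * y)) a.
have -> : q ^+ L * x / (q ^+ M * y) * (q ^+ M * (v * y)) = q ^+ L * (v * x).
  by field; rewrite ?qM ?y0.
have -> : q ^+ L * x / (q ^+ M * y) * (y / (q ^+ L * x)) = (q ^+ M)^-1.
  by field; rewrite ?qM ?y0 ?x0 ?qL.
move=> <-; rewrite mulr_sumr; apply: eq_box => P Pa; have wP := wt_le Pa.
have hvp : qp (v * y) (wt P) != 0 by apply: qpoch_neq0W hvy; natlia.
have hva : qp (v * y) (wt a) != 0 by apply: qpoch_neq0W hvy; natlia.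
have hv : qp (v * y) (wt a) = qp (v * y) (wt P) *
    qp (q ^+ L * (v * x) * (y / (q ^+ L * x)) * q ^+ wt P) (wt a - wt P).
  rewrite -{1}(subnKC wP) qpochD; congr (_ * qp _ _).
  by field; rewrite ?qL ?x0.
have hr : qp (q ^+ L * (v * x) * (y / (q ^+ L * x)) * q ^+ wt P) (wt a - wt P) != 0.
  by move: hva; rewrite hv mulf_eq0 negb_or => /andP[].
rewrite hv.
have -> : (q ^+ L * x / (q ^+ M * y)) ^+ wt P = (x / y) ^+ wt P * q ^+ (L * wt P) / q ^+ (M * wt P).
  rewrite !exprM -exprMn -expr_div_n; congr (_ ^+ _).
  by field; rewrite ?qM ?y0.
have -> : q ^+ (M * wt N) = q ^+ (M * (wt N - wt P)) * q ^+ (M * wt P).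
  by rewrite -exprD -mulnDr subnK //; natlia.
have -> : q ^+ (L * wt a) = q ^+ (L * (wt a - wt P)) * q ^+ (L * wt P).
  by rewrite -exprD -mulnDr subnK.
have h1 := expf_neq0 (M * wt P) q0; have h2 := expf_neq0 (L * wt P) q0.
have h3 := expf_neq0 (L * (wt a - wt P)) q0.
move: hvp hr h1 h2 h3.
move: (vb _ _) (q ^+ (M * _)) (q ^+ (M * _)) (q ^+ (L * _)) (q ^+ (L * _)) ((x / y) ^+ _) => *.
by field; do !(apply/andP; split).
Qed.

(** [vb_assoc] is applied to P <= d <= N to sum over d for fixed P, then to P <= a <= N to take
    [vb N a] out of the sum over P. *)
Lemma double_sum :
  \sum_(d <- box N) qp (q ^+ M * (v * y)) (wt d) / qp (v * x) (wt d)
    * (q ^+ (M * (wt N - wt d)) * qp (q ^+ M)^-1 (wt N - wt d) * vb N d * cleared d)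
  = vb N a * qp (q ^+ L)^-1 (wt b) * qp (q ^+ M)^-1 (wt a) * q ^+ (M * wt N) / q ^+ (L * wt a)
    * (qp (q ^+ L * (v * x)) (wt a) * qp (v * y) (wt N) / (qp (v * x) (wt N) * qp (v * y) (wt a))).
Proof.
have aN : lec a N by apply/lecP=> i; rewrite vecE leq_addr.
have Pan P : lec P a -> lec P N by move=> Pa; apply: lec_trans Pa aN.
pose ph P := Phi q (subc a P) (subc N P) (q ^+ L * x / (q ^+ M * y)) (x / (q ^+ M * y)).
transitivity (\sum_(P <- box a) \sum_(d <- box N | lec P d)
  qp (q ^+ M * (v * y)) (wt d) / qp (v * x) (wt d)
    * (q ^+ (M * (wt N - wt d)) * qp (q ^+ M)^-1 (wt N - wt d) * vb N d *
   (vb d P * (qp (y / (q ^+ L * x)) (wt P) *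
     qp (x / y) (wt d - wt P) * (x / y) ^+ wt P) * ph P))).
  rewrite (exchange_big_dep xpredT) //=; apply: eq_box => d dN.
  rewrite /cleared (box_widen _ (minc_lecl a d)) !mulr_sumr.
  rewrite big_seq_cond [RHS]big_seq_cond; apply: eq_bigl => P.
  rewrite mem_box; apply: andb_id2l => /lecP Pa.
  apply/lecP/lecP => h i; move: (h i) (Pa i); rewrite ?vecE; clear; lia.
transitivity (\sum_(P <- box a) vb N P * qp (y / (q ^+ L * x)) (wt P) * (x / y) ^+ wt P * ph P *
   (qp (q ^+ M * (v * y)) (wt P) * q ^+ (M * (wt N - wt P)) / qp (v * x) (wt N)
    * (qp (q ^+ wt P * (v * y)) (wt N - wt P) * qp (x / (q ^+ M * y)) (wt N - wt P)))).
  apply: eq_box => P Pa; rewrite -inner ?Pan // mulr_sumr (box_shift _ (Pan _ Pa)).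
  rewrite big_seq_cond [RHS]big_seq_cond; apply: eq_bigr => d /andP[].
  rewrite mem_box => dN Pd; rewrite wt_subc // subnKC ?wt_le //.
  have e := vb_assoc q0 q1 Pd dN.
  transitivity (qp (q ^+ M * (v * y)) (wt d) / qp (v * x) (wt d)
    * (q ^+ (M * (wt N - wt d)) * qp (q ^+ M)^-1 (wt N - wt d)) * (vb N d * vb d P)
    * (qp (y / (q ^+ L * x)) (wt P) * qp (x / y) (wt d - wt P) * (x / y) ^+ wt P) * ph P).
    by move: (_^-1) (_^-1) (vb _ _) (vb _ _) (q ^+ (M * _)) => *; ring.
  rewrite e; move: (_^-1) (_^-1) (vb _ _) (vb _ _) (q ^+ (M * _)) => *; ring.
transitivity (vb N a * qp (q ^+ L)^-1 (wt b) * qp (v * y) (wt N) / qp (v * x) (wt N) *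
  \sum_(P <- box a) vb a P * (qp (y / (q ^+ L * x)) (wt P) * (x / y) ^+ wt P
    * qp (q ^+ L * x / (q ^+ M * y)) (wt a - wt P) / q ^+ (L * (wt a - wt P))
    * qp (q ^+ M * (v * y)) (wt P) * q ^+ (M * (wt N - wt P)) / qp (v * y) (wt P))); last first.
  have hva : qp (v * y) (wt a) != 0 by apply: qpoch_neq0W hvy; apply: wt_le.
  rewrite outer; have h1 := expf_neq0 (L * wt a) q0.
  move: hvx hva h1; move: (vb _ _) (q ^+ (M * _)) (q ^+ (L * _)) => *.
  by field; do !(apply/andP; split).
rewrite mulr_sumr; apply: eq_box => P Pa.
have wP := wt_le Pa; have waN := wt_le aN; have wN : wt N = (wt a + wt b)%N := wt_addc a b.
rewrite /ph PhiE !wt_subc ?Pan //.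
have -> : (wt N - wt P - (wt a - wt P) = wt b)%N by natlia.
have -> : (q ^+ L * x / (q ^+ M * y))^-1 * (x / (q ^+ M * y)) = (q ^+ L)^-1.
  by field; rewrite ?qM ?y0 ?x0 ?qL.
have -> : x / (q ^+ M * y) / (q ^+ L * x / (q ^+ M * y)) = (q ^+ L)^-1.
  by field; rewrite ?qM ?y0 ?x0 ?qL.
have -> : (q ^+ L)^-1 ^+ (wt a - wt P) = (q ^+ (L * (wt a - wt P)))^-1 by rewrite exprVn -exprM.
have e := vb_assoc q0 q1 Pa aN.
have hp : qp (x / (q ^+ M * y)) (wt N - wt P) != 0.
  by apply: qpoch_neq0W hxy; rewrite leq_subr.
have hvP : qp (v * y) (wt P) != 0 by apply: qpoch_neq0W hvy; natlia.
have hv : qp (v * y) (wt N) = qp (v * y) (wt P) * qp (q ^+ wt P * (v * y)) (wt N - wt P).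
  by rewrite -qpochD subnKC //; natlia.
transitivity (vb N a * vb a P * (qp (q ^+ L)^-1 (wt b) * qp (v * y) (wt N) / qp (v * x) (wt N) *
  (qp (y / (q ^+ L * x)) (wt P) * (x / y) ^+ wt P
    * qp (q ^+ L * x / (q ^+ M * y)) (wt a - wt P) / q ^+ (L * (wt a - wt P))
    * qp (q ^+ M * (v * y)) (wt P) * q ^+ (M * (wt N - wt P)) / qp (v * y) (wt P)))); last first.
  by move: (_^-1) (_^-1) (_^-1) (vb _ _) (vb _ _) => *; ring.
rewrite e hv; have h3 := expf_neq0 (L * (wt a - wt P)) q0.
move: hvx hvP hp h3.
move: (vb _ _) (vb _ _) (q ^+ (M * _)) (q ^+ (L * _)) ((x / y) ^+ _) => *.
by field; do !(apply/andP; split).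
Qed.

End DoubleSum.

(** * The weights sum to 1 *)

Section PartOne.
Variables (F : fieldType) (q : F).
Hypotheses (q0 : q != 0) (q1 : forall k, (0 < k)%N -> q ^+ k != 1).
Variables (n L M : nat) (x y v : F) (A B : composition n).
Local Notation qp := (qpoch q).
Local Notation vb := (vb q).
Local Notation WW := (core_weight q).
Local Notation Sw := (Sweight q).
Local Notation dyn := (dyn_qpoch q).
Hypotheses (wA : wt A = M) (wB : wt B = L).
Let a := tail A.
Let b := tail B.
Let N := addc a b.

Let aM : (wt a <= M)%N. Proof. by rewrite -wA wt_tail_le. Qed.
Let bL : (wt b <= L)%N. Proof. by rewrite -wB wt_tail_le. Qed.

Lemma dynE (K k : nat) u : (k <= K)%N -> dyn K (K - k) u = qp (q ^+ k * u) (K - k).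
Proof.
by move=> kK; rewrite /dyn_qpoch subzn ?leq_subr // subKn // -exprnP.
Qed.

Let subKz (k K : nat) : (k <= K)%N -> K%:Z - (K - k)%N%:Z = k%:Z.
Proof. by clear; lia. Qed.

(** The pair (C, D) is parametrized by the tail d of D; [inr] says that the tails leave room for
    nonnegative entries of index 0. *)
Let Cc (d : {ffun 'I_n -> nat}) := extc M (subc N d).
Let Dc (d : {ffun 'I_n -> nat}) := extc L d.
Let inr (d : {ffun 'I_n -> nat}) := (wt (subc N d) <= M)%N && (wt d <= L)%N.

Let adm d : lec d N -> inr d -> Sadmissible L M A B (Cc d) (Dc d).
Proof.
move=> /lecP dN /andP[cM dL]; apply: Sadmissible_intro; rewrite ?wt_extc // !tail_extc.
by rewrite -/a -/b -/N; apply/vecP=> i; rewrite [RHS]addcE subcE subnK.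
Qed.

Let cst (d : {ffun 'I_n -> nat}) := q ^ wexp L M A B (Cc d) (Dc d)
  * (comp_qfact q A * comp_qfact q B / (comp_qfact q (Cc d) * comp_qfact q (Dc d))) * WW L M x y a b d.

(** The dynamical factor of the term d is [num d v / den v]; both are kept as functions of t because
    they are polynomial in it. *)
Let num (d : {ffun 'I_n -> nat}) t := dyn L (L - wt d) (t * x) * dyn M (M - wt (subc N d)) (q ^+ wt d * (t * y)).
Let den t := dyn L (L - wt b) (q ^+ wt a * (t * x)) * dyn M (M - wt a) (t * y).

Section Summation.
Hypotheses (x0 : x != 0) (y0 : y != 0) (hxy : qp (x / (q ^+ M * y)) (wt N) != 0).

(** This constant of [weight_const] is also the prefactor in [double_sum]; their agreement is what
    makes the total equal to 1. *)
Let Kc := vb N a * qp (q ^+ L)^-1 (wt b) * qp (q ^+ M)^-1 (wt a) * q ^+ (M * wt N)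
  / q ^+ (L * wt a).

Let Kc_neq0 : Kc != 0.
Proof.
by rewrite !mulf_neq0 ?invr_eq0 ?expf_neq0 ?(vb_neq0 q0 q1) ?qpoch_negpow_neq0.
Qed.

Let cst_clear d : lec d N -> inr d ->
  cst d * Kc = q ^+ (M * (wt N - wt d)) * qp (q ^+ M)^-1 (wt N - wt d) * vb N d
    * cleared q L M x y a b d.
Proof.
move=> dN din; have ad := adm dN din; case/andP: din => cM dL.
have := weight_const q0 q1 ad.
rewrite /Cc /Dc !tail_extc -/a -/b -/N -!wt_addc -/N -/Kc wt_subc // => <-.
have qL := expf_neq0 L q0.
have hL : x / (q ^+ L * x) = (q ^+ L)^-1 by field; rewrite ?qL ?x0.
have hd : qp (x / (q ^+ L * x)) (wt d) != 0 by rewrite hL qpoch_negpow_neq0.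
have := Wk_clear (q ^+ M * y) a b (def_neq0 q0 L x0) y0 hd.
rewrite -/(cleared q L M x y a b d) -/(WW L M x y a b d) hL => <-; rewrite hL in hd.
rewrite /cst; move: (WW _ _ _ _ _ _ _) (q ^ _) Kc (qfact_neq0 q1 (Cc d)) (qfact_neq0 q1 (Dc d)).
by rewrite /Cc /Dc => *; field; do !(apply/andP; split).
Qed.

(** In the form with V before U the cleared sum carries (q^-L;q)_|d|, which is 0 for |d| > L. *)
Let cleared_out d : lec d N -> (wt (subc N d) <= M)%N -> (L < wt d)%N ->
  cleared q L M x y a b d = 0.
Proof.
move=> dN cM dL; have qL := expf_neq0 L q0; have qM := expf_neq0 M q0.
have e : addc a b = addc (subc N d) d.
  by rewrite -/N; apply/vecP=> i; rewrite [RHS]addcE subcE subnK //; move/lecP: dN.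
rewrite /cleared (Wk_alt_cleared q0 q1 x0 (def_neq0 q0 L x0) y0 (def_neq0 q0 M y0) e).
- have -> : x / (q ^+ L * x) = (q ^+ L)^-1 by field; rewrite ?qL ?x0.
  by rewrite (qpoch_negpow_eq0 q0 dL) mul0r.
- by rewrite -e.
have -> : y / (q ^+ M * y) = (q ^+ M)^-1 by field; rewrite ?qM ?y0.
exact: qpoch_negpow_neq0.
Qed.

(** The sum extends to all d below N: an added term contains (q^-M;q)_|N-d| = 0 or is killed by
    [cleared_out]. *)
Let cst_sum t : qp (t * x) (wt N) != 0 -> qp (t * y) (wt N) != 0 ->
  \sum_(d <- box N | inr d) qp (q ^+ M * (t * y)) (wt d) / qp (t * x) (wt d) * cst d
  = qp (q ^+ L * (t * x)) (wt a) * qp (t * y) (wt N) / (qp (t * x) (wt N) * qp (t * y) (wt a)).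
Proof.
move=> htx hty; apply: (mulIf Kc_neq0); rewrite [RHS]mulrC.
rewrite -(double_sum q0 q1 L x0 y0 hxy htx hty) mulr_suml big_mkcond.
apply: eq_box => d dN; have [din|] := boolP (inr d).
  by rewrite -[LHS]mulrA cst_clear.
rewrite /inr negb_and -!ltnNge => /orP[cM|dL].
  by rewrite wt_subc // in cM; rewrite (qpoch_negpow_eq0 q0 cM) !(mulr0, mul0r).
have [cM|cM] := leqP (wt (subc N d)) M.
  by rewrite cleared_out // !mulr0.
by rewrite wt_subc // in cM; rewrite (qpoch_negpow_eq0 q0 cM) !(mulr0, mul0r).
Qed.

Let cof_dyn u K : u != 0 -> cof (fun t => qp (t * u) K != 0).
Proof.
move=> u0; have h := alim_qpoch q K (alimM (alim_id 0) (alim_cst 0 u)).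
apply: alim_cof_neq0 h; rewrite mul0r /qpoch; apply/prodf_neq0 => j _.
by rewrite mulr0 subr0 oner_neq0.
Qed.

(** Both sides are polynomial in t, and at generic t division by symbols in t x and t y reduces the
    identity to [cst_sum]. *)
Lemma dyn_sum t : \sum_(d <- box N | inr d) num d t * cst d = den t.
Proof.
move: t; apply: (polyfun_eq_cof q0 q1).
- apply: polyfun_sum => d; apply: polyfunM; last exact: polyfun_cst.
  by rewrite /num /dyn_qpoch; polyfun_tac.
- by rewrite /den /dyn_qpoch; polyfun_tac.
apply: cofI2 (cof_dyn (wt N + L) x0) (cof_dyn (wt N + M) y0) => t hx hy.
have aN : (wt a <= wt N)%N by rewrite wt_addc leq_addr.
have htx : qp (t * x) (wt N) != 0 by apply: qpoch_neq0W hx; rewrite leq_addr.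
have hty : qp (t * y) (wt N) != 0 by apply: qpoch_neq0W hy; rewrite leq_addr.
have hta : qp (t * y) (wt a) != 0 by apply: qpoch_neq0W aN hty.
have denE : den t = qp (t * x) L * qp (t * y) M / qp (t * y) (wt N) *
    (qp (q ^+ L * (t * x)) (wt a) * qp (t * y) (wt N) / (qp (t * x) (wt N) * qp (t * y) (wt a))).
  rewrite /den !dynE //.
  have e1 : qp (t * x) (wt N) * qp (q ^+ wt b * (q ^+ wt a * (t * x))) (L - wt b) =
      qp (t * x) L * qp (q ^+ L * (t * x)) (wt a).
    rewrite mulrA -exprD addnC -wt_addc -!qpochD; congr qpoch.
    by move: bL; rewrite wt_addc; clear; lia.
  have e2 : qp (t * y) (wt a) * qp (q ^+ wt a * (t * y)) (M - wt a) = qp (t * y) M.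
    by rewrite -qpochD subnKC.
  rewrite -e2; apply: (mulfI htx); rewrite [LHS]mulrA e1.
  by field; rewrite ?htx ?hty ?hta.
rewrite denE -cst_sum // mulr_sumr big_seq_cond [RHS]big_seq_cond.
apply: eq_bigr => d /andP[]; rewrite mem_box => dN /andP[cM dL].
have wd := wt_le dN.
have hd : qp (t * x) (wt d) != 0 by apply: qpoch_neq0W wd htx.
rewrite [RHS]mulrA; congr (_ * _); rewrite /num !dynE //.
have e1 : qp (t * x) (wt d) * qp (q ^+ wt d * (t * x)) (L - wt d) = qp (t * x) L.
  by rewrite -qpochD subnKC.
have e2 : qp (t * y) (wt N) * qp (q ^+ wt (subc N d) * (q ^+ wt d * (t * y))) (M - wt (subc N d)) =
    qp (t * y) M * qp (q ^+ M * (t * y)) (wt d).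
  rewrite mulrA -exprD wt_subc // subnK // -!qpochD; congr qpoch.
  by rewrite wt_subc // in cM; move: cM wd; clear; lia.
rewrite -e1; apply: (mulfI hty); rewrite [LHS]mulrCA e2.
by field; rewrite ?hty ?hd.
Qed.

Lemma num_wdyn d : inr d -> den v != 0 ->
  wdyn q L M A B (Cc d) (Dc d) x y v = num d v / den v.
Proof.
move=> /andP[cM dL]; rewrite /den /num /wdyn /Cc /Dc !extc0.
have -> : A ord0 = (M - wt a)%N by rewrite -wA wt_comp addnK.
have -> : B ord0 = (L - wt b)%N by rewrite -wB wt_comp addnK.
rewrite !subKz // -!exprnP.
by rewrite mulf_eq0 negb_or => /andP[h1 h2]; field; rewrite ?h1 ?h2.
Qed.

End Summation.

Theorem Sweight_normalized : (forall C D : composition n, Sdefined q L M A B C D x y v) ->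
  \sum_(CD \in [set: composition n * composition n])
    (let: (C, D) := CD in Sw L M A B C D x y v) = 1.
Proof.
(* Definedness at C = A, D = B provides all nonvanishing conditions, including that of [den v]. *)
move=> df; have adB : Sadmissible L M A B A B by exact: Sadmissible_intro.
have [x0 y0 h1 h2 hxy] := Sdefined_bounds q0 adB (df A B).
have dn : den v != 0.
  move: h1 h2.
  have -> : A ord0 = (M - wt a)%N by rewrite -wA wt_comp addnK.
  have -> : B ord0 = (L - wt b)%N by rewrite -wB wt_comp addnK.
  rewrite !subKz // -exprnP => h1 h2.
  by rewrite mulf_neq0.
rewrite (@fsbig_seqE _ _ _ [seq (Cc d, Dc d) | d <- [seq d <- box N | inr d]]) //.
- rewrite big_map big_filter; apply: (mulIf dn); rewrite mul1r -[RHS]dyn_sum // mulr_suml.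
  rewrite big_seq_cond [RHS]big_seq_cond; apply: eq_bigr => d /andP[].
  rewrite mem_box => dN din; rewrite Sweight_decomp ?adm // num_wdyn // /cst [tail (Dc d)]tail_extc -/a -/b.
  by move: (WW _ _ _ _ _ _ _) (q ^ _) (_ / (comp_qfact q _ * _)) => *; field; rewrite dn.
- rewrite map_inj_uniq ?filter_uniq ?box_uniq // => k k' [_ e].
  by rewrite -(tail_extc L k) -(tail_extc L k'); exact: (f_equal (@tail n) e).
move=> [C D] _ nin; apply/eqP/negPn/negP => /Sweight_adm ad.
move/negP: nin; apply; apply/mapP; have e := Sadmissible_tail ad.
have /and5P[_ _ /eqP wC _ /eqP wD] := ad.
rewrite -/a -/b -/N in e.
have eC : subc N (tail D) = tail C by rewrite e; apply/vecP=> l; rewrite !vecE addnK.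
exists (tail D).
  rewrite mem_filter mem_box /inr eC -{1}wC -{1}wD !wt_tail_le /=.
  by rewrite e; apply/lecP=> l; rewrite vecE leq_addl.
by rewrite /Cc /Dc eC -{1}wC -{1}wD !extc_tail.
Qed.

End PartOne.

Theorem theorem5p9 (R : realType) (q : complex R) (n : nat) (n_gt0 : (0 < n)%N)
    (q_neq0 : q != 0) (q_not_root1 : forall k : nat, (0 < k)%N -> q ^+ k != 1) :
  (forall (L M : nat) (x y v : complex R) (A B : composition n),
    (0 < L)%N -> (0 < M)%N -> wt A = M -> wt B = L ->
    (forall C D : composition n, Sdefined q L M A B C D x y v) ->
    \sum_(CD \in [set: composition n * composition n])
      (let: (C, D) := CD in Sweight q L M A B C D x y v) = 1)
  /\
  (forall (L M T : nat) (x y z v : complex R)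
      (I1 J1 K1 I3 J3 K3 : composition n),
    (0 < L)%N -> (0 < M)%N -> (0 < T)%N ->
    (forall I2 J2 K2 : composition n,
      [/\ Sdefined q L M I1 J1 I2 J2 x y (q ^ (T%:Z - (K1 ord0)%:Z) * v),
          Sdefined q L T K1 J2 K2 J3 x z v &
          Sdefined q M T K2 I2 K3 I3 y z (q ^ (L%:Z - (J3 ord0)%:Z) * v)]) ->
    (forall I2 J2 K2 : composition n,
      [/\ Sdefined q M T K1 I1 K2 I2 y z v,
          Sdefined q L T K2 J1 K3 J2 x z (q ^ (M%:Z - (I2 ord0)%:Z) * v) &
          Sdefined q L M I2 J2 I3 J3 x y v]) ->
    \sum_(IJK \in [set: composition n * composition n * composition n])
      (let: (I2, J2, K2) := IJK in
       Sweight q L M I1 J1 I2 J2 x y (q ^ (T%:Z - (K1 ord0)%:Z) * v)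
       * Sweight q L T K1 J2 K2 J3 x z v
       * Sweight q M T K2 I2 K3 I3 y z (q ^ (L%:Z - (J3 ord0)%:Z) * v))
    = \sum_(IJK \in [set: composition n * composition n * composition n])
      (let: (I2, J2, K2) := IJK in
       Sweight q M T K1 I1 K2 I2 y z v
       * Sweight q L T K2 J1 K3 J2 x z (q ^ (M%:Z - (I2 ord0)%:Z) * v)
       * Sweight q L M I2 J2 I3 J3 x y v)).
Proof.
split=> [L M x y v A B _ _ wA wB df|L M T x y z v I1 J1 K1 I3 J3 K3 _ _ _ dl dr].
  exact: (Sweight_normalized q_neq0 q_not_root1 wA wB df).
exact: (dynamical_yang_baxter q_neq0 q_not_root1 dl dr).
Qed.
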